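(* Let $(W,S)$ be a finite Coxeter system, let $c\in W$ be a standard Coxeter element, and let $s\in S$ be initial in $c$ (i.e. $\ell(sc)<\ell(c)$). Let $x\in \mathrm{NC}(W,c)$ and $y:=x^{-1}c$. Then $$x^{-1}sx\in N(y)\iff x^{-1}sx\in N(S_c(y)),$$ where $S_c=\mathsf{Read}^{-1}:\mathrm{NC}(W,c)\to \mathrm{Sort}_c(W)$ is the inverse of Reading's bijection.
   Context: $(W,S)$ is a finite Coxeter system, $T=\bigcup_{w\in W}wSw^{-1}$ its set of reflections, $\ell$ and $\ell_T$ the length functions of $W$ with respect to $S$ and $T$. A standard Coxeter element is a product of all the elements of $S$, each once, in some order. The absolute order is: $u\leq_T v$ iff $\ell_T(u)+\ell_T(u^{-1}v)=\ell_T(v)$. $\mathrm{NC}(W,c)=\{x\in W: x\leq_T c\}$; if $x\in\mathrm{NC}(W,c)$ then $x^{-1}c\in\mathrm{NC}(W,c)$. For $y\in W$, $N(y)=\{t\in T:\ell(ty)<\ell(y)\}$. Coxeter sortable elements: fix a reduced expression $s_1\cdots s_n$ of $c$ and let $c^\infty=s_1\cdots s_n|s_1\cdots s_n|\cdots$. The $c$-sorting word of $w\in W$ is the lexicographically first (as a sequence of positions in $c^\infty$) $S$-reduced expression of $w$ appearing as a subword of $c^\infty$. Write it $w_1w_2\cdots w_k$ with $w_i$ the part coming from the $i$-th copy of $c$ ($k$ maximal with $w_k$ nonempty), and regard each $w_i$ also as a subset of $S$. Then $w$ is $c$-sortable if $w_k\subseteq w_{k-1}\subseteq\cdots\subseteq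 w_1$. $\mathrm{Sort}_c(W)$ is the set of $c$-sortable elements (independent of the reduced expression of $c$). Reading's bijection $\mathsf{Read}:\mathrm{Sort}_c(W)\to\mathrm{NC}(W,c)$: for $w$ $c$-sortable with $c$-sorting word $s_{i_1}\cdots s_{i_\ell}$, totally order $N(w)$ so that its $j$-th element is $s_{i_1}\cdots s_{i_{j-1}}s_{i_j}s_{i_{j-1}}\cdots s_{i_1}$. The cover reflections of $w$ are the elements of $\mathrm{Cov}(w)=\{wsw^{-1}: s\in S,\ \ell(ws)<\ell(w)\}\subseteq N(w)$. If $t_1,\dots,t_k$ are the cover reflections listed in this order, then $\mathsf{Read}(w)=t_1t_2\cdots t_k$. It is a known theorem of Reading that this is a bijection onto $\mathrm{NC}(W,c)$; $S_c$ denotes its inverse. *)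

(* Defs.v *)
From HB Require Import structures.
From mathcomp Require Import all_boot all_order all_fingroup.
Set Implicit Arguments.
Unset Strict Implicit.
Unset Printing Implicit Defensive.
Import Order.TTheory.
Local Open Scope group_scope.

(* Bourbaki's definition: S generates W, consists of involutions, and W is
   presented by the relations (s t)^m(s,t) = 1, where m(s,t) is the order of
   s t. The presentation is given by its universal property, over arbitrary
   (possibly infinite) groups H; only the values of f on S matter. Uniqueness
   of phi on W follows from <<S>> = W. *)
Definition coxeter_system (gT : finGroupType) (W : {group gT}) (S : {set gT}) :
    Prop :=
  [/\ <<S>> = W :> {set gT},
      {in S, forall s, #[s] = 2} &
      forall (H : groupType) (f : gT -> H),
        {in S &, forall s t, (f s * f t) ^+ #[s * t] = 1} ->
        exists phi : gT -> H,
          {in W &, {morph phi : u v / u * v}} /\ {in S, phi =1 f}].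

Section Lengths.
Variables (gT : finGroupType) (W : {group gT}) (S : {set gT}).
Implicit Types (A : {set gT}) (u : seq gT) (w x y : gT).

(* The least n such that w is a product of n elements of A. The partial
   products of a shortest word are pairwise distinct, so for w in <<A>> the
   search below #|gT| succeeds; it returns #|gT| for w outside <<A>>. *)
Definition wlength A w : nat := find (fun n => w \in A ^+ n) (iota 0 #|gT|).

Definition reflections : {set gT} := \bigcup_(w in W) (S :^ w^-1).

Definition absolute_le x y : bool :=
  wlength reflections x + wlength reflections (x^-1 * y)
    == wlength reflections y.

Definition NC c : {set gT} := [set x in W | absolute_le x c].

Definition inversions y : {set gT} :=
  [set t in reflections | wlength S (t * y) < wlength S y].

Definition covers w : {set gT} :=
  [set w * s * w^-1 | s in S & wlength S (w * s) < wlength S w].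

Definition reduced_expr w u : bool :=
  [&& all (mem S) u, \prod_(s <- u) s == w & size u == wlength S w].

Definition standard_coxeter_element c : Prop :=
  exists2 u : seq gT, perm_eq u (enum S) & c = \prod_(s <- u) s.

Lemma mem_expgP A (n : nat) w :
  reflect (exists u, [/\ all (mem A) u, \prod_(a <- u) a = w & size u = n])
          (w \in A ^+ n).
Proof.
elim: n w => [|n IHn] w.
  rewrite expg0; apply: (iffP set1gP) => [-> | [u [_ <-]]].
    by exists [::]; rewrite big_nil.
  by move/size0nil->; rewrite big_nil.
rewrite expgS; apply: (iffP mulsgP) => [[a v aA vA ->] |].
  by have [u [uA <- <-]] := elimT (IHn v) vA; exists (a :: u); rewrite /= aA uA big_cons.
case=> -[|a u] [] //= /andP[aA uA] <- [szu].
rewrite big_cons; exists a (\prod_(b <- u) b) => //.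
by apply/IHn; exists u.
Qed.

Lemma wlengthP A w : w \in <<A>> ->
  w \in A ^+ wlength A w /\ forall n, w \in A ^+ n -> wlength A w <= n.
Proof.
move=> /gen_prodgP[n0 [f fA wE]].
have w_pow : exists n, w \in A ^+ n.
  exists n0; apply/mem_expgP; exists [seq f i | i <- index_enum 'I_n0]; split.
  - by apply/allP=> _ /mapP[i _ ->]; apply: fA.
  - by rewrite wE big_map.
  - by rewrite size_map [index_enum _]unlock -enumT size_enum_ord.
have [m wm m_min] := ex_minnP w_pow.
have [u [uA uw um]] := mem_expgP _ _ _ wm.
pose g (i : 'I_m.+1) := \prod_(a <- take i u) a.
have g_neq (i j : 'I_m.+1) : i < j -> g i != g j.
  move=> ltij; apply/eqP=> gij.
  have: w \in A ^+ size (take i u ++ drop j u).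
    apply/mem_expgP; exists (take i u ++ drop j u); split=> //.
      by apply/allP=> a; rewrite mem_cat => /orP[/mem_take|/mem_drop] /(allP uA).
    by rewrite big_cat /= [X in X * _]gij -big_cat cat_take_drop.
  move/m_min; apply/negP; rewrite -ltnNge size_cat size_drop um.
  have := leq_ord j; rewrite size_take_min um; move: ltij.
  by move: (nat_of_ord i) (nat_of_ord j) => a b ltab lebm;
     rewrite (minn_idPl (ltnW (leq_trans ltab lebm))) -[X in _ < X](subnKC lebm) ltn_add2r.
have g_inj : injective g.
  move=> i j gij; apply/val_inj/eqP; case: ltngtP => // /g_neq; rewrite gij eqxx //.
have lt_m : m < #|gT| by rewrite -[m.+1]card_ord; apply: leq_card g_inj.
have has_w : has (fun n => w \in A ^+ n) (iota 0 #|gT|).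
  by apply/hasP; exists m; rewrite ?mem_iota.
have lt_w : wlength A w < #|gT| by rewrite has_find size_iota in has_w.
split=> [|n wn]; first by have := nth_find 0 has_w; rewrite nth_iota.
apply: leq_trans (m_min n wn); rewrite leqNgt; apply/negP=> ltmw.
by have := before_find 0 ltmw; rewrite nth_iota // add0n wm.
Qed.

Lemma reduced_expr_exists w : w \in <<S>> -> exists u, reduced_expr w u.
Proof.
case/wlengthP=> /mem_expgP[u [uS uw su]] _.
by exists u; rewrite /reduced_expr uS uw su !eqxx.
Qed.

End Lengths.

Section Sorting.
Variables (gT : finGroupType) (W : {group gT}) (S : {set gT}).
(* cw is a reduced expression s_1 ... s_n of the Coxeter element c. *)
Variable cw : seq gT.
Implicit Types (u : seq gT) (w y : gT) (p q : seq nat).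

(* Positions in c^infinity are counted from 0. *)
Definition cinf (i : nat) : gT := nth 1 cw (i %% size cw).

Definition reduced_subword w p : bool :=
  sorted ltn p && reduced_expr S w (map cinf p).

(* Positions of the c-sorting word. A reduced subword which skips a whole copy
   of c can be replaced by a lexicographically smaller one (shift its tail one
   copy to the left), so the search can be restricted to the first l(w)
   copies; lemma sorting_positionsP checks this. *)
Definition sorting_positions w : seq nat :=
  let P := fun p : (wlength S w).-tuple 'I_(size cw * wlength S w) =>
    reduced_subword w (map val p) in
  if [pick p | P p &
        [forall q, P q ==>
          ((map val p : seqlexi nat) <= (map val q : seqlexi nat))%O]] is Some p
  then map val p else [::].

Fixpoint compress (n b : nat) p : seq nat :=
  if p is a :: p' then
    let a' := b + (a - b) %% n in a' :: compress n a'.+1 p'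
  else [::].

Lemma compressP (n b : nat) p : 0 < n -> sorted ltn p -> all (leq b) p ->
  [/\ path ltn b (map succn (compress n b p)),
      all (gtn (b + n * size p)) (compress n b p),
      map (modn^~ n) (compress n b p) = map (modn^~ n) p &
      ((compress n b p : seqlexi nat) <= (p : seqlexi nat))%O].
Proof.
move=> n_gt0; elim: p b => [|a p IHp] b //= pth /andP[leba _].
set a' := b + _.
have le_a' : a' <= a by rewrite -[X in _ <= X](subnKC leba) leq_add2l leq_mod.
have lt_a' : a' < b + n by rewrite ltn_add2l ltn_mod.
have sp := path_sorted pth.
have ap : all (leq a'.+1) p.
  move: pth; rewrite (path_sortedE ltn_trans) => /andP[/allP pa _].
  by apply/allP=> i /pa; apply: leq_ltn_trans.
have [sc bc mc lc] := IHp _ sp ap.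
split.
- by rewrite ltnS leq_addr.
- rewrite mulnS addnA (leq_trans lt_a') ?leq_addr //=.
  apply/allP=> i /(allP bc) /= /leq_trans; apply.
  by rewrite leq_add2r.
- by rewrite mc /a' modnDmr subnKC.
- by rewrite lexi_cons leEnat le_a' lc implybT.
Qed.

Lemma sorting_positionsP w : {subset S <= cw} -> w \in <<S>> ->
  reduced_subword w (sorting_positions w) /\
  forall q, reduced_subword w q ->
    ((sorting_positions w : seqlexi nat) <= (q : seqlexi nat))%O.
Proof.
move=> sub_cw w_gen.
set k := wlength S w; set n := size cw.
pose P (p : k.-tuple 'I_(n * k)) := reduced_subword w (map val p).
have size_red q : reduced_subword w q -> size q = k.
  by case/andP=> _ /and3P[_ _ /eqP]; rewrite size_map.
have squeeze q : reduced_subword w q ->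
    exists2 p, P p & ((map val p : seqlexi nat) <= (q : seqlexi nat))%O.
  move=> rq; have sq := size_red q rq.
  have [n0|n_gt0] := posnP n.
    have q0: q = [::].
      case/andP: rq => _ /and3P[+ _ _]; case: (q) => //= a q' /andP[+ _].
      by move/sub_cw; rewrite (size0nil n0).
    have k0 : k = 0 by rewrite -sq q0.
    have ex0 : exists p : k.-tuple 'I_(n * k), map val p = [::].
      by rewrite k0; exists [tuple].
    have [p pE] := ex0; exists p; first by rewrite /P pE -q0.
    by rewrite pE.
  have [sorted_q red_q] := andP rq.
  have [] := @compressP n 0 q n_gt0 sorted_q; first exact/allP.
  set r := compress n 0 q => sr br mr lr.
  have sz : size r = k by rewrite -sq -(size_map (modn^~ n)) mr size_map.
  have br' : all (gtn (n * k)%N) r by rewrite -sq.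
  have [p pE] : exists p : k.-tuple 'I_(n * k), map val p = r.
    have szp : size (pmap insub r : seq 'I_(n * k)) == k.
      by rewrite size_pmap_sub (eqP (etrans (esym (all_count _ _)) br')) sz.
    exists (Tuple szp) => /=; rewrite (pmap_filter (insubK _)).
    by apply/all_filterP/allP=> i /(allP br') /= lti; rewrite insubT.
  exists p; rewrite ?pE // /P pE /reduced_subword.
  have -> : map cinf r = map cinf q.
    have cE s : map cinf s = map (nth 1 cw) (map (modn^~ n) s).
      by rewrite -map_comp.
    by rewrite !cE mr.
  by rewrite red_q andbT; move/path_sorted: sr; rewrite sorted_map.
have [p0 Pp0] : exists p : k.-tuple 'I_(n * k), P p.
  have [u] := reduced_expr_exists w_gen; case/and3P=> uS /eqP uw /eqP uk.
  pose q0 := [seq (i * n)%N + index (nth 1 u i) cw | i <- iota 0 (size u)].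
  have idx i : i < size u -> index (nth 1 u i) cw < n.
    by move=> lti; rewrite index_mem; apply/sub_cw/(allP uS)/mem_nth.
  have q0u : map cinf q0 = u.
    rewrite -map_comp -[RHS](mkseq_nth 1) /mkseq; apply/eq_in_map => i.
    rewrite mem_iota /= => lti; rewrite /cinf modnMDl modn_small ?idx //.
    by rewrite nth_index //; apply/sub_cw/(allP uS)/mem_nth.
  have [] := squeeze q0; last by move=> p; exists p.
  rewrite /reduced_subword q0u /reduced_expr uS uw uk !eqxx !andbT.
  apply/(sortedP 0) => i; rewrite size_map size_iota => ltSi.
  rewrite !(nth_map 0) ?size_iota ?(ltnW ltSi) // !nth_iota ?(ltnW ltSi) //.
  rewrite !add0n mulSn; apply: leq_trans (leq_addr _ _).
  by rewrite addnC ltn_add2r idx // ltnW.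
rewrite /sorting_positions; case: pickP => [p /andP[Pp /forallP min_p] | nop].
  split=> // q rq; have [r Pr ler] := squeeze q rq.
  by apply: le_trans ler; apply: (implyP (min_p r)).
pose F (p : k.-tuple 'I_(n * k)) : seqlexi nat := map val p.
case: (@Order.TotalTheory.arg_minP _ _ _ p0 P F Pp0) => p Pp min_p.
have /idP[] := nop p; rewrite /= -/(P p) Pp /=.
by apply/forallP=> q; apply/implyP=> Pq; apply: min_p.
Qed.

Definition sorting_word w : seq gT := map cinf (sorting_positions w).

(* The letters of the sorting word coming from the (i+1)-st copy of c. *)
Definition sorting_block w (i : nat) : {set gT} :=
  [set:: [seq cinf j | j <- sorting_positions w & j %/ size cw == i]].

(* Blocks of index >= l(w) are empty, so the range of i covers the whole chain
   of inclusions. *)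
Definition sortable : {set gT} :=
  [set w in W | [forall i : 'I_(wlength S w),
                   sorting_block w i.+1 \subset sorting_block w i]].

(* The j-th entry (from 0) is u_0 ... u_(j-1) u_j u_(j-1) ... u_0. *)
Definition inversion_seq u : seq gT :=
  [seq \prod_(r <- take j u ++ nth 1 u j :: rev (take j u)) r
     | j <- iota 0 (size u)].

Definition Read w : gT :=
  \prod_(t <- inversion_seq (sorting_word w) | t \in covers S w) t.

(* The inverse of Read : sortable -> NC W S c; the default value 1 is never
   used on NC W S c because Read is onto. *)
Definition Read_inv y : gT := odflt 1 [pick w in sortable | Read w == y].

End Sorting.

(* Main.v *)
(* Write c = x y with y in NC(W,c), let w be the sortable element with
   Read w = y, and let a_s be the simple root of s. The vector x^-1 a_s is plus
   or minus the root of x^-1 s x, and y^-1 x^-1 a_s = c^-1 a_s is negative, so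
   the claim is that w^-1 x^-1 a_s is negative as well.

   The Cambrian recursion attaches to w a basis A u (-D) of roots with
   w^-1 (A u (-D)) positive, D being the cover roots of w; the reflections in A
   have product x and those in D product y. For the Euler form E of c, the lists
   A and D are unitriangular with nonpositive off-diagonal entries and
   E(A, D) = 0. With c I = - a_s one has E(-, I) = E(a_s, -) = the coordinate
   along a_s. Splitting I = X + Z and a_s = X' + Z' along span A + span D gives
   - x^-1 a_s = y I = X - Z', and back substitution shows that X lies in the cone
   of A and Z' in the cone of D. Hence w^-1 y I is positive.

   That w exists is proved by running the same recursion on factorizations of c
   into n reflections; it terminates because c fixes no nonzero vector, so every
   reflection below c is conjugated to a simple one by some prefix of
   c^infinity. *)
Require Import Defs.
From HB Require Import structures.
From mathcomp Require Import all_boot all_order all_fingroup all_algebra.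
From mathcomp Require Import ring lra zify.
From Stdlib Require Import Rtrigo_def Rtrigo1.
From mathcomp Require Import Rstruct.
Set Implicit Arguments.
Unset Strict Implicit.
Unset Printing Implicit Defensive.
Import Order.TTheory GRing.Theory Num.Theory.
Local Open Scope ring_scope.

(** * The geometric representation *)

(** Write v = x^-1 a_s. Its own sign is unknown, which is why the result is an equivalence: once
    y^-1 v and w^-1 v are both negative, each membership says exactly that v is positive. What is
    needed of the basis A u D is the sign of coefficients, and E supplies it: its pairings with
    positive roots can be recognised as coordinates, hence are nonnegative, and triangularity turns
    nonnegative pairings into nonnegative coefficients. E also survives the recursion, because
    rotating the Coxeter word past s and applying s to both arguments preserves it. For surjectivity
    of [Read] the obstacle is that the recursion may return a factorization other than the given
    one; only the two products agree. The spaces im(x - 1) and im(y - 1) depend on the products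
    alone, and a dimension count recovers from them the number of factors and the span of their
    roots. *)

Section DihedralNumbers.
Local Notation R := Rdefinitions.R.

(* Witnesses: [q m] = 2 cos (pi / m) and [u m k] = sin (k pi / m) / sin (pi / m). *)
Lemma dihedral_numbers : exists (q : nat -> R) (u : nat -> nat -> R),
  [/\ forall m, u m 0%N = 0, forall m, u m 1%N = 1,
      forall m k, u m k.+2 = q m * u m k.+1 - u m k &
      forall m : nat, (1 < m)%N -> [/\ u m m = 0, u m m.+1 = -1, q m * q m != 4 &
        forall k : nat, (k <= m)%N -> 0 <= u m k]].
Proof.
pose th (m : nat) : R := PI / m%:R.
pose q m : R := 2 * cos (th m).
pose f m k : R * R := iter k (fun p => (p.2, q m * p.2 - p.1)) (0, 1).
exists q, (fun m k => (f m k).1); split=> // m m1.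
have m0 : 0 < m%:R :> R by rewrite ltr0n ltnW.
have pi0 : (0 : R) < PI by apply/RltP/PI_RGT_0.
have th0 : 0 < th m by apply: divr_gt0.
have s0 : 0 < sin (th m).
  apply/RltP/sin_gt_0; apply/RltP => //.
  by rewrite /th ltr_pdivrMr // ltr_pMr // ltr1n.
have s2 : sin (th m) * sin (th m) + cos (th m) * cos (th m) = 1 by apply: sin2_cos2.
have sPI : sin PI%R = 0 := sin_PI.
have cPI : cos PI%R = -1 := cos_PI.
have fE (k : nat) : (f m k).1 = sin (k%:R * th m)%R / sin (th m).
  elim/ltn_ind: k => [[|[|k]] IH].
  - by rewrite mul0r (_ : sin 0%R = 0) ?mul0r //; apply: sin_0.
  - by rewrite mul1r divff ?gt_eqF.
  - have -> : (f m k.+2).1 = q m * (f m k.+1).1 - (f m k).1 by [].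
    rewrite (IH k.+1) // (IH k) ?ltnS ?leqnSn // mulrA -mulrBl; congr (_ / _).
    have E (n : nat) : n.+1%:R * th m = n%:R * th m + th m by rewrite mulrS; ring.
    rewrite !E /q !sinD !cosD.
    apply/eqP; rewrite -subr_eq0; apply/eqP.
    transitivity (sin (k%:R * th m)%R *
      (sin (th m) * sin (th m) + cos (th m) * cos (th m) - 1)); first by ring.
    by rewrite s2 subrr mulr0.
have mth : m%:R * th m = PI by rewrite /th mulrC divfK ?gt_eqF.
split.
- by rewrite fE mth sPI mul0r.
- rewrite fE mulrS mulrDl mul1r mth sinD sPI cPI.
  by rewrite mulr0 addr0 mulrN1 mulNr divff // gt_eqF.
- rewrite -subr_eq0.
  have -> : q m * q m - 4 = - 4 * (sin (th m) * sin (th m)).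
    by rewrite -[sin _ * _](addrK (cos (th m) * cos (th m))) s2 /q; ring.
  by rewrite !mulf_neq0 ?oppr_eq0 ?pnatr_eq0 // gt_eqF.
- move=> k km; rewrite fE divr_ge0 ?(ltW s0) //.
  apply/RleP/sin_ge_0; apply/RleP; first by rewrite mulr_ge0 ?ler0n ?ltW.
  by rewrite -mth ler_pM2r // ler_nat.
Qed.

End DihedralNumbers.

Section InvertibleMatrices.
Variables (R : comUnitRingType) (n : nat).

(** The universal property in [coxeter_system] ranges over [groupType], so the reflections have to
    live in such a group; carrying the inverse along makes inversion a swap. *)
Definition gl_pred (p : 'M[R]_n * 'M[R]_n) : bool :=
  (p.1 *m p.2 == 1%:M) && (p.2 *m p.1 == 1%:M).

Record gl := Gl { glP : 'M[R]_n * 'M[R]_n; _ : gl_pred glP }.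

HB.instance Definition _ := [isSub for glP].
HB.instance Definition _ := [Choice of gl by <:].

Fact gl_one_subproof : gl_pred (1%:M, 1%:M).
Proof. by rewrite /gl_pred /= !mulmx1 eqxx. Qed.
Definition gl_one := Gl gl_one_subproof.

Fact gl_inv_subproof (g : gl) : gl_pred ((glP g).2, (glP g).1).
Proof. by case: g => p /= /andP[pq qp]; apply/andP. Qed.
Definition gl_inv g := Gl (gl_inv_subproof g).

Fact gl_mul_subproof (g h : gl) :
  gl_pred ((glP g).1 *m (glP h).1, (glP h).2 *m (glP g).2).
Proof.
case: g h => [[a a'] /=] /andP[/= /eqP aa' /eqP a'a].
case=> [[b b'] /=] /andP[/= /eqP bb' /eqP b'b]; apply/andP; split => /=.
  by rewrite mulmxA -(mulmxA a) bb' mulmx1 aa'.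
by rewrite mulmxA -(mulmxA b') a'a mulmx1 b'b.
Qed.
Definition gl_mul g h := Gl (gl_mul_subproof g h).

Fact gl_mulA : associative gl_mul.
Proof. by move=> g h k; apply: val_inj; rewrite /= !mulmxA. Qed.
Fact gl_mul1 : left_id gl_one gl_mul.
Proof. by move=> [[a b] H]; apply: val_inj; rewrite /= mul1mx mulmx1. Qed.
Fact gl_mulr1 : right_id gl_one gl_mul.
Proof. by move=> [[a b] H]; apply: val_inj; rewrite /= mul1mx mulmx1. Qed.
Fact gl_mulV : left_inverse gl_one gl_inv gl_mul.
Proof. by move=> [[a b] H]; apply: val_inj => /=; case/andP: H => /= _ /eqP ->. Qed.
Fact gl_mulVr : right_inverse gl_one gl_inv gl_mul.
Proof. by move=> [[a b] H]; apply: val_inj => /=; case/andP: H => /= /eqP -> _. Qed.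
HB.instance Definition _ :=
  isGroup.Build gl gl_mulA gl_mul1 gl_mulr1 gl_mulV gl_mulVr.

End InvertibleMatrices.

Section Alternating.
Variables (R : realFieldType) (q : R) (u : nat -> R) (m : nat).
Hypotheses (m_gt1 : (1 < m)%N) (u0 : u 0%N = 0) (u1 : u 1%N = 1).
Hypothesis uS : forall k, u k.+2 = q * u k.+1 - u k.
Hypotheses (um : u m = 0) (umS : u m.+1 = -1) (q4 : q * q != 4).
Variable d : nat -> R.
Hypothesis dS : forall k, d k.+2 = q * d k.+1 - d k.

Lemma alt_lin k : d k.+1 = u k.+1 * d 1%N - u k * d 0%N.
Proof.
elim/ltn_ind: k => [[|[|k]] IH]; first by rewrite u0 u1; ring.
  by rewrite dS uS u0 u1; ring.
by rewrite dS (IH k.+1) // (IH k) ?ltnS ?leqnSn // !uS; ring.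
Qed.

(** Reading the recurrence backwards at m gives u_(m-1) = 1; this fixes the two values from which
    the sign change propagates. *)
Lemma alt_antiperiod k : d (k + m)%N = - d k.
Proof.
have um1 : u m.-1 = 1.
  have := uS m.-1; rewrite !prednK ?(ltnW m_gt1) // umS um => H.
  by apply: (can_inj (@opprK _)); lra.
elim/ltn_ind: k => [[|[|k]] IH].
- have -> : (0 + m = m.-1.+1)%N by lia.
  by rewrite alt_lin um1 prednK ?(ltnW m_gt1) // um; ring.
- by rewrite add1n alt_lin umS um; ring.
- by rewrite !addSn !dS -addSn (IH k.+1) // (IH k) ?ltnS ?leqnSn //; ring.
Qed.

(** By periodicity the two sums satisfy q So = 2 Se and q Se = 2 So, whence (q^2 - 4) Se = 0. They
    will be the total multiples of the two simple roots subtracted by (s t)^m. *)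
Lemma alt_sum0 : \sum_(i < m) d i.*2.+1 = 0 /\ \sum_(i < m) d i.*2.+2 = 0.
Proof.
set So := \sum_(i < m) d i.*2.+1; set Se := \sum_(i < m) d i.*2.+2.
have per k : d (k + m.*2)%N = d k by rewrite -addnn addnA !alt_antiperiod opprK.
have shift (f : nat -> R) : f m = f 0%N -> \sum_(i < m) f i.+1 = \sum_(i < m) f i.
  move=> fm; have m0 := ltnW m_gt1.
  rewrite -(big_mkord xpredT (fun i => f i.+1)) -(big_mkord xpredT f).
  have := big_ltn (op := +%R) (idx := 0) (F := f) (ltn0Sn m).
  by rewrite big_nat_recr //= fm big_add1 addrC => /addrI ->.
have e1 : q * So = Se + Se.
  have SeE : Se = \sum_(i < m) d i.*2.
    by apply: (shift (fun i => d i.*2)); rewrite -[m.*2]add0n per.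
  rewrite {2}SeE.
  rewrite mulr_sumr -big_split; apply: eq_bigr => i _ /=.
  by rewrite dS; ring.
have e2 : q * Se = So + So.
  have SoE : \sum_(i < m) d i.*2.+3 = So.
    by apply: (shift (fun i => d i.*2.+1)); rewrite -[m.*2.+1]add1n per.
  rewrite -{2}SoE addrC.
  rewrite mulr_sumr -big_split; apply: eq_bigr => i _ /=.
  by rewrite [d _.+3]dS; ring.
have Se0 : Se = 0.
  apply/eqP; have /eqP : (q * q - 4) * Se = 0 by rewrite mulrBl -mulrA e2 mulrDr e1; ring.
  by rewrite mulf_eq0 subr_eq0 (negPf q4).
by split=> //; move: e2; rewrite Se0; lra.
Qed.
End Alternating.

Section Geometric.
Variables (R : realFieldType) (q : nat -> R) (u : nat -> nat -> R).
Hypothesis u0 : forall m, u m 0%N = 0.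
Hypothesis u1 : forall m, u m 1%N = 1.
Hypothesis uS : forall m k, u m k.+2 = q m * u m k.+1 - u m k.
Hypothesis um : forall m, (1 < m)%N -> u m m = 0.
Hypothesis umS : forall m, (1 < m)%N -> u m m.+1 = -1.
Hypothesis q4 : forall m, (1 < m)%N -> q m * q m != 4.
Variables (gT : finGroupType).
Implicit Types (s t w : gT).

Local Notation V := 'cV[R]_#|gT|.
Implicit Types (v : V).

(** There is one coordinate for each element of the group, not just for each generator; roots turn
    out to be supported in [S], and parabolic subspaces are cut out by [supp]. *)
Definition co v s : R := v (enum_rank s) 0.
Definition alpha s : V := delta_mx (enum_rank s) 0.
(* Twice the invariant form on simple roots, so that roots have square length 2
   for [bf] below; [dl s v] is the pairing of [v] with [alpha s]. *)
Definition cart s t : R := if s == t then 2 else - q #[s * t]%g.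
Definition dl s v : R := \sum_t cart s t * co v t.
Definition sgmx s : 'M[R]_#|gT| :=
  1%:M - alpha s *m \row_j cart s (enum_val j).

Lemma coD v v' s : co (v + v') s = co v s + co v' s. Proof. by rewrite /co mxE. Qed.
Lemma coN v s : co (- v) s = - co v s. Proof. by rewrite /co mxE. Qed.
Lemma coB v v' s : co (v - v') s = co v s - co v' s. Proof. by rewrite coD coN. Qed.
Lemma coZ a v s : co (a *: v) s = a * co v s. Proof. by rewrite /co mxE. Qed.
Lemma co0 s : co 0 s = 0. Proof. by rewrite /co mxE. Qed.
Lemma co_alpha s t : co (alpha s) t = (s == t)%:R.
Proof. by rewrite /co /alpha mxE eqxx andbT (inj_eq enum_rank_inj) eq_sym. Qed.
Lemma co_inj v v' : (forall s, co v s = co v' s) -> v = v'.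
Proof. by move=> E; apply/colP=> i; have := E (enum_val i); rewrite /co enum_valK. Qed.
Lemma co_sum v : v = \sum_s co v s *: alpha s.
Proof.
apply: co_inj => s; rewrite {2}/co summxE (bigD1 s) //= big1 => [|t ts].
  by rewrite addr0 -/(co _ _) coZ co_alpha eqxx mulr1.
by rewrite -/(co _ _) coZ co_alpha (negPf ts) mulr0.
Qed.

Lemma cart_sym s t : cart s t = cart t s.
Proof.
rewrite /cart eq_sym; case: eqP => // _; congr (- q _).
by rewrite -(orderJ (s * t)%g s) conjgE !mulgA mulVg mul1g.
Qed.
Lemma cartss s : cart s s = 2. Proof. by rewrite /cart eqxx. Qed.

Lemma dlD s v v' : dl s (v + v') = dl s v + dl s v'.
Proof. by rewrite /dl -big_split; apply: eq_bigr => t _; rewrite coD mulrDr. Qed.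
Lemma dlZ s a v : dl s (a *: v) = a * dl s v.
Proof. by rewrite /dl mulr_sumr; apply: eq_bigr => t _; rewrite coZ mulrCA. Qed.
Lemma dlN s v : dl s (- v) = - dl s v.
Proof. by rewrite -scaleN1r dlZ mulN1r. Qed.
Lemma dlB s v v' : dl s (v - v') = dl s v - dl s v'.
Proof. by rewrite dlD dlN. Qed.
Lemma dl_alpha s t : dl s (alpha t) = cart s t.
Proof.
rewrite /dl (bigD1 t) //= co_alpha eqxx mulr1 big1 ?addr0 // => r /negPf.
by rewrite co_alpha eq_sym => ->; rewrite mulr0.
Qed.

Lemma sgmxE s v : sgmx s *m v = v - dl s v *: alpha s.
Proof.
rewrite mulmxBl mul1mx -mulmxA; congr (_ - _).
have -> : \row_j cart s (enum_val j) *m v = (dl s v)%:M.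
  apply/matrixP=> i j; rewrite !ord1 !mxE eqxx mulr1n /dl.
  rewrite (reindex (enum_val : 'I_#|gT| -> gT)) /=; last first.
    by exists enum_rank => t _; rewrite ?enum_valK ?enum_rankK.
  by apply: eq_bigr => k _; rewrite mxE /co enum_valK.
by rewrite mul_mx_scalar.
Qed.

Lemma co_sg s t v : s != t -> co (sgmx s *m v) t = co v t.
Proof. by move=> /negPf st; rewrite sgmxE coB coZ co_alpha st mulr0 subr0. Qed.
Lemma dl_sg s v : dl s (sgmx s *m v) = - dl s v.
Proof. by rewrite sgmxE dlB dlZ dl_alpha cartss; ring. Qed.
Lemma sgK s v : sgmx s *m (sgmx s *m v) = v.
Proof. by rewrite {1}sgmxE dl_sg scaleNr opprK sgmxE subrK. Qed.

Lemma mx_ext (A B : 'M[R]_#|gT|) : (forall v, A *m v = B *m v) -> A = B.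
Proof.
move=> E; apply/matrixP=> i j.
have /colP/(_ i) := E (delta_mx j 0).
by rewrite -!colE !mxE.
Qed.

Lemma sgmx2 s : sgmx s *m sgmx s = 1%:M.
Proof. by apply: mx_ext => v; rewrite -mulmxA sgK mul1mx. Qed.

(** Each reflection subtracts a multiple of its simple root, and the successive multiples obey the
    recurrence of [alt_sum0], so over a full turn they add up to zero. *)
Lemma sg_braid s t v : let m := #[s * t]%g in s != t -> (1 < m)%N ->
  iter m (fun z => sgmx s *m (sgmx t *m z)) v = v.
Proof.
move=> m st m1.
have cst : cart s t = - q m by rewrite /cart (negPf st).
have cts : cart t s = - q m by rewrite cart_sym.
have [d [d0 d1 dS]] : exists d : nat -> R,
    [/\ d 0%N = - dl s v, d 1%N = dl t v & forall k, d k.+2 = q m * d k.+1 - d k].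
  (* The value before [dl t v] is the multiple that [s] would have subtracted had it just produced
     [v]. *)
  pose f k : R * R := iter k (fun p => (p.2, q m * p.2 - p.1)) (- dl s v, dl t v).
  by exists (fun k => (f k).1).
have [So Se] := alt_sum0 m1 (u0 m) (u1 m) (uS m) (um m1) (umS m1) (q4 m1) dS.
have inv j : let z := iter j (fun z => sgmx s *m (sgmx t *m z)) v in
  [/\ dl t z = d j.*2.+1, dl s z = - d j.*2
    & z = v - (\sum_(i < j) d i.*2.+1) *: alpha t - (\sum_(i < j) d i.*2.+2) *: alpha s].
  elim: j => [|j [IH1 IH2 IH3]] /=.
    by rewrite !big_ord0 !scale0r !subr0 d0 d1 opprK.
  set z := iter j _ v in IH1 IH2 IH3 *.
  have E1 : sgmx t *m z = z - d j.*2.+1 *: alpha t by rewrite sgmxE IH1.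
  have dt1 : dl t (sgmx t *m z) = - d j.*2.+1 by rewrite dl_sg IH1.
  have ds1 : dl s (sgmx t *m z) = d j.*2.+2.
    by rewrite E1 dlB dlZ dl_alpha cst IH2 dS; ring.
  have E2 : sgmx s *m (sgmx t *m z) = z - d j.*2.+1 *: alpha t - d j.*2.+2 *: alpha s.
    by rewrite sgmxE ds1 E1.
  split.
  - by rewrite sgmxE dlB dlZ dl_alpha dt1 ds1 cts doubleS [d _.+3]dS; ring.
  - by rewrite dl_sg ds1.
  - rewrite E2 IH3 !big_ord_recr /=.
    by apply: co_inj => r; rewrite !(coB, coZ); ring.
have [_ _ ->] := inv m.
by rewrite So Se !scale0r !subr0.
Qed.

Lemma geometric_representation (W : {group gT}) (S : {set gT}) :
  coxeter_system W S ->
  exists rho : gT -> 'M[R]_#|gT|,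
    [/\ rho 1%g = 1%:M, {in W &, {morph rho : a b / (a * b)%g >-> a *m b}}
      & {in S, rho =1 sgmx}].
Proof.
case=> genS S2 univ.
have sgP s : gl_pred (sgmx s, sgmx s) by rewrite /gl_pred /= !sgmx2 eqxx.
pose f s : gl R #|gT| := Gl (sgP s).
have s2 s : s \in S -> (s * s = 1)%g by move=> /S2 s2; rewrite -(expg_order s) s2 expgS expg1.
have relf : {in S &, forall s t, ((f s * f t) ^+ #[s * t] = 1)%g}.
  move=> s t sS tS; apply: val_inj => /=.
  have fV (g : gl R #|gT|) : (glP g).1 = 1%:M -> glP g = (1%:M, 1%:M).
    case: g => [[a b] /= /andP[/= /eqP ab _] a1]; rewrite a1 in ab *.
    by rewrite -ab mul1mx.
  apply: fV; apply: mx_ext => v; rewrite mul1mx.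
  have E j : (glP ((f s * f t) ^+ j)%g).1 *m v =
               iter j (fun z => sgmx s *m (sgmx t *m z)) v.
    elim: j v => [|j IH] v; first by rewrite mul1mx.
    by rewrite expgS /= -!mulmxA IH.
  rewrite E; have [->|st] := eqVneq s t.
    by rewrite s2 // order1 /= sgK.
  apply: sg_braid => //; rewrite ltn_neqAle order_gt0 andbT eq_sym order_eq1.
  apply: contra st => /eqP st1; apply/eqP.
  by rewrite -[s]mulg1 -(s2 t tS) mulgA st1 mul1g.
have [phi [phiM phiS]] := univ (gl R #|gT|) f relf.
exists (fun w => (glP (phi w)).1); split=> [|a b aW bW|s sS] /=.
- have phi11 := phiM _ _ (group1 W) (group1 W); rewrite mulg1 in phi11.
  by have -> : phi 1%g = 1%g by apply: (mulgI (phi 1%g)); rewrite mulg1 -phi11.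
- by rewrite phiM.
- by rewrite phiS.
Qed.

End Geometric.

(** * Words and lengths *)

Section Words.
Variable gT : finGroupType.
Implicit Types (A : {set gT}) (u : seq gT) (w s : gT).

Definition wprod u : gT := (\prod_(s <- u) s)%g.

Lemma wprod_nil : wprod [::] = 1%g. Proof. exact: big_nil. Qed.
Lemma wprod_cons s u : wprod (s :: u) = (s * wprod u)%g. Proof. exact: big_cons. Qed.
Lemma wprod_cat u v : wprod (u ++ v) = (wprod u * wprod v)%g. Proof. exact: big_cat. Qed.
Lemma wprod_rcons u s : wprod (rcons u s) = (wprod u * s)%g.
Proof. by rewrite -cats1 wprod_cat wprod_cons wprod_nil mulg1. Qed.
Lemma wprod_conj s u : wprod (map (fun t => t ^ s)%g u) = (wprod u ^ s)%g.
Proof. by elim: u => [|t u IH]; rewrite ?wprod_nil ?conj1g // !wprod_cons IH conjMg. Qed.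

Lemma wprod_gen A u : all (mem A) u -> wprod u \in (<<A>>)%g.
Proof.
elim: u => [|s u IH] /=; first by rewrite wprod_nil group1.
by case/andP=> sA /IH uA; rewrite wprod_cons groupM // mem_gen.
Qed.

Lemma gen_wprod A w : w \in (<<A>>)%g -> exists2 u, all (mem A) u & wprod u = w.
Proof. by case/wlengthP=> /mem_expgP[u [uA uw _]] _; exists u. Qed.

Lemma wlength_wprod A u : all (mem A) u -> (wlength A (wprod u) <= size u)%N.
Proof.
move=> uA; have [_] := wlengthP (wprod_gen uA); apply.
by apply/mem_expgP; exists u.
Qed.

Lemma wlength_word A w : w \in (<<A>>)%g ->
  exists u, [/\ all (mem A) u, wprod u = w & size u = wlength A w].
Proof. by case/wlengthP=> /mem_expgP. Qed.

Lemma wlength_mull A s w : s \in A -> w \in (<<A>>)%g ->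
  (wlength A (s * w)%g <= (wlength A w).+1)%N.
Proof.
move=> sA /wlength_word[u [uA <- <-]]; rewrite -wprod_cons -[(size u).+1]/(size (s :: u)).
by apply: wlength_wprod; rewrite /= sA.
Qed.

Lemma wlength_mulr A s w : s \in A -> w \in (<<A>>)%g ->
  (wlength A (w * s)%g <= (wlength A w).+1)%N.
Proof.
move=> sA /wlength_word[u [uA <- <-]]; rewrite -wprod_rcons -(size_rcons u s).
by apply: wlength_wprod; rewrite all_rcons /= sA.
Qed.

Lemma wlength1 A : wlength A 1%g = 0%N.
Proof.
by apply/eqP; rewrite -leqn0 -wprod_nil; apply: wlength_wprod.
Qed.

Lemma exists_right_descent A w : w \in (<<A>>)%g -> w != 1%g ->
  exists2 s, s \in A & ((w * s^-1)%g \in (<<A>>)%g) && (wlength A (w * s^-1)%g < wlength A w)%N.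
Proof.
move=> /wlength_word[u [uA uw su]]; case: (lastP u) uA uw su => [|u' s].
  by move=> _ <-; rewrite wprod_nil eqxx.
rewrite all_rcons => /andP[sA uA] <- <- _; exists s => //.
by rewrite wprod_rcons mulgK wprod_gen //= size_rcons ltnS wlength_wprod.
Qed.

(** Built from the right: the last letter is [a] for every positive length, and right descents are
    tested at that end. *)
Fixpoint alt (a b : gT) k : seq gT :=
  if k is k'.+1 then rcons (alt b a k') a else [::].

Lemma size_alt a b k : size (alt a b k) = k.
Proof. by elim: k a b => //= k IH a b; rewrite size_rcons IH. Qed.

Lemma alt_in A a b k : a \in A -> b \in A -> all (mem A) (alt a b k).
Proof. by elim: k a b => //= k IH a b aA bA; rewrite all_rcons /= aA IH. Qed.

Lemma altS a b k : alt a b k.+1 = (if odd k then b else a) :: alt a b k.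
Proof.
elim: k a b => // k IH a b; rewrite -[LHS]/(rcons (alt b a k.+1) a) IH /=.
by case: odd.
Qed.

Lemma alt_suffix a b i k : exists2 Z, alt a b (i + k) = Z ++ alt a b k & size Z = i.
Proof.
elim: k a b => [|k IH] a b.
  by rewrite addn0; exists (alt a b i); rewrite ?cats0 ?size_alt.
have [Z EZ sZ] := IH b a.
by rewrite addnS /= EZ; exists Z => //; rewrite rcons_cat.
Qed.

(** The quotient of the two sides is an alternating word of twice the length, that is (a b)^m or (b
    a)^m. *)
Lemma alt_braid a b : (a * a = 1)%g -> (b * b = 1)%g ->
  wprod (alt a b #[a * b]%g) = wprod (alt b a #[a * b]%g).
Proof.
move=> a2 b2; set m := #[_]%g.
have aV : (a^-1 = a)%g by apply: (mulgI a); rewrite mulgV a2.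
have bV : (b^-1 = b)%g by apply: (mulgI b); rewrite mulgV b2.
have ba_m : ((b * a) ^+ m = 1)%g.
  have -> : (b * a = (a * b)^-1)%g by rewrite invMg aV bV.
  by rewrite expgVn expg_order invg1.
have ab_m : ((a * b) ^+ m = 1)%g by rewrite expg_order.
have even c d k : wprod (alt c d k.*2) = ((d * c) ^+ k)%g.
  elim: k => [|k IH]; first by rewrite wprod_nil.
  by rewrite doubleS /= !wprod_rcons IH expgSr mulgA.
have step c d i j : (c^-1 = c)%g -> (d^-1 = d)%g -> exists e,
    e \in [:: (c, d); (d, c)] /\
    (wprod (alt c d i) * (wprod (alt d c j))^-1)%g = wprod (alt e.1 e.2 (i + j)).
  elim: j c d i => [|j IH] c d i cV dV.
    by exists (c, d); rewrite inE eqxx addn0 wprod_nil invg1 mulg1.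
  have [e [eI E]] := IH d c i.+1 dV cV; exists e; split.
    by move: eI; rewrite !inE orbC.
  by rewrite -addSnnS -E /= !wprod_rcons invMg dV mulgA.
have [e [eI E]] := step a b m m aV bV.
apply/eqP; rewrite eq_mulgV1 E addnn even.
by move: eI; rewrite !inE => /orP[] /eqP -> /=; rewrite ?ba_m ?ab_m.
Qed.

Lemma pairwise_rev (X : Type) (r : rel X) (z : seq X) :
  pairwise r (rev z) = pairwise (fun x y : X => r y x) z.
Proof.
by elim: z => //= x z IH; rewrite rev_cons pairwise_rcons IH all_rev.
Qed.

End Words.

(** * Signs of roots *)

(** The [u m k] are the coefficients, in the two simple roots, of the roots of a dihedral subgroup
    with parameter m; their nonnegativity up to k = m is the source of all sign statements on
    roots. *)
Record geometric (R : realFieldType) (q : nat -> R) (u : nat -> nat -> R)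
    (gT : finGroupType) (W : {group gT}) (S : {set gT})
    (rho : gT -> 'M[R]_#|gT|) : Prop := Geometric {
  geo_u0 : forall m, u m 0%N = 0;
  geo_u1 : forall m, u m 1%N = 1;
  geo_uS : forall m k, u m k.+2 = q m * u m k.+1 - u m k;
  geo_u_ge0 : forall m k : nat, (1 < m)%N -> (k <= m)%N -> 0 <= u m k;
  geo_gen : (<<S>>)%g = W;
  geo_inv : forall s, s \in S -> (s * s)%g = 1%g;
  geo_rho1 : rho 1%g = 1%:M;
  geo_rhoM : {in W &, {morph rho : a b / (a * b)%g >-> a *m b}};
  geo_rhoS : {in S, rho =1 sgmx q (gT := gT)}
}.

Section CoxeterTheory.
Variables (R : realFieldType) (q : nat -> R) (u : nat -> nat -> R).
Variables (gT : finGroupType) (W : {group gT}) (S : {set gT}).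
Variable rho : gT -> 'M[R]_#|gT|.
Hypothesis G : geometric q u W S rho.
Implicit Types (s t w : gT) (v : 'cV[R]_#|gT|).
Local Notation a := (@alpha R gT).
Local Notation ell := (wlength S).
Local Notation act w v := (rho w *m v).

Definition nneg v := [forall s, 0 <= co v s].

Lemma nnegP v : reflect (forall s, 0 <= co v s) (nneg v).
Proof. exact: forallP. Qed.
Lemma nnegD v v' : nneg v -> nneg v' -> nneg (v + v').
Proof. by move=> /nnegP p /nnegP p'; apply/nnegP=> s; rewrite coD addr_ge0. Qed.
Lemma nnegZ c v : 0 <= c -> nneg v -> nneg (c *: v).
Proof. by move=> c0 /nnegP p; apply/nnegP=> s; rewrite coZ mulr_ge0. Qed.
Lemma nneg0 : nneg 0.
Proof. by apply/nnegP=> s; rewrite co0. Qed.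
Lemma nneg_alpha s : nneg (a s).
Proof. by apply/nnegP=> t; rewrite co_alpha ler0n. Qed.
Lemma nneg_anti v : nneg v -> nneg (- v) -> v = 0.
Proof.
move=> /nnegP p /nnegP p'; apply: co_inj => s; apply/eqP.
by rewrite co0 eq_le p -oppr_ge0 -coN p'.
Qed.

Lemma S_in_W s : s \in S -> s \in W.
Proof. by move=> sS; rewrite -(geo_gen G) mem_gen. Qed.

Lemma mulWS w s : w \in W -> s \in S -> (w * s)%g \in W.
Proof. by move=> wW /S_in_W; apply: groupM. Qed.
Lemma mulSW w s : s \in S -> w \in W -> (s * w)%g \in W.
Proof. by move=> /S_in_W; apply: groupM. Qed.

Lemma wprodW x : all (mem S) x -> wprod x \in W.
Proof. by rewrite -(geo_gen G); apply: wprod_gen. Qed.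

Lemma repM w w' v : w \in W -> w' \in W -> act (w * w')%g v = act w (act w' v).
Proof. by move=> wW w'W; rewrite (geo_rhoM G) // mulmxA. Qed.
Lemma rep1 v : act 1%g v = v. Proof. by rewrite (geo_rho1 G) mul1mx. Qed.
Lemma repS s v : s \in S -> act s v = v - dl q s v *: a s.
Proof. by move=> sS; rewrite (geo_rhoS G) // sgmxE. Qed.
Lemma repK w v : w \in W -> act w^-1%g (act w v) = v.
Proof. by move=> wW; rewrite -repM ?groupV // mulVg rep1. Qed.
Lemma repVK w v : w \in W -> act w (act w^-1%g v) = v.
Proof. by move=> wW; rewrite -repM ?groupV // mulgV rep1. Qed.
Lemma repD w v v' : act w (v + v') = act w v + act w v'. Proof. exact: mulmxDr. Qed.
Lemma repB w v v' : act w (v - v') = act w v - act w v'. Proof. exact: mulmxBr. Qed.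
Lemma repN w v : act w (- v) = - act w v. Proof. exact: mulmxN. Qed.
Lemma repZ w c v : act w (c *: v) = c *: act w v. Proof. by rewrite scalemxAr. Qed.
Lemma SV s : s \in S -> s^-1%g = s.
Proof. by move=> /(geo_inv G) s2; apply: (mulgI s); rewrite mulgV s2. Qed.
Lemma SmulK s w : s \in S -> (s * (s * w))%g = w.
Proof. by move=> sS; rewrite mulgA (geo_inv G) // mul1g. Qed.
Lemma SmulKr s w : s \in S -> (w * s * s)%g = w.
Proof. by move=> sS; rewrite -mulgA (geo_inv G) // mulg1. Qed.
Lemma repSS s v : s \in S -> act s (act s v) = v.
Proof. by move=> sS; rewrite -(repM _ (S_in_W sS) (S_in_W sS)) (geo_inv G) // rep1. Qed.
Lemma rep_alpha s : s \in S -> act s (a s) = - a s.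
Proof. by move=> sS; rewrite repS // dl_alpha cartss scaler_nat mulr2n opprD addNKr. Qed.

Section Dihedral.
Variables s t : gT.
Hypotheses (sS : s \in S) (tS : t \in S) (st : s != t).
Let m := #[s * t]%g.

Lemma dihedral_gt1 : (1 < m)%N.
Proof.
rewrite ltn_neqAle order_gt0 andbT eq_sym order_eq1; apply: contra st => /eqP st1.
by rewrite -[t]mul1g -st1 -mulgA (geo_inv G) // mulg1.
Qed.

(** The last letter [a0] turns the dihedral root with coefficients u_j, u_(j+1) into the one with
    u_(j+1), u_(j+2) and exchanges the two generators; [j + k < m] keeps every index in the
    nonnegative range. *)
Lemma alt_nneg k : forall j a0 b0 x, (a0, b0) \in [:: (s, t); (t, s)] ->
  (j + k < m)%N -> x \in W -> nneg (act x (a a0)) -> nneg (act x (a b0)) ->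
  nneg (act (x * wprod (alt a0 b0 k))%g (u m j *: a a0 + u m j.+1 *: a b0)).
Proof.
elim: k => [|k IH] j a0 b0 x ab jk xW xa xb.
  rewrite wprod_nil mulg1 repD !repZ nnegD ?nnegZ //; apply: (geo_u_ge0 G dihedral_gt1); lia.
have [a0S b0S ba cE] : [/\ a0 \in S, b0 \in S, (b0, a0) \in [:: (s, t); (t, s)]
    & cart q a0 b0 = - q m].
  move: ab; rewrite !inE => /orP[] /eqP[-> ->]; rewrite sS tS eqxx ?orbT; split=> //.
    by rewrite /cart (negPf st).
  by rewrite cart_sym /cart (negPf st).
rewrite /= wprod_rcons mulgA repM ?groupM ?wprodW ?alt_in //; last exact: S_in_W.
have -> : act a0 (u m j *: a a0 + u m j.+1 *: a b0) =
          u m j.+1 *: a b0 + u m j.+2 *: a a0.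
  rewrite repD !repZ rep_alpha // repS // dl_alpha cE (geo_uS G).
  by apply: co_inj => r; rewrite !(coD, coZ, coN, coB); ring.
by apply: IH => //; rewrite addSnnS.
Qed.
End Dihedral.

(** Split w as v times an alternating word in s and a right descent t, with lengths adding, and
    shorten v until neither s nor t is a right descent of it. By induction v a_s and v a_t are
    nonnegative. The alternating word is shorter than the order of t s, since otherwise a braid move
    would make it end in s, against the ascent; so [alt_nneg] applies. *)
Lemma nneg_ascent n : forall w s, ell w = n -> w \in W -> s \in S ->
  ~~ (ell (w * s)%g < ell w)%N -> nneg (act w (a s)).
Proof.
elim/ltn_ind: n => n IHn w s wn wW sS asc.
have [w1|w1] := eqVneq w 1%g; first by rewrite w1 rep1 nneg_alpha.
have [|t tS] := exists_right_descent (A := S) (w := w) _ w1; first by rewrite (geo_gen G).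
rewrite SV // => /andP[_ dt].
have st : s != t by apply: contra asc => /eqP ->.
have ts : t != s by rewrite eq_sym.
have tmem : (t, s) \in [:: (t, s); (s, t)] by rewrite inE eqxx.
have lenM x y : x \in W -> all (mem S) y -> (ell (x * wprod y)%g <= ell x + size y)%N.
  rewrite -(geo_gen G) => /wlength_word[z [zS <- <-]] yS.
  by rewrite -wprod_cat -size_cat; apply: wlength_wprod; rewrite all_cat zS.
have main d : forall k (v : gT), v \in W -> ell v = d -> (0 < k)%N ->
    w = (v * wprod (alt t s k))%g -> ell w = (ell v + k)%N -> nneg (act w (a s)).
  elim/ltn_ind: d => d IHd k v vW vd k0 wE lwE.
  have altS' k' : all (mem S) (alt t s k') by apply: alt_in.
  (* [c] is the letter that would extend the alternating word to the left, [b] its present first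
     letter; [b] is no descent of [v] because the lengths add. *)
  pose c := if odd k then s else t.
  pose b := if odd k then t else s.
  have cS : c \in S by rewrite /c; case: odd.
  have bS : b \in S by rewrite /b; case: odd.
  have [vc|vc] := boolP (ell (v * c)%g < ell v)%N.
    apply: (IHd (ell (v * c)%g) _ k.+1 (v * c)%g) => //.
    - by rewrite -vd.
    - exact: mulWS.
    - by rewrite wE altS -/c wprod_cons -mulgA (mulgA c) (geo_inv G) // mul1g.
    - have := @wlength_mulr _ S c (v * c)%g cS.
      rewrite (geo_gen G) mulWS // => /(_ isT).
      by rewrite -mulgA (geo_inv G) // mulg1 lwE; move: (ell _) (ell _) vc => i j; clear; lia.
  have vb : ~~ (ell (v * b)%g < ell v)%N.
    apply/negP => vb; have kE : k = k.-1.+1 by rewrite prednK.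
    have E : w = (v * b * wprod (alt t s k.-1))%g.
      rewrite wE kE altS wprod_cons mulgA; congr (v * _ * _)%g.
      by rewrite /b [in RHS]kE /=; case: odd.
    have := @lenM (v * b)%g (alt t s k.-1) _ (altS' _).
    by rewrite -E mulWS // size_alt lwE => /(_ isT); clear -vb k0; lia.
  have vst r : r \in [:: s; t] -> ~~ (ell (v * r)%g < ell v)%N.
    by move: vc vb; rewrite !inE /c /b; case: odd => vc vb /orP[] /eqP ->.
  have vpos r : r \in [:: s; t] -> nneg (act v (a r)).
    move=> rst; apply: (IHn (ell v)) => //; last exact: vst.
      by rewrite -wn lwE -addn1 leq_add2l.
    by move: rst; rewrite !inE => /orP[] /eqP ->.
  have km : (k < #[t * s]%g)%N.
    rewrite ltnNge; apply/negP => mk.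
    have [Z ZE sZ] := alt_suffix t s (k - #[t * s]%g) #[t * s]%g.
    rewrite subnK // in ZE.
    have m0 : (0 < #[t * s]%g)%N by rewrite order_gt0.
    have br : wprod (alt t s #[t * s]%g) = (wprod (alt t s #[t * s]%g.-1) * s)%g.
      by rewrite alt_braid ?(geo_inv G) // -{1}(prednK m0) /= wprod_rcons.
    have ZS : all (mem S) Z by have := altS' k; rewrite ZE all_cat => /andP[].
    have E : (w * s)%g = (v * wprod (Z ++ alt t s #[t * s]%g.-1))%g.
      rewrite wE ZE !wprod_cat br -!mulgA (geo_inv G) // mulg1 //.
    have := @lenM v (Z ++ alt t s #[t * s]%g.-1) vW; rewrite all_cat ZS altS' -E.
    rewrite size_cat sZ size_alt => /(_ isT) le; move/negP: asc; apply.
    by rewrite lwE; clear -le mk m0; lia.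
  have := alt_nneg (k := k) (j := 0) tS sS ts tmem km vW.
  rewrite (geo_u0 G) (geo_u1 G) scale0r scale1r add0r -wE; apply; apply: vpos;
    by rewrite !inE eqxx ?orbT.
apply: (main (ell (w * t)%g) 1%N (w * t)%g) => //.
- exact: mulWS.
- by rewrite /= wprod_cons wprod_nil mulg1 -mulgA (geo_inv G) // mulg1.
- apply/eqP; rewrite eqn_leq addn1 dt andbT.
  have := @wlength_mulr _ S t (w * t)%g tS.
  by rewrite (geo_gen G) mulWS // -mulgA (geo_inv G) // mulg1; apply.
Qed.

Lemma nneg_mulr w s : w \in W -> s \in S ->
  if (ell (w * s)%g < ell w)%N then nneg (- act w (a s)) else nneg (act w (a s)).
Proof.
move=> wW sS; case: ifPn => [lt|]; last exact: nneg_ascent.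
have := @nneg_ascent _ (w * s)%g s erefl; rewrite mulWS // -mulgA (geo_inv G) // mulg1.
rewrite -leqNgt (ltnW lt) => /(_ isT sS isT).
by rewrite (repM _ wW (S_in_W sS)) rep_alpha // repN.
Qed.

Lemma rep_neq0 w v : w \in W -> v != 0 -> act w v != 0.
Proof. by move=> wW; apply: contra => /eqP E; rewrite -(repK v wW) E mulmx0. Qed.

Lemma alpha_neq0 s : a s != 0.
Proof. by apply/eqP => /(congr1 (fun v => co v s)); rewrite co_alpha eqxx co0 => /eqP; rewrite oner_eq0. Qed.

Lemma descentP w s : w \in W -> s \in S ->
  (ell (w * s)%g < ell w)%N = nneg (- act w (a s)).
Proof.
move=> wW sS; have := nneg_mulr wW sS; case: ifPn => // _ p.
by apply/esym/negP => p'; have /eqP := nneg_anti p p'; apply/negP/rep_neq0/alpha_neq0.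
Qed.

Lemma faithful w : w \in W -> (forall v, act w v = v) -> w = 1%g.
Proof.
move=> wW w_id; apply/eqP/negPn/negP => w1.
have [|s sS] := exists_right_descent (A := S) (w := w) _ w1; first by rewrite (geo_gen G).
rewrite SV // descentP // w_id => /andP[_ /(nneg_anti (nneg_alpha s))].
by apply/eqP/alpha_neq0.
Qed.

(** * The invariant form, roots and their reflections *)

Implicit Types (b : 'cV[R]_#|gT|).

Definition bf v v' : R := \sum_s co v s * dl q s v'.

Lemma bf_alpha s v : bf (a s) v = dl q s v.
Proof.
rewrite /bf (bigD1 s) //= co_alpha eqxx mul1r big1 ?addr0 // => t /negPf ts.
by rewrite co_alpha eq_sym ts mul0r.
Qed.
Lemma bfDr v v1 v2 : bf v (v1 + v2) = bf v v1 + bf v v2.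
Proof. by rewrite /bf -big_split; apply: eq_bigr => t _; rewrite dlD mulrDr. Qed.
Lemma bfZr v c v1 : bf v (c *: v1) = c * bf v v1.
Proof. by rewrite /bf mulr_sumr; apply: eq_bigr => t _; rewrite dlZ mulrCA. Qed.
Lemma bfC v v' : bf v v' = bf v' v.
Proof.
rewrite /bf /dl; under eq_bigr do rewrite mulr_sumr.
rewrite exchange_big; apply: eq_bigr => t _ /=; rewrite mulr_sumr.
by apply: eq_bigr => s _; rewrite cart_sym; ring.
Qed.
Lemma bfBr v v1 v2 : bf v (v1 - v2) = bf v v1 - bf v v2.
Proof. by rewrite -scaleN1r bfDr bfZr mulN1r. Qed.
Lemma bfBl v v1 v2 : bf (v1 - v2) v = bf v1 v - bf v2 v.
Proof. by rewrite !(bfC _ v) bfBr. Qed.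
Lemma bfZl v c v1 : bf (c *: v1) v = c * bf v1 v.
Proof. by rewrite !(bfC _ v) bfZr. Qed.

Lemma bf_inv w v v' : w \in W -> bf (act w v) (act w v') = bf v v'.
Proof.
rewrite -(geo_gen G) => /gen_wprod[z zS <-].
elim: z zS v v' => [_ v v'|s z IH] /=; first by rewrite wprod_nil !rep1.
case/andP=> sS zS v v'; rewrite wprod_cons !(repM _ (S_in_W sS) (wprodW zS)) -[RHS]IH //.
rewrite !(repS _ sS) bfBl !bfBr !bfZl !bfZr bf_alpha (bfC _ (a s)) !bf_alpha dl_alpha cartss; ring.
Qed.

Definition isroot v := [exists w in W, [exists s in S, v == act w (a s)]].

Lemma isrootP v : reflect (exists w s, [/\ w \in W, s \in S & v = act w (a s)]) (isroot v).
Proof.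
apply: (iffP (exists_inP)) => [[w wW /exists_inP[s sS /eqP ->]] | [w [s [wW sS ->]]]].
  by exists w, s.
by exists w => //; apply/exists_inP; exists s.
Qed.

Lemma root_rep w v : w \in W -> isroot v -> isroot (act w v).
Proof.
move=> wW /isrootP[x [s [xW sS ->]]]; apply/isrootP; exists (w * x)%g, s.
by rewrite groupM // repM.
Qed.
Lemma root_alpha s : s \in S -> isroot (a s).
Proof. by move=> sS; apply/isrootP; exists 1%g, s; rewrite group1 rep1. Qed.
Lemma isrootN v : isroot v -> isroot (- v).
Proof.
move=> /isrootP[x [s [xW sS ->]]]; apply/isrootP; exists (x * s)%g, s.
by rewrite mulWS // (repM _ xW (S_in_W sS)) rep_alpha // repN.
Qed.
Lemma root_bf v : isroot v -> bf v v = 2.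
Proof. by move=> /isrootP[x [s [xW sS ->]]]; rewrite bf_inv // bf_alpha dl_alpha cartss. Qed.
Lemma root_neq0 v : isroot v -> v != 0.
Proof. by move=> /isrootP[x [s [xW sS ->]]]; rewrite rep_neq0 // alpha_neq0. Qed.
Lemma root_sign v : isroot v -> nneg v || nneg (- v).
Proof.
move=> /isrootP[x [s [xW sS ->]]]; have := nneg_mulr xW sS.
by case: ifP => _ ->; rewrite ?orbT.
Qed.
Lemma root_nneg v : isroot v -> nneg (- v) = ~~ nneg v.
Proof.
move=> rv; have := root_sign rv; have := root_neq0 rv.
by case: (boolP (nneg v)) => //= p v0 _; apply/negP => /(nneg_anti p)/eqP; apply/negP.
Qed.

Definition pos v := isroot v && nneg v.

(* The element of W acting as the reflection in the root [v]; 1 on non-roots. *)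
Definition tau v : gT :=
  if [pick p : gT * gT | [&& p.1 \in W, p.2 \in S & v == act p.1 (a p.2)]] is Some p
  then (p.1 * p.2 * p.1^-1)%g else 1%g.

Lemma rep_conj w s v : w \in W -> s \in S ->
  act (w * s * w^-1)%g v = v - bf (act w (a s)) v *: act w (a s).
Proof.
move=> wW sS; have wVW : (w^-1)%g \in W by rewrite groupV.
rewrite (repM _ (mulWS wW sS) wVW) (repM _ wW (S_in_W sS)) (repS _ sS) repB repVK // repZ.
by rewrite -(bf_inv _ _ wVW) repK // bf_alpha.
Qed.

Lemma tau_mem v : tau v \in W.
Proof.
rewrite /tau; case: pickP => [[w s] /= /and3P[wW sS _]|_]; last exact: group1.
by rewrite groupM ?groupV // mulWS.
Qed.

Lemma rep_tau v v' : isroot v -> act (tau v) v' = v' - bf v v' *: v.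
Proof.
move=> /isrootP[w [s [wW sS vE]]]; rewrite /tau; case: pickP => [[w' s'] /=|/(_ (w, s))/=].
  by case/and3P=> w'W s'S /eqP ->; rewrite rep_conj.
by rewrite wW sS vE eqxx.
Qed.

Lemma rep_inj w x : w \in W -> x \in W -> (forall v, act w v = act x v) -> w = x.
Proof.
move=> wW xW E; apply/eqP; rewrite eq_mulVg1; apply/eqP/faithful.
  by rewrite groupM ?groupV.
by move=> v; rewrite repM ?groupV // -E repK.
Qed.

Lemma tau_rep w v : w \in W -> isroot v -> tau (act w v) = (w * tau v * w^-1)%g.
Proof.
move=> wW rv; have wVW : (w^-1)%g \in W by rewrite groupV.
apply: rep_inj => [||v']; rewrite ?groupM ?tau_mem //.
rewrite (repM _ (groupM wW (tau_mem v)) wVW) (repM _ wW (tau_mem v)).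
rewrite !rep_tau ?root_rep // repB repVK // repZ.
by rewrite -(bf_inv _ _ wVW) repK.
Qed.

Lemma tau_alpha s : s \in S -> tau (a s) = s.
Proof.
move=> sS; apply: rep_inj => [||v']; rewrite ?tau_mem ?S_in_W //.
by rewrite rep_tau ?root_alpha // bf_alpha repS.
Qed.

Lemma tauN v : isroot v -> tau (- v) = tau v.
Proof.
move=> rv; apply: rep_inj => [||v']; rewrite ?tau_mem //.
rewrite !rep_tau ?isrootN //.
have -> : bf (- v) v' = - bf v v' by rewrite -scaleN1r bfZl mulN1r.
by rewrite scalerN scaleNr opprK.
Qed.

Lemma tau_conj w s : w \in W -> s \in S -> tau (act w (a s)) = (w * s * w^-1)%g.
Proof. by move=> wW sS; rewrite tau_rep ?root_alpha // tau_alpha. Qed.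

Lemma tau_invol v : isroot v -> (tau v * tau v)%g = 1%g.
Proof.
move=> /isrootP[w [s [wW sS ->]]]; rewrite tau_conj // !mulgA mulgKV -(mulgA w).
by rewrite (geo_inv G) // mulg1 mulgV.
Qed.

(** Square length 2 leaves only the scalars 1 and -1 in front of [a s]. *)
Lemma pos_alpha s b : s \in S -> isroot b -> (forall t, t != s -> co b t = 0) -> nneg b -> b = a s.
Proof.
move=> sS rb b0 pb; have bE : b = co b s *: a s.
  apply: co_inj => t; rewrite coZ co_alpha; case: eqVneq => [->|ts]; first by rewrite mulr1.
  by rewrite mulr0 b0 // eq_sym.
have := root_bf rb; rewrite bE bfZl bfZr bf_alpha dl_alpha cartss => E.
have c0 : 0 <= co b s by have /nnegP := pb.
have /eqP : (co b s - 1) * (co b s + 1) * 2 = 0.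
  by rewrite -(subrr 2) -[X in _ = X - _]E; ring.
rewrite !mulf_eq0 pnatr_eq0 orbF subr_eq0 => /orP[/eqP -> |]; first by rewrite scale1r.
by rewrite paddr_eq0 ?ler01 // oner_eq0 andbF.
Qed.

(** [s] alters the [s]-coordinate only, so a positive root turned negative has all other coordinates
    zero. *)
Lemma pos_simple s b : s \in S -> pos b -> b != a s -> pos (act s b).
Proof.
move=> sS /andP[rb pb] bs; have rsb := root_rep (S_in_W sS) rb.
rewrite /pos rsb /=; case/orP: (root_sign rsb) => // nb; case/eqP: bs.
apply: pos_alpha => // t ts; apply/eqP; rewrite eq_le.
have -> : co b t = co (act s b) t by rewrite (geo_rhoS G) // co_sg // eq_sym.
rewrite -oppr_ge0 -coN; have /nnegP -> := nb.
by rewrite (geo_rhoS G) // co_sg 1?eq_sym //; have /nnegP -> := pb.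
Qed.

(** The exchange condition: carried along the word, [b] turns negative at a letter whose simple root
    it has become, and multiplying by [tau b] deletes that letter. *)
Lemma refl_word_lt z b : all (mem S) z -> pos b -> nneg (- act (wprod z)^-1%g b) ->
  (ell (tau b * wprod z)%g < size z)%N.
Proof.
elim: z b => [|s z IH] b /=.
  rewrite wprod_nil invg1 rep1 => _ /andP[rb pb] nb.
  by have /negP[] := root_neq0 rb; apply/eqP/nneg_anti.
case/andP=> sS zS pb; rewrite wprod_cons invMg (SV sS).
rewrite (repM _ _ (S_in_W sS)) ?groupV ?wprodW //.
have [-> _|bs nb] := eqVneq b (a s).
  by rewrite tau_alpha // mulgA (geo_inv G) // mul1g ltnS wlength_wprod.
have psb := pos_simple sS pb bs.
have := IH _ zS psb nb; rewrite tau_rep ?S_in_W //; last by case/andP: pb.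
rewrite (SV sS) -!mulgA => lt; rewrite ltnS; apply: leq_trans lt.
have := @wlength_mull _ S s (s * (tau b * (s * wprod z)))%g sS.
rewrite (geo_gen G) (mulSW sS (groupM (tau_mem b) (mulSW sS (wprodW zS)))) => /(_ isT).
by rewrite SmulK.
Qed.

(** The dictionary between inversions and signs. The converse applies the same bound to [tau b * y],
    whose inverse sends b to the opposite of y^-1 b. *)
Lemma refl_lt b y : pos b -> y \in W ->
  (ell (tau b * y)%g < ell y)%N = nneg (- act y^-1%g b).
Proof.
move=> pb yW; have lt x : x \in W -> nneg (- act x^-1%g b) -> (ell (tau b * x) < ell x)%N.
  move=> xW; have := xW; rewrite -{1}(geo_gen G) => /wlength_word[z [zS zx zl]] nb.
  by rewrite -zl -zx; apply: refl_word_lt; rewrite ?zx.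
have /andP[rb _] := pb.
apply/idP/idP; last exact: lt.
rewrite root_nneg ?root_rep ?groupV // => le; apply/negP => p.
have tyW : (tau b * y)%g \in W by rewrite groupM ?tau_mem.
have tV : (tau b)^-1%g = tau b by apply: (mulgI (tau b)); rewrite mulgV tau_invol.
have := lt (tau b * y)%g tyW; rewrite invMg tV mulgA tau_invol // mul1g ltnNge (ltnW le).
suff -> : nneg (- act (y^-1 * tau b)%g b) by move=> /(_ isT).
rewrite (repM _ _ (tau_mem b)) ?groupV // rep_tau // root_bf // scaler_nat.
by rewrite mulr2n opprD addNKr repN opprK.
Qed.

Lemma rep_co s t v : s \in S -> s != t -> co (act s v) t = co v t.
Proof. by move=> sS st; rewrite (geo_rhoS G) // co_sg. Qed.

Definition supp v (J : seq gT) := forall t, t \notin J -> co v t = 0.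

Lemma rep_word_co z v t : all (mem S) z -> t \notin z -> co (act (wprod z) v) t = co v t.
Proof.
elim: z => [|s z IH] /=; first by rewrite wprod_nil rep1.
case/andP=> sS zS; rewrite inE negb_or => /andP[ts tz].
by rewrite wprod_cons (repM _ (S_in_W sS) (wprodW zS)) (rep_co _ sS) 1?eq_sym // IH.
Qed.

Lemma supp_rep z J v : all (mem S) z -> {subset z <= J} -> supp v J -> supp (act (wprod z) v) J.
Proof.
by move=> zS zJ vJ t tJ; rewrite rep_word_co ?vJ //; apply: contra tJ => /zJ.
Qed.

Implicit Types (x y : 'cV[R]_#|gT|) (J cw wd : seq gT).
Implicit Types (A D : seq 'cV[R]_#|gT|).

(** * The Euler form and sortable elements *)

(* The Euler form of the Coxeter word [cw], normalised by [euler cw x x = 1] on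
   simple roots; its symmetrisation is [bf]. *)
Fixpoint euler cw x y : R :=
  if cw is s :: cw' then
    co y s * (co x s + \sum_(j <- cw') cart q j s * co x j) + euler cw' x y
  else 0.

Lemma eulerDl cw x x' y : euler cw (x + x') y = euler cw x y + euler cw x' y.
Proof.
elim: cw => [|s cw IH] /=; first by rewrite addr0.
rewrite IH coD (eq_bigr (fun j => cart q j s * co x j + cart q j s * co x' j)).
  by rewrite big_split /=; ring.
by move=> j _; rewrite coD mulrDr.
Qed.
Lemma eulerZl cw c x y : euler cw (c *: x) y = c * euler cw x y.
Proof.
elim: cw => [|s cw IH] /=; first by rewrite mulr0.
rewrite IH coZ (eq_bigr (fun j => c * (cart q j s * co x j))).
  by rewrite -mulr_sumr /=; ring.
by move=> j _; rewrite coZ mulrCA.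
Qed.
Lemma eulerDr cw x y y' : euler cw x (y + y') = euler cw x y + euler cw x y'.
Proof. by elim: cw => [|s cw IH] /=; rewrite ?addr0 // IH coD; ring. Qed.
Lemma eulerZr cw c x y : euler cw x (c *: y) = c * euler cw x y.
Proof. by elim: cw => [|s cw IH] /=; rewrite ?mulr0 // IH coZ; ring. Qed.
Lemma eulerNl cw x y : euler cw (- x) y = - euler cw x y.
Proof. by rewrite -scaleN1r eulerZl mulN1r. Qed.

Lemma euler_ext cw x y x' y' : {in cw, forall t, co x t = co x' t} ->
  {in cw, forall t, co y t = co y' t} -> euler cw x y = euler cw x' y'.
Proof.
elim: cw => //= s cw IH Ex Ey; rewrite IH ?Ex ?Ey ?mem_head //.
- congr (_ * (_ + _) + _); apply: eq_big_seq => j jcw.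
  by rewrite Ex // inE jcw orbT.
- by move=> t tcw; rewrite Ex // inE tcw orbT.
- by move=> t tcw; rewrite Ey // inE tcw orbT.
Qed.
Lemma euler0l cw y : euler cw 0 y = 0.
Proof. by rewrite -(scale0r 0) eulerZl mul0r. Qed.
Lemma euler0r cw x : euler cw x 0 = 0.
Proof. by rewrite -(scale0r 0) eulerZr mul0r. Qed.

Lemma euler_rcons cw s x y : euler (rcons cw s) x y =
  euler cw x y + co x s * (co y s + \sum_(j <- cw) cart q s j * co y j).
Proof.
elim: cw => [|t cw IH] /=; first by rewrite !big_nil; ring.
by rewrite IH big_rcons big_cons /= (cart_sym _ s t); ring.
Qed.

Lemma supp_sub v J J' : {subset J <= J'} -> supp v J -> supp v J'.
Proof. by move=> JJ vJ t tJ; apply: vJ; apply: contra tJ; apply: JJ. Qed.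
Lemma supp_rcons v J s : supp v (rcons J s) <-> supp v (s :: J).
Proof. by split; apply: supp_sub => t; rewrite mem_rcons. Qed.
Lemma supp_alpha s J : s \in J -> supp (a s) J.
Proof.
by move=> sJ t tJ; rewrite co_alpha; case: eqP => // st; rewrite -st sJ in tJ.
Qed.
Lemma suppD v v' J : supp v J -> supp v' J -> supp (v + v') J.
Proof. by move=> vJ v'J t tJ; rewrite coD vJ // v'J // addr0. Qed.
Lemma suppZ c v J : supp v J -> supp (c *: v) J.
Proof. by move=> vJ t tJ; rewrite coZ vJ // mulr0. Qed.
Lemma suppB v v' J : supp v J -> supp v' J -> supp (v - v') J.
Proof. by move=> vJ v'J t tJ; rewrite coB vJ // v'J // subr0. Qed.
Lemma supp_repS s v J : s \in S -> s \in J -> supp v J -> supp (act s v) J.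
Proof. by move=> sS sJ vJ; rewrite repS //; apply/suppB/suppZ/supp_alpha. Qed.

Lemma dl_supp s v J : uniq J -> supp v J -> dl q s v = \sum_(t <- J) cart q s t * co v t.
Proof.
move=> uJ vJ; rewrite [RHS]big_uniq //= /dl (bigID (mem J)) /=.
by rewrite [X in _ + X]big1 ?addr0 // => t tJ; rewrite vJ // mulr0.
Qed.

Lemma co_repS s v : s \in S -> co (act s v) s = co v s - dl q s v.
Proof. by move=> sS; rewrite repS // coB coZ co_alpha eqxx mulr1. Qed.

Lemma euler_consE s cw x y : s \in S -> uniq (s :: cw) -> supp x (s :: cw) ->
  euler (s :: cw) x y = - co (act s x) s * co y s + euler cw x y.
Proof.
move=> sS uJ xJ; rewrite co_repS // (dl_supp _ uJ xJ) /= big_cons cartss.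
by under eq_bigr do rewrite cart_sym; ring.
Qed.
Lemma euler_rconsE s cw x y : s \in S -> uniq (s :: cw) -> supp y (s :: cw) ->
  euler (rcons cw s) x y = euler cw x y - co x s * co (act s y) s.
Proof.
move=> sS uJ yJ; rewrite co_repS // (dl_supp _ uJ yJ) /= big_cons cartss euler_rcons.
by ring.
Qed.

(** As first letter, [s] contributes minus the product of the [s]-coordinates of s x and y; as last
    letter, after reflecting both arguments, it contributes the same product. The remaining letters
    do not see [s]. *)
Lemma euler_rot s cw x y : s \in S -> uniq (s :: cw) ->
  supp x (s :: cw) -> supp y (s :: cw) ->
  euler (rcons cw s) (act s x) (act s y) = euler (s :: cw) x y.
Proof.
move=> sS uJ xJ yJ; rewrite euler_consE // euler_rconsE //; last first.
  by apply: supp_repS => //; rewrite mem_head.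
rewrite repSS // addrC mulNr; congr (_ + _).
have su t : t \in cw -> s != t by apply: contraTneq => <-; have /andP[] := uJ.
by apply: euler_ext => t /su st; rewrite (rep_co _ sS st).
Qed.

Lemma euler_alpha_head s cw y : s \notin cw -> euler (s :: cw) (a s) y = co y s.
Proof.
move=> sN; have E t : t \in cw -> co (a s) t = co 0 t.
  by rewrite co0 co_alpha; case: eqP => // <-; rewrite (negPf sN).
rewrite /= (euler_ext (x' := 0) (y' := y) E) // euler0l addr0 co_alpha eqxx.
rewrite big1_seq ?addr0 ?mulr1 // => j /E ->; by rewrite co0 mulr0.
Qed.
Lemma euler_alpha_last s cw x : s \notin cw -> euler (rcons cw s) x (a s) = co x s.
Proof.
move=> sN; have E t : t \in cw -> co (a s) t = co 0 t.
  by rewrite co0 co_alpha; case: eqP => // <-; rewrite (negPf sN).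
rewrite euler_rcons (euler_ext (x' := x) (y' := 0) _ E) // euler0r add0r co_alpha eqxx.
rewrite big1_seq ?addr0 ?mulr1 // => j /E ->; by rewrite co0 mulr0.
Qed.
Lemma euler_head_alpha s cw x : s \in S -> uniq (s :: cw) -> supp x (s :: cw) ->
  euler (s :: cw) x (a s) = - co (act s x) s.
Proof.
move=> sS uJ xJ; rewrite euler_consE // co_alpha eqxx mulr1.
have /andP[sN _] := uJ; have E t : t \in cw -> co (a s) t = co 0 t.
  by rewrite co0 co_alpha; case: eqP => // <-; rewrite (negPf sN).
by rewrite (euler_ext (x' := x) (y' := 0) _ E) // euler0r addr0.
Qed.
Lemma euler_last_alpha s cw y : s \in S -> uniq (s :: cw) -> supp y (s :: cw) ->
  euler (rcons cw s) (a s) y = - co (act s y) s.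
Proof.
move=> sS uJ yJ; rewrite euler_rconsE // co_alpha eqxx mul1r.
have /andP[sN _] := uJ; have E t : t \in cw -> co (a s) t = co 0 t.
  by rewrite co0 co_alpha; case: eqP => // <-; rewrite (negPf sN).
by rewrite (euler_ext (x' := 0) (y' := y) E) // euler0l add0r.
Qed.
Lemma euler_cons_supp s cw x y : supp y cw -> s \notin cw ->
  euler (s :: cw) x y = euler cw x y.
Proof. by move=> ycw sN; rewrite /= ycw // mul0r add0r. Qed.

(** * Cones and unitriangular systems *)

Fixpoint cone A v : Prop :=
  if A is x :: A' then exists2 p : R, 0 <= p & cone A' (v - p *: x) else v = 0.

Lemma cone_closed (P : 'cV[R]_#|gT| -> Prop) A v :
  P 0 -> (forall x y, P x -> P y -> P (x + y)) ->
  (forall p x, 0 <= p -> P x -> P (p *: x)) ->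
  {in A, forall x, P x} -> cone A v -> P v.
Proof.
move=> P0 PD PZ; elim: A v => [|x A IH] v /= AP; first by move->.
case=> p p0 /IH Pv; rewrite -(subrK (p *: x) v); apply: PD; last first.
  by apply: PZ => //; apply: AP; rewrite mem_head.
by apply: Pv => y yA; apply: AP; rewrite inE yA orbT.
Qed.

(** Meant for the sum of all coordinates but one, which is positive on every positive root except
    one simple root and vanishes on that one. *)
Lemma cone_pos0 (f : 'cV[R]_#|gT| -> R) A v :
  (forall x y, f (x + y) = f x + f y) -> (forall c x, f (c *: x) = c * f x) ->
  {in A, forall x, 0 < f x} -> cone A v -> f v = 0 -> v = 0.
Proof.
move=> fD fZ; elim: A v => //= x A IH v fA [p p0 cv] fv0.
have fA' : {in A, forall y, 0 < f y} by move=> y yA; apply: fA; rewrite inE yA orbT.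
have fx : 0 < f x by apply: fA; rewrite mem_head.
have fv' : 0 <= f (v - p *: x).
  apply: (cone_closed (P := fun y => 0 <= f y)) cv.
  - by rewrite -(scale0r 0) fZ mul0r.
  - by move=> y z; rewrite fD; apply: addr_ge0.
  - by move=> c y c0; rewrite fZ; apply: mulr_ge0.
  - by move=> y /fA' /ltW.
move: fv'; rewrite fD -scaleNr fZ fv0 add0r mulNr oppr_ge0 pmulr_lle0 // => ple.
have p00 : p = 0 by apply/eqP; rewrite eq_le ple p0.
by move: cv; rewrite p00 scale0r subr0 => cv; apply: IH.
Qed.

Lemma linear_span0 (f : 'cV[R]_#|gT| -> R) A v :
  (forall x y, f (x + y) = f x + f y) -> (forall c x, f (c *: x) = c * f x) ->
  {in A, forall x, f x = 0} -> v \in <<A>>%VS -> f v = 0.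
Proof.
move=> fD fZ; elim: A v => [|x A IH] v fA.
  by rewrite span_nil memv0 => /eqP ->; rewrite -(scale0r 0) fZ mul0r.
rewrite span_cons => /memv_addP[_ /vlineP[c ->] [y yA ->]].
rewrite fD fZ fA ?mem_head // mulr0 add0r; apply: IH => // z zA.
by apply: fA; rewrite inE zA orbT.
Qed.

(* Back substitution in a unitriangular system with nonpositive off-diagonal
   entries. *)
Lemma cone_triangular (F : 'cV[R]_#|gT| -> 'cV[R]_#|gT| -> R) A v :
  (forall z x y, F z (x + y) = F z x + F z y) ->
  (forall z c x, F z (c *: x) = c * F z x) ->
  pairwise (fun x y => (F x y == 0) && (F y x <= 0)) A ->
  all (fun x => F x x == 1) A ->
  v \in <<A>>%VS -> {in A, forall x, 0 <= F x v} -> cone A v.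
Proof.
move=> FD FZ; elim: A v => [|x A IH] v; first by rewrite span_nil memv0 => _ _ /eqP.
rewrite /= => /andP[/allP xA pA] /andP[/eqP Fxx FA].
rewrite span_cons => /memv_addP[_ /vlineP[c ->] [y yA ->]] pos_v.
have Fxy : F x y = 0.
  apply: (linear_span0 (FD x) (FZ x)) yA => z /xA /andP[/eqP ->] //.
have c0 : 0 <= c.
  by have := pos_v x (mem_head _ _); rewrite FD FZ Fxx mulr1 Fxy addr0.
exists c => //.
rewrite addrC addKr; apply: IH => // z zA.
have := pos_v z; rewrite inE zA orbT => /(_ isT); rewrite FD FZ => /le_trans; apply.
by rewrite gerDr mulr_ge0_le0 //; have /andP[] := xA z zA.
Qed.

(* [csort cw wd A D]: [wd] is the sorting word of a sortable element w of the
   parabolic subgroup of [cw]. [A] and [- D] are the positive and negative roots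
   of Reading and Speyer's set C_c(w), so [D] lists the cover roots of w in
   inversion order. *)
Inductive csort : seq gT -> seq gT -> seq 'cV[R]_#|gT| -> seq 'cV[R]_#|gT| -> Prop :=
| CsNil : csort [::] [::] [::] [::]
| CsSkip s cw wd A D : csort cw wd A D -> csort (s :: cw) wd (a s :: A) D
| CsMove s cw wd A D : csort (rcons cw s) wd A D ->
    nneg (act (wprod wd)^-1%g (a s)) -> a s \notin A ->
    csort (s :: cw) (s :: wd) (map (fun v => act s v) A) (map (fun v => act s v) D)
| CsCover s cw wd A1 A2 D : csort (rcons cw s) wd (A1 ++ a s :: A2) D ->
    csort (s :: cw) (s :: wd)
      (map (fun v => act s v) (A1 ++ A2)) (a s :: map (fun v => act s v) D).

Definition triangular cw A :=
  pairwise (fun x y => (euler cw x y == 0) && (euler cw y x <= 0)) A &&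
  all (fun x => euler cw x x == 1) A.

(* [cs_prod] is the factorization of the Coxeter element as a product of
   noncrossing partitions, the second one being Read w. *)
Record csort_spec cw wd A D : Prop := CsortSpec {
  cs_word : all (mem S) wd /\ {subset wd <= cw};
  cs_size : (size A + size D)%N = size cw;
  cs_prod : (wprod (map tau A) * wprod (map tau D))%g = wprod cw;
  cs_posA : forall b, b \in A -> pos b /\ supp b cw;
  cs_posD : forall b, b \in D -> pos b /\ supp b cw;
  cs_triA : triangular cw A;
  cs_triD : triangular cw D;
  cs_AD : forall x y, x \in A -> y \in D -> euler cw x y = 0;
  cs_A : forall x, x \in A -> nneg (act (wprod wd)^-1%g x);
  cs_D : forall y, y \in D -> exists2 r, r \in S & y = - act (wprod wd) (a r);
  cs_cov : forall r, r \in S -> nneg (- act (wprod wd) (a r)) ->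
             - act (wprod wd) (a r) \in D;
  cs_span : forall v, supp v cw -> v \in <<A ++ D>>%VS
}.

Lemma root_supp b t : isroot b -> t \notin S -> co b t = 0.
Proof.
move=> /isrootP[w [s [wW sS ->]]] tS; have := wW; rewrite -(geo_gen G) => /gen_wprod[z zS <-].
rewrite rep_word_co ?co_alpha //; first by case: eqP => // st; rewrite -st sS in tS.
by apply: contra tS => /(allP zS).
Qed.

Lemma wprod_inv z : all (mem S) z -> (wprod z)^-1%g = wprod (rev z).
Proof.
elim: z => [|s z IH] /=; first by rewrite wprod_nil invg1.
by case/andP=> sS zS; rewrite rev_cons wprod_rcons wprod_cons invMg (SV sS) IH.
Qed.

Lemma rep_wordV_co z v t : all (mem S) z -> t \notin z -> co (act (wprod z)^-1%g v) t = co v t.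
Proof. by move=> zS tz; rewrite wprod_inv // rep_word_co ?all_rev ?mem_rev. Qed.

Lemma pos_off_simple s b : s \in S -> pos b -> b != a s -> 0 < \sum_(t | t != s) co b t.
Proof.
move=> sS /andP[rb pb] bs; have b_ge t : 0 <= co b t by have /nnegP := pb.
rewrite lt0r sumr_ge0 ?andbT // psumr_eq0 //; apply: contra bs => /allP b0; apply/eqP.
apply: pos_alpha => // t ts; apply/eqP; have := b0 t; rewrite ts mem_index_enum.
by move=> /(_ isT).
Qed.

Lemma pos_nneg b : pos b -> nneg b. Proof. by case/andP. Qed.
Lemma pos_root b : pos b -> isroot b. Proof. by case/andP. Qed.
Lemma pos_alphaS s : s \in S -> pos (a s).
Proof. by move=> sS; rewrite /pos root_alpha // nneg_alpha. Qed.
Lemma root_pos b : isroot b -> pos b = nneg b.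
Proof. by rewrite /pos => ->. Qed.
Lemma pos_neq0 b : pos b -> b != 0. Proof. by case/andP=> /root_neq0. Qed.
Lemma pos_ge0 b t : pos b -> 0 <= co b t.
Proof. by case/andP=> _ /nnegP. Qed.

Section Spec.
Variables (cw wd : seq gT) (A D : seq 'cV[R]_#|gT|).
Hypothesis sp : csort_spec cw wd A D.
Let w := wprod wd.

Lemma cs_wordW : w \in W.
Proof. by have [wdS _] := cs_word sp; apply: wprodW. Qed.

Lemma euler_span_l x v : v \in <<D>>%VS -> x \in A -> euler cw x v = 0.
Proof.
move=> vD xA; apply: (linear_span0 (A := D)) vD => [y z|c y|y yD].
- exact: eulerDr.
- exact: eulerZr.
- exact: (cs_AD sp).
Qed.
Lemma euler_span_r v y : v \in <<A>>%VS -> y \in D -> euler cw v y = 0.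
Proof.
move=> vA yD; apply: (linear_span0 (f := fun x => euler cw x y) (A := A)) vA => [x z|c x|x xA].
- exact: eulerDl.
- exact: eulerZl.
- exact: (cs_AD sp).
Qed.

Lemma cs_decomp v : supp v cw -> exists X Z, [/\ X \in <<A>>%VS, Z \in <<D>>%VS, v = X + Z,
  {in A, forall x, euler cw x v = euler cw x X} &
  {in D, forall y, euler cw v y = euler cw Z y}].
Proof.
move=> vcw; have := cs_span sp vcw; rewrite span_cat => /memv_addP[X XA [Z ZD vE]].
exists X, Z; split=> // [x xA|y yD].
  by rewrite vE eulerDr (euler_span_l ZD xA) addr0.
by rewrite vE eulerDl (euler_span_r XA yD) add0r.
Qed.

Lemma cs_coneA X : X \in <<A>>%VS -> {in A, forall x, 0 <= euler cw x X} -> cone A X.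
Proof.
have /andP[pA aA] := cs_triA sp.
move=> XA pX; apply: (cone_triangular (F := euler cw)) => // *.
  exact: eulerDr.
exact: eulerZr.
Qed.

(** Here the unknown vector is the left argument of the form; this transposes the triangular system,
    hence the reversal of D. *)
Lemma cs_coneD Z : Z \in <<D>>%VS -> {in D, forall y, 0 <= euler cw Z y} -> cone (rev D) Z.
Proof.
have /andP[pD aD] := cs_triD sp.
move=> ZD pZ; apply: (cone_triangular (F := fun x y => euler cw y x)).
- by move=> z x y; apply: eulerDl.
- by move=> z c x; apply: eulerZl.
- by rewrite pairwise_rev.
- by rewrite all_rev.
- by rewrite (eq_span (mem_rev D)).
- by move=> y; rewrite mem_rev; apply: pZ.
Qed.

Lemma cs_posAw x : x \in A -> pos (act w^-1%g x).
Proof.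
move=> xA; have [/pos_root rx _] := cs_posA sp xA.
by rewrite root_pos ?(cs_A sp) // root_rep // groupV cs_wordW.
Qed.

Lemma cs_Dw y : y \in D -> exists2 r, r \in S & act w^-1%g y = - a r.
Proof. by case/(cs_D sp)=> r rS ->; exists r => //; rewrite repN repK // cs_wordW. Qed.

Lemma cs_coneA_nneg X : cone A X -> nneg (act w^-1%g X).
Proof.
apply: (cone_closed (P := fun v => nneg (act w^-1%g v))) => [|v v'|c v c0|v].
- by rewrite mulmx0 nneg0.
- by rewrite repD; apply: nnegD.
- by rewrite repZ; apply: nnegZ.
- exact: (cs_A sp).
Qed.

Lemma cs_coneD_nneg Z : cone (rev D) Z -> nneg (- act w^-1%g Z).
Proof.
apply: (cone_closed (P := fun v => nneg (- act w^-1%g v))) => [|v v'|c v c0|v].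
- by rewrite mulmx0 oppr0 nneg0.
- by rewrite repD opprD; apply: nnegD.
- by rewrite repZ -scalerN; apply: nnegZ.
- by rewrite mem_rev => /cs_Dw[t tS ->]; rewrite opprK nneg_alpha.
Qed.

(** All E(x, v) with x in A vanish, so back substitution puts both v and -v in the cone of A, which
    consists of nonnegative vectors. *)
Lemma cs_span_disjoint v : v \in <<A>>%VS -> v \in <<D>>%VS -> v = 0.
Proof.
move=> vA vD.
have cA : cone A v by apply: cs_coneA => // x xA; rewrite euler_span_l.
have cNA : cone A (- v).
  by apply: cs_coneA => [|x xA]; rewrite ?memvN // euler_span_l // memvN.
have nn z : cone A z -> nneg z.
  apply: (cone_closed (P := fun v => nneg v)) => [|x y|c x|x xA]; [exact: nneg0|exact: nnegD|exact: nnegZ|].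
  by have [/pos_nneg] := cs_posA sp xA.
exact: nneg_anti (nn _ cA) (nn _ cNA).
Qed.

End Spec.

(* [s] being the last letter, [euler x (a s)] is the [s]-coordinate of [x], and
   [euler (a s) y] is minus that of the reflection of [y]. *)
Lemma cs_last_decomp s cw wd A D : csort_spec (rcons cw s) wd A D ->
  uniq (s :: cw) -> s \in S -> a s \notin D ->
  exists X Y, [/\ cone A X, cone (rev D) Y & a s = X - Y].
Proof.
move=> sp uJ sS sD; have sN : s \notin cw by case/andP: uJ.
have ss : supp (a s) (rcons cw s) by apply: supp_alpha; rewrite mem_rcons mem_head.
have [X [Z [XA ZD E EA ED]]] := cs_decomp sp ss.
exists X, (- Z); split; last by rewrite opprK.
  apply: (cs_coneA sp) => // x xA; rewrite -EA // euler_alpha_last //.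
  by apply: pos_ge0; have [] := cs_posA sp xA.
apply: (cs_coneD sp) => [|y yD]; first by rewrite memvN.
have [py /supp_rcons sy] := cs_posD sp yD.
rewrite eulerNl -ED // euler_last_alpha // opprK; apply: pos_ge0; apply: pos_simple => //.
by apply: contra sD => /eqP <-.
Qed.

Lemma spec_nil : csort_spec [::] [::] [::] [::].
Proof.
split=> //=.
- by rewrite !wprod_nil mulg1.
- move=> r rS; rewrite wprod_nil rep1 => n; have := nneg_anti (nneg_alpha r) n.
  by move/eqP; rewrite (negPf (alpha_neq0 r)).
- by move=> v v0; rewrite span_nil memv0; apply/eqP/co_inj => t; rewrite co0 v0.
Qed.

Lemma eq_triangular_map (f : 'cV[R]_#|gT| -> 'cV[R]_#|gT|) cw cw' A :
  {in A &, forall x y, euler cw' (f x) (f y) = euler cw x y} ->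
  triangular cw A -> triangular cw' (map f A).
Proof.
move=> E /andP[pA aA]; apply/andP; split; last first.
  by rewrite all_map; apply/allP => x xA /=; rewrite E //; apply: (allP aA).
rewrite pairwise_map; move: pA; apply: (sub_in_pairwise (P := mem A)); last exact/allP.
by move=> x y xA yA /=; rewrite !E.
Qed.

(** The word avoids [s], so w^-1 keeps the [s]-coordinate of [a s] equal to 1 and the root stays
    positive. It goes to the head of A because E(a_s, -) is the [s]-coordinate, which is zero on the
    old roots. *)
Lemma spec_skip s cw wd A D : s \in S -> uniq (s :: cw) ->
  csort_spec cw wd A D -> csort_spec (s :: cw) wd (a s :: A) D.
Proof.
move=> sS uJ sp; have sN : s \notin cw by case/andP: uJ.
have [wdS wdcw] := cs_word sp.
have up v : supp v cw -> supp v (s :: cw).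
  by apply: supp_sub => t tcw; rewrite inE tcw orbT.
have tri B : {in B, forall b, pos b /\ supp b cw} -> triangular cw B -> triangular (s :: cw) B.
  move=> Bp tB; rewrite -[B]map_id; apply: eq_triangular_map tB => x y xB yB.
  by rewrite euler_cons_supp //; have [] := Bp y yB.
split.
- by split=> // t /wdcw tcw; rewrite inE tcw orbT.
- by rewrite /= addSn (cs_size sp).
- by rewrite /= !wprod_cons tau_alpha // -mulgA (cs_prod sp).
- move=> b; rewrite inE => /predU1P[->|bA].
    by split; [apply: pos_alphaS | apply/supp_alpha/mem_head].
  by have [pb sb] := cs_posA sp bA; split=> //; apply: up.
- by move=> b bD; have [pb sb] := cs_posD sp bD; split=> //; apply: up.
- have /andP[pA aA] := tri A (cs_posA sp) (cs_triA sp).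
  apply/andP; split=> /=.
    rewrite [X in _ && X]pA andbT; apply/allP => y yA; have [py sy] := cs_posA sp yA.
    rewrite -/(euler (s :: cw) (a s) y) -/(euler (s :: cw) y (a s)).
    rewrite euler_alpha_head // sy // eqxx euler_head_alpha //; last exact: up.
    rewrite oppr_le0; apply/pos_ge0/pos_simple => //.
    by apply/eqP => ya; have := sy s sN; rewrite ya co_alpha eqxx => /eqP; rewrite oner_eq0.
  rewrite [X in _ && X]aA andbT -/(euler (s :: cw) (a s) (a s)).
  by rewrite euler_alpha_head // co_alpha eqxx.
- exact: tri (cs_posD sp) (cs_triD sp).
- move=> x y xA yD; have [py sy] := cs_posD sp yD.
  rewrite euler_cons_supp //; move: xA; rewrite inE => /predU1P[->|xA].
    by rewrite -(euler_cons_supp (a s) sy sN) euler_alpha_head // sy.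
  exact: (cs_AD sp).
- move=> x; rewrite inE => /predU1P[->|/(cs_A sp) //].
  have rb : isroot (act (wprod wd)^-1%g (a s)).
    by rewrite root_rep ?root_alpha // groupV wprodW.
  case/orP: (root_sign rb) => // /nnegP/(_ s).
  rewrite coN rep_wordV_co //; last by apply: contra sN => /wdcw.
  by rewrite co_alpha eqxx oppr_ge0 ler10.
- exact: (cs_D sp).
- exact: (cs_cov sp).
- move=> v vJ; rewrite /= span_cons -(subrK (co v s *: a s) v) addrC.
  apply: memv_add; first by rewrite memvZ // memv_line.
  apply: (cs_span sp) => t tcw; rewrite coB coZ co_alpha.
  case: eqVneq => [<-|st]; first by rewrite mulr1 subrr.
  by rewrite mulr0 subr0 vJ // inE negb_or eq_sym st.
Qed.

Implicit Types (B L : seq 'cV[R]_#|gT|).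
Local Notation rep_seq s A := (map (fun v => rho s *m v) A).

Lemma tau_conj_seq s A : s \in S -> {in A, forall b, isroot b} ->
  map tau (rep_seq s A) = map (fun t => t ^ s)%g (map tau A).
Proof.
move=> sS rA; rewrite -!map_comp; apply/eq_in_map => b bA /=.
by rewrite tau_rep ?S_in_W ?rA // conjgE SV // mulgA.
Qed.

Lemma mem_span_rep s v L : v \in <<L>>%VS -> act s v \in <<rep_seq s L>>%VS.
Proof.
elim: L v => [|x L IH] v; first by rewrite span_nil memv0 => /eqP ->; rewrite mulmx0 mem0v.
rewrite /= !span_cons => /memv_addP[_ /vlineP[c ->] [y yL ->]].
by rewrite repD repZ memv_add ?IH // memvZ // memv_line.
Qed.

Lemma wprod_conjS s z z' : s \in S -> wprod z = wprod (rcons z' s) ->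
  (wprod z ^ s)%g = wprod (s :: z').
Proof. by move=> sS ->; rewrite wprod_rcons wprod_cons conjgE SV // -!mulgA (geo_inv G) // mulg1. Qed.

(** The only positive root that [s] makes negative is [a s]. *)
Lemma new_descent s w r : s \in S -> r \in S -> w \in W ->
  nneg (- act (s * w)%g (a r)) -> nneg (- act w (a r)) || (act w (a r) == a s).
Proof.
move=> sS rS wW; rewrite (repM _ (S_in_W sS) wW) => n.
have rb : isroot (act w (a r)) by rewrite root_rep ?root_alpha.
case/orP: (root_sign rb) => [p|->//]; apply/orP; right; apply/negPn/negP => ne.
have pb : pos (act w (a r)) by rewrite root_pos.
have /andP[_ p'] := pos_simple sS pb ne.
by move: n; rewrite root_nneg ?p' // root_rep ?S_in_W.
Qed.

Section Step.
Variables (s : gT) (cw wd : seq gT) (A D : seq 'cV[R]_#|gT|).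
Hypotheses (sS : s \in S) (uJ : uniq (s :: cw)).
Hypothesis sp : csort_spec (rcons cw s) wd A D.
Hypothesis asc : nneg (act (wprod wd)^-1%g (a s)).

Lemma step_word : all (mem S) (s :: wd) /\ {subset s :: wd <= s :: cw}.
Proof.
have [wdS wdcw] := cs_word sp; split; first by rewrite /= sS.
move=> t; rewrite inE => /predU1P[->|/wdcw]; first exact: mem_head.
by rewrite mem_rcons.
Qed.

Lemma step_rootA : {in A, forall b, isroot b}.
Proof. by move=> b bA; have [/pos_root] := cs_posA sp bA. Qed.
Lemma step_rootD : {in D, forall b, isroot b}.
Proof. by move=> b bD; have [/pos_root] := cs_posD sp bD. Qed.

Lemma step_notin : a s \notin D.
Proof.
apply/negP => /(cs_Dw sp)[r rS E]; move: asc; rewrite E => /(nneg_anti (nneg_alpha r)).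
by apply/eqP/alpha_neq0.
Qed.

Lemma step_pos b B : {in B, forall b, pos b /\ supp b (rcons cw s)} -> a s \notin B ->
  b \in rep_seq s B -> pos b /\ supp b (s :: cw).
Proof.
move=> Bp sB /mapP[x xB ->]; have [px /supp_rcons sx] := Bp x xB; split.
  by apply: pos_simple => //; apply: contra sB => /eqP <-.
by apply: supp_repS => //; apply: mem_head.
Qed.

Lemma step_euler B B' : {in B, forall b, pos b /\ supp b (rcons cw s)} ->
  {in B', forall b, pos b /\ supp b (rcons cw s)} ->
  {in B & B', forall x y, euler (s :: cw) (act s x) (act s y) = euler (rcons cw s) x y}.
Proof.
move=> Bp Bp' x y xB yB'; have [_ /supp_rcons sx] := Bp x xB.
have [_ /supp_rcons sy] := Bp' y yB'.
by rewrite -euler_rot ?repSS //; apply: supp_repS => //; apply: mem_head.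
Qed.

Lemma step_tri B : {in B, forall b, pos b /\ supp b (rcons cw s)} ->
  triangular (rcons cw s) B -> triangular (s :: cw) (rep_seq s B).
Proof. by move=> Bp; apply: eq_triangular_map => x y xB yB; apply: (step_euler Bp Bp). Qed.

Lemma step_repV x : act (wprod (s :: wd))^-1%g (act s x) = act (wprod wd)^-1%g x.
Proof.
have [wdS _] := cs_word sp; have wW := wprodW wdS; have sW := S_in_W sS.
by rewrite wprod_cons invMg (SV sS) (repM _ (groupVr wW) sW) repSS.
Qed.

Lemma step_rep x : act (wprod (s :: wd)) x = act s (act (wprod wd) x).
Proof. by rewrite wprod_cons (repM _ (S_in_W sS) (cs_wordW sp)). Qed.

Lemma step_D y : y \in rep_seq s D -> exists2 r, r \in S & y = - act (wprod (s :: wd)) (a r).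
Proof.
case/mapP=> x xD ->; have [r rS ->] := cs_D sp xD; exists r => //.
by rewrite step_rep repN.
Qed.

Lemma step_cov r : r \in S -> nneg (- act (wprod (s :: wd)) (a r)) ->
  (- act (wprod (s :: wd)) (a r) \in rep_seq s D) || (act (wprod wd) (a r) == a s).
Proof.
move=> rS; rewrite {1}wprod_cons => /(new_descent sS rS (cs_wordW sp)) /orP[n|->].
  by rewrite step_rep -repN map_f // (cs_cov sp).
by rewrite orbT.
Qed.

Lemma step_span v : supp v (s :: cw) -> v \in <<rep_seq s (A ++ D)>>%VS.
Proof.
move=> vJ; rewrite -[v](repSS _ sS); apply/mem_span_rep/(cs_span sp)/supp_rcons.
by apply: supp_repS => //; apply: mem_head.
Qed.

(** Write a_s = X - Y with X in the cone of A and Y in that of D. If w a_r = a_s, then w^-1 sends A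
    and -D to positive roots other than a_r, on which the sum of the coordinates off r is positive.
    That sum is zero for w^-1 a_s = a_r, which forces X = Y = 0. *)
Lemma step_no_cover r : a s \notin A -> r \in S -> act (wprod wd) (a r) <> a s.
Proof.
move=> sA rS E; have wW := cs_wordW sp.
have [X [Y [cX cY XY]]] := cs_last_decomp sp uJ sS step_notin.
pose f v := \sum_(t | t != r) co (act (wprod wd)^-1%g v) t.
have fD x y : f (x + y) = f x + f y.
  by rewrite /f -big_split; apply: eq_bigr => t _; rewrite repD coD.
have fZ c x : f (c *: x) = c * f x.
  by rewrite /f mulr_sumr; apply: eq_bigr => t _; rewrite repZ coZ.
have fA : {in A, forall x, 0 < f x}.
  move=> x xA; apply: pos_off_simple => //; first exact: (cs_posAw sp).
  by apply: contra sA => /eqP E'; rewrite -E -E' repVK.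
have fND : {in rev D, forall x, 0 < f (- x)}.
  move=> x; rewrite mem_rev => xD; have [r' r'S E'] := cs_Dw sp xD.
  rewrite /f repN E' opprK; apply: pos_off_simple => //; first exact: pos_alphaS.
  apply/eqP => rr'; have [/pos_nneg px _] := cs_posD sp xD.
  have := nneg_anti px; rewrite -[x](repVK _ wW) E' rr' repN E opprK nneg_alpha.
  by move=> /(_ isT)/eqP; rewrite oppr_eq0 (negPf (alpha_neq0 s)).
pose g v := f (- v).
have gD x y : g (x + y) = g x + g y by rewrite /g opprD fD.
have gZ c x : g (c *: x) = c * g x by rewrite /g -scalerN fZ.
have ge0 (h : _ -> R) B v : (forall x y, h (x + y) = h x + h y) -> (forall c x, h (c *: x) = c * h x) ->
    {in B, forall x, 0 < h x} -> cone B v -> 0 <= h v.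
  move=> hD hZ hB; apply: (cone_closed (P := fun v => 0 <= h v)) => [|x y|c x|x xB].
  - by rewrite -(scale0r 0) hZ mul0r.
  - by rewrite hD; apply: addr_ge0.
  - by move=> c0; rewrite hZ; apply: mulr_ge0.
  - exact/ltW/hB.
have fX := ge0 _ _ _ fD fZ fA cX; have gY := ge0 _ _ _ gD gZ fND cY.
have fas : f X + g Y = 0.
  rewrite /g -fD -XY -E /f repK // big1 // => t /negPf tr.
  by rewrite co_alpha eq_sym tr.
have [fX0 gY0] : f X = 0 /\ g Y = 0 by split; apply/eqP; rewrite eq_le; lra.
have := alpha_neq0 s; rewrite XY (cone_pos0 fD fZ fA cX fX0) (cone_pos0 gD gZ fND cY gY0).
by rewrite subr0 eqxx.
Qed.

Lemma spec_move : a s \notin A ->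
  csort_spec (s :: cw) (s :: wd) (rep_seq s A) (rep_seq s D).
Proof.
move=> sA; split.
- exact: step_word.
- by rewrite !size_map (cs_size sp) size_rcons.
- rewrite !tau_conj_seq //; [|exact: step_rootD|exact: step_rootA].
  rewrite !wprod_conj -conjMg (cs_prod sp); exact: wprod_conjS.
- by move=> b; apply: step_pos => //; apply: (cs_posA sp).
- by move=> b; apply: step_pos => //; [apply: (cs_posD sp) | apply: step_notin].
- exact: step_tri (cs_posA sp) (cs_triA sp).
- exact: step_tri (cs_posD sp) (cs_triD sp).
- move=> _ _ /mapP[x xA ->] /mapP[y yD ->].
  by rewrite (step_euler (cs_posA sp) (cs_posD sp)) // (cs_AD sp).
- by move=> _ /mapP[x xA ->]; rewrite step_repV (cs_A sp).
- exact: step_D.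
- move=> r rS n; case/orP: (step_cov rS n) => // /eqP E.
  by have := step_no_cover sA rS.
- by move=> v vJ; rewrite -map_cat; apply: step_span.
Qed.

End Step.

(* That [a s] is a cover root: otherwise all cover roots of [s * w] would have
   zero [s]-coordinate, whereas expanding [a s] in the images of the simple
   roots exhibits a negative one with nonzero [s]-coordinate. *)
Lemma spec_cover s cw wd A1 A2 D : s \in S -> uniq (s :: cw) ->
  csort_spec (rcons cw s) wd (A1 ++ a s :: A2) D ->
  csort_spec (s :: cw) (s :: wd) (rep_seq s (A1 ++ A2)) (a s :: rep_seq s D).
Proof.
move=> sS uJ sp; have sN : s \notin cw by case/andP: uJ.
have wW := cs_wordW sp; have [wdS wdcw] := cs_word sp.
have sA : a s \in A1 ++ a s :: A2 by rewrite mem_cat mem_head orbT.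
have sub : {subset A1 ++ A2 <= A1 ++ a s :: A2}.
  by move=> x; rewrite !mem_cat inE => /orP[->|->]; rewrite ?orbT.
have asc := cs_A sp sA.
have sD := step_notin sp asc.
have posA x : x \in A1 ++ A2 -> pos x /\ supp x (rcons cw s) by move/sub/(cs_posA sp).
have /andP[] := cs_triA sp; rewrite pairwise_cat /= all_cat /=.
case/and4P=> /allrelP r12 p1 /allP r2 p2 /andP[d1 /andP[_ d2]].
(* With [s] as last letter, E(x, a_s) is the [s]-coordinate of x and E(a_s, x) is minus that of s x;
   triangularity of A gives the signs of both around the position of [a s]. *)
have r1 x : x \in A1 -> co x s = 0.
  move=> xA; have /andP[/eqP] := r12 x (a s) xA (mem_head _ _).
  by rewrite euler_alpha_last.
(* The roots after [a s] are orthogonal to it, so in the product the factor [s] moves past them to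
   the head of D. *)
have r2' x : x \in A2 -> act s x = x /\ co x s = 0.
  move=> xA; have [px /supp_rcons sx] : pos x /\ supp x (rcons cw s) by apply: posA; rewrite mem_cat xA orbT.
  have /andP[/eqP] := r2 x xA; rewrite euler_last_alpha // euler_alpha_last // => /eqP.
  rewrite oppr_eq0 => /eqP e1 e2.
  have e3 : co x s = 0 by apply/eqP; rewrite eq_le e2 (pos_ge0 _ px).
  split=> //; move: e1; rewrite co_repS // e3 sub0r => /eqP; rewrite oppr_eq0 => /eqP d0.
  by rewrite repS // d0 scale0r subr0.
have cs0 x : x \in A1 ++ A2 -> co x s = 0.
  by rewrite mem_cat => /orP[/r1|/r2'[]].
have sA' : a s \notin A1 ++ A2.
  by apply/negP => /cs0/eqP; rewrite co_alpha eqxx oner_eq0.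
have triA' : triangular (rcons cw s) (A1 ++ A2).
  apply/andP; split; last by rewrite all_cat d1.
  by rewrite pairwise_cat p1 p2 !andbT; apply/allrelP => x y x1 y2; apply: r12; rewrite // inE y2 orbT.
have rA : {in A1 ++ a s :: A2, forall b, isroot b} := step_rootA sp.
have as_wd : act s (a s) = - a s := rep_alpha sS.
split.
- exact: step_word sp.
- by rewrite /= !size_map !size_cat -(size_rcons cw s) -(cs_size sp) size_cat /= !addnS addSn.
- rewrite /= wprod_cons tau_alpha // !tau_conj_seq //; last first.
  + by move=> b /sub; apply: rA.
  + exact: (step_rootD sp).
  rewrite !wprod_conj map_cat wprod_cat conjMg.
  have -> : (wprod (map tau A2) ^ s)%g = wprod (map tau A2).
    rewrite -wprod_conj -tau_conj_seq //; last first.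
      by move=> b bA; apply: rA; rewrite mem_cat inE bA !orbT.
    congr wprod; congr map; rewrite -[RHS]map_id; apply/eq_in_map => x xA.
    by have [] := r2' x xA.
  have := cs_prod sp; rewrite map_cat wprod_cat /= wprod_cons tau_alpha // wprod_rcons => E.
  have -> : wprod (s :: cw) = (s * (wprod cw * s) * s)%g.
    by rewrite wprod_cons mulgA SmulKr.
  by rewrite -E !conjgE (SV sS) -!mulgA SmulK.
- by move=> b; apply: (step_pos sS) sA' => //.
- move=> b; rewrite inE => /predU1P[->|].
    by split; [apply: pos_alphaS | apply/supp_alpha/mem_head].
  by apply: (step_pos sS) sD => //; apply: (cs_posD sp).
- exact: (step_tri sS uJ posA).
- have /andP[pD aD] := step_tri sS uJ (cs_posD sp) (cs_triD sp).
  apply/andP; split=> /=; last first.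
    rewrite [X in _ && X]aD andbT -/(euler (s :: cw) (a s) (a s)).
    by rewrite euler_alpha_head // co_alpha eqxx.
  rewrite [X in _ && X]pD andbT; apply/allP => _ /mapP[y yD ->].
  have [py /supp_rcons sy] := cs_posD sp yD.
  rewrite -/(euler (s :: cw) (a s) (act s y)) -/(euler (s :: cw) (act s y) (a s)).
  rewrite euler_alpha_head // euler_head_alpha ?repSS //; last first.
    by apply: supp_repS => //; apply: mem_head.
  rewrite oppr_le0 (pos_ge0 _ py) andbT.
  by have := cs_AD sp sA yD; rewrite euler_last_alpha // => /eqP; rewrite oppr_eq0.
- move=> _ y /mapP[x xA ->]; have [px /supp_rcons sx] := posA x xA.
  rewrite inE => /predU1P[->|/mapP[z zD ->]].
    rewrite euler_head_alpha ?repSS //; first by rewrite cs0 // oppr0.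
    by apply: supp_repS => //; apply: mem_head.
  by rewrite (step_euler sS uJ posA (cs_posD sp)) // (cs_AD sp) // sub.
- by move=> _ /mapP[x xA ->]; rewrite (step_repV sS sp) (cs_A sp) // sub.
- move=> y; rewrite inE => /predU1P[->|]; last exact: (step_D sS sp).
  pose z := act (wprod wd)^-1%g (a s).
  have zE : a s = \sum_r co z r *: act (wprod wd) (a r).
    rewrite -[LHS](repVK _ wW) -/z {1}(co_sum z) mulmx_sumr.
    by apply: eq_bigr => r _; rewrite repZ.
  have [r /andP[zr nr]] : exists r, (0 < co z r) && (0 < co (- act (wprod (s :: wd)) (a r)) s).
    apply/existsP; apply: contraT => none0; have none := existsPn none0.
    have := congr1 (fun v => co (act s v) s) zE; rewrite as_wd coN co_alpha eqxx.
    have coS (F : gT -> 'cV[R]_#|gT|) : co (\sum_r F r) s = \sum_r co (F r) s.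
      by rewrite /co summxE.
    rewrite mulmx_sumr coS => E.
    have : 0 <= -1 :> R.
      rewrite E; apply: sumr_ge0 => r _; rewrite repZ coZ.
      have := none r; rewrite (lt0r (co z r)); have := asc => /nnegP/(_ r); rewrite -/z => z0.
      case: eqVneq => [-> _|zr /=]; first by rewrite mul0r.
      rewrite z0 /= -leNgt coN oppr_le0 (step_rep sS sp) => p.
      exact: mulr_ge0.
    by rewrite oppr_ge0 ler10.
  have rS : r \in S.
    apply: contraTT zr => rS; rewrite /z root_supp ?ltxx // root_rep ?groupV //.
    exact: root_alpha.
  exists r => //.
  have n : nneg (- act (wprod (s :: wd)) (a r)).
    have rb : isroot (- act (wprod (s :: wd)) (a r)).
      by rewrite isrootN // root_rep ?root_alpha // wprod_cons mulSW.
    case/orP: (root_sign rb) => // /nnegP/(_ s); rewrite coN oppr_ge0 => le.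
    by have := lt_le_trans nr le; rewrite ltxx.
  case/orP: (step_cov sS sp rS n) => [|/eqP E]; last first.
    by rewrite (step_rep sS sp) E as_wd opprK.
  case/mapP=> d dD E; move: nr; rewrite E.
  have [pd /supp_rcons sd] := cs_posD sp dD.
  have := cs_AD sp sA dD; rewrite euler_last_alpha // => /eqP.
  by rewrite oppr_eq0 => /eqP ->; rewrite ltxx.
- move=> r rS n; rewrite inE; case/orP: (step_cov sS sp rS n) => [->|/eqP E].
    by rewrite orbT.
  by rewrite (step_rep sS sp) E as_wd opprK eqxx.
- move=> v vJ; have := step_span sS sp vJ; apply/subvP/span_subvP => x.
  rewrite map_cat map_cat /= mem_cat mem_cat inE => /orP[/orP[h|/orP[/eqP ->|h]]|h].
  + by apply: memv_span; rewrite map_cat !mem_cat h.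
  + rewrite as_wd memvN; apply: memv_span; rewrite mem_cat mem_head orbT //.
  + by apply: memv_span; rewrite map_cat !mem_cat h !orbT.
  + by apply: memv_span; rewrite !mem_cat inE h !orbT.
Qed.

Lemma csortP cw wd A D : uniq cw -> all (mem S) cw -> csort cw wd A D ->
  csort_spec cw wd A D.
Proof.
move=> uJ cwS cs; elim: cs uJ cwS => {cw wd A D}.
- by move=> _ _; apply: spec_nil.
- move=> s cw wd A D _ IH uJ /= /andP[sS cwS]; apply: spec_skip => //; apply: IH => //.
  by case/andP: uJ.
- move=> s cw wd A D _ IH asc sA uJ /= /andP[sS cwS]; apply: spec_move => //; apply: IH.
    by rewrite rcons_uniq.
  by rewrite all_rcons /= sS.
- move=> s cw wd A1 A2 D _ IH uJ /= /andP[sS cwS]; apply: spec_cover => //; apply: IH.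
    by rewrite rcons_uniq.
  by rewrite all_rcons /= sS.
Qed.

Implicit Types (r : gT) (z : seq gT).

(** * The sign of [x^-1 (a s)] *)

Lemma euler_rotw z p x y : all (mem S) z -> uniq (z ++ p) ->
  supp x (z ++ p) -> supp y (z ++ p) ->
  euler (z ++ p) x y = euler (p ++ z) (act (wprod z)^-1%g x) (act (wprod z)^-1%g y).
Proof.
elim: z p x y => [|s z IH] p x y; first by rewrite wprod_nil invg1 !rep1 cats0.
rewrite [all _ _]/= cat_cons => /andP[sS zS] uJ sx sy; rewrite -euler_rot // rcons_cat.
have su v : supp v (s :: z ++ p) -> supp (act s v) (z ++ rcons p s).
  move=> /(supp_repS sS (mem_head _ _)); apply: supp_sub => t.
  by rewrite !inE !mem_cat mem_rcons inE orbCA.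
rewrite IH //; [|by rewrite -rcons_cat rcons_uniq|exact: su|exact: su].
have zW := groupVr (wprodW zS); have sW := S_in_W sS.
by rewrite cat_rcons wprod_cons invMg (SV sS) !(repM _ zW sW).
Qed.

(** Undoing the reflection in a preceding letter leaves no coordinate along that letter, so its term
    in the form vanishes and only the term of [r] remains. *)
Lemma euler_proj cw1 r cw2 b : all (mem S) cw1 -> uniq (cw1 ++ r :: cw2) ->
  euler (cw1 ++ r :: cw2) (act (wprod cw1) (a r)) b = co b r.
Proof.
elim: cw1 => [|s cw1 IH] /=.
  by move=> _ /andP[rN _]; rewrite wprod_nil rep1 -/(euler (r :: cw2) (a r) b) euler_alpha_head.
case/andP=> sS cwS uJ; have /andP[sN uJ'] := uJ; have wW := wprodW cwS.
rewrite wprod_cons (repM _ (S_in_W sS) wW).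
have sup : supp (act (wprod cw1) (a r)) (cw1 ++ r :: cw2).
  apply: supp_rep => // [t tc|]; first by rewrite mem_cat tc.
  by apply: supp_alpha; rewrite mem_cat mem_head orbT.
have sup' : supp (act s (act (wprod cw1) (a r))) (s :: cw1 ++ r :: cw2).
  apply: supp_repS => //; first exact: mem_head.
  by apply: supp_sub sup => t tc; rewrite inE tc orbT.
rewrite -/(euler (s :: cw1 ++ r :: cw2) _ b) euler_consE // repSS // sup // oppr0 mul0r add0r.
rewrite -[RHS]IH //; apply: euler_ext => // t tc; rewrite (rep_co _ sS) //.
by apply: contraNneq sN => ->.
Qed.

(** Letters before [r] are absent from the second argument; rotating the letters after [r] to the
    front makes [r] the last letter, where the pairing with [a r] is a coordinate. *)
Lemma euler_inj cw1 r cw2 b : all (mem S) (cw1 ++ r :: cw2) -> uniq (cw1 ++ r :: cw2) ->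
  euler (cw1 ++ r :: cw2) b (act (wprod cw2)^-1%g (a r)) = co b r.
Proof.
elim: cw1 => [|s cw1 IH] /=; last first.
  case/andP=> sS cwS /andP[sN uJ].
  rewrite -/(euler (s :: cw1 ++ r :: cw2) b _) euler_cons_supp ?IH //.
  move: cwS; rewrite all_cat /= => /and3P[_ rS cw2S]; rewrite wprod_inv //.
  apply: supp_rep; rewrite ?all_rev //.
    by move=> t; rewrite mem_rev mem_cat inE => ->; rewrite !orbT.
  by apply: supp_alpha; rewrite mem_cat mem_head orbT.
case/andP=> rS cwS uJ; have rN : r \notin cw2 by case/andP: uJ.
(* Rotation asks for vectors supported on the word, so [b] is truncated to the letters from [r] on,
   which leaves the pairing unchanged. *)
pose b' := \sum_(t <- r :: cw2) co b t *: a t.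
have b'E t : co b' t = if t \in r :: cw2 then co b t else 0.
  rewrite /b' /co summxE -/(co b t).
  rewrite (eq_bigr (fun i => co b i * (i == t)%:R)); last first.
    by move=> i _; rewrite -/(co (co b i *: a i) t) coZ co_alpha.
  case: ifPn => tJ.
    rewrite (bigD1_seq t) //= eqxx mulr1 big1 ?addr0 // => i /negPf ->.
    by rewrite mulr0.
  rewrite big1_seq // => i /andP[_ iJ]; case: eqP => [it|_]; last by rewrite mulr0.
  by rewrite -it iJ in tJ.
have sb' : supp b' (r :: cw2) by move=> t /negPf tJ; rewrite b'E tJ.
rewrite -/(euler (r :: cw2) b _) (euler_ext (x' := b') (y' := act (wprod cw2)^-1%g (a r))) //;
  last by move=> t tJ; rewrite b'E tJ.
have su v : supp v (r :: cw2) -> supp v (cw2 ++ [:: r]).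
  by apply: supp_sub => t; rewrite mem_cat !inE orbC.
have E := @euler_rotw cw2 [:: r] (act (wprod cw2) b') (a r) cwS.
have uc : uniq (cw2 ++ [:: r]) by rewrite cats1 rcons_uniq.
have s1 : supp (act (wprod cw2) b') (cw2 ++ [:: r]).
  by apply/su/supp_rep => // t tc; rewrite inE tc orbT.
have s2 : supp (a r) (cw2 ++ [:: r]) by apply/su/supp_alpha/mem_head.
move: {E s1 s2}(E uc s1 s2); rewrite (repK _ (wprodW cwS)) cat1s => <-.
by rewrite cats1 euler_alpha_last // rep_word_co // b'E mem_head.
Qed.

Lemma wprod_tauW B : wprod (map tau B) \in W.
Proof. by elim: B => [|c C IHC]; rewrite ?wprod_nil // wprod_cons groupM ?tau_mem. Qed.

Lemma rep_refl_prod B v : {in B, forall b, isroot b} ->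
  act (wprod (map tau B)) v - v \in <<B>>%VS.
Proof.
elim: B => [|b B IH] rB /=; first by rewrite wprod_nil rep1 subrr mem0v.
rewrite wprod_cons (repM _ (tau_mem b) (wprod_tauW B)) rep_tau ?rB ?mem_head //.
rewrite addrAC span_cons addrC memv_add ?memvN ?memvZ ?memv_line //.
by apply: IH => c cB; apply: rB; rewrite inE cB orbT.
Qed.

(** An initial generator need not be the first letter of [cw]; all that is known is that c^-1 makes
    its root negative. Such a root becomes simple just before the letter at which it changes
    sign. *)
Lemma initial_root cw b : all (mem S) cw -> pos b -> nneg (- act (wprod cw)^-1%g b) ->
  exists cw1 r cw2, cw = cw1 ++ r :: cw2 /\ b = act (wprod cw1) (a r).
Proof.
elim: cw b => [|s cw IH] b.
  rewrite wprod_nil invg1 rep1 => _ pb nb.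
  by have := pos_neq0 pb; rewrite (nneg_anti (pos_nneg pb) nb) eqxx.
move=> /= /andP[sS cwS] pb; have wW := wprodW cwS.
rewrite wprod_cons invMg (SV sS) (repM _ (groupVr wW) (S_in_W sS)).
have [-> _|bs nb] := eqVneq b (a s).
  by exists [::], s, cw; rewrite wprod_nil rep1.
have [cw1 [r [cw2 [cwE bE]]]] := IH _ cwS (pos_simple sS pb bs) nb.
exists (s :: cw1), r, cw2; rewrite cwE; split=> //.
have cw1S : all (mem S) cw1 by move: cwS; rewrite cwE all_cat => /andP[].
by rewrite wprod_cons (repM _ (S_in_W sS) (wprodW cw1S)) -bE repSS.
Qed.

(* [I] is the injective and [b] the projective root attached to one letter of
   the Coxeter word; their Euler pairings with a positive root are its
   (nonnegative) coordinate along that letter. *)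
Lemma initial_root_sign cw wd A D b : uniq cw -> all (mem S) cw ->
  csort_spec cw wd A D -> pos b -> nneg (- act (wprod cw)^-1%g b) ->
  nneg (- act (wprod wd)^-1%g (act (wprod (map tau D)) (act (wprod cw)^-1%g b))).
Proof.
move=> uJ cwS sp pb nb; have [cw1 [r [cw2 [cwE bE]]]] := initial_root cwS pb nb.
have [cw1S rS cw2S] : [/\ all (mem S) cw1, r \in S & all (mem S) cw2].
  by apply/and3P; move: cwS; rewrite cwE all_cat.
have cwW := wprodW cwS; have w1W := wprodW cw1S; have w2W := wprodW cw2S.
have wW := cs_wordW sp; have wVW := groupVr wW.
pose I := act (wprod cw2)^-1%g (a r).
have IE : act (wprod cw)^-1%g b = - I.
  rewrite cwE bE wprod_cat wprod_cons !invMg (SV rS).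
  rewrite (repM _ (groupM (groupVr w2W) (S_in_W rS)) (groupVr w1W)) repK //.
  by rewrite (repM _ (groupVr w2W) (S_in_W rS)) rep_alpha // repN.
rewrite IE !repN opprK.
have rcw : r \in cw by rewrite cwE mem_cat mem_head orbT.
have sI : supp I cw.
  rewrite /I wprod_inv //; apply: supp_rep; rewrite ?all_rev //; last exact: supp_alpha.
  by move=> t; rewrite mem_rev cwE mem_cat inE => ->; rewrite !orbT.
have sb : supp b cw.
  rewrite bE; apply: supp_rep => // [t tc|]; first by rewrite cwE mem_cat tc.
  exact: supp_alpha.
have [X [Z [XA ZD EI EIA _]]] := cs_decomp sp sI.
have [X' [Z' [XA' ZD' Eb _ EbD]]] := cs_decomp sp sb.
have EuI v : euler cw v I = co v r by rewrite cwE euler_inj // -cwE.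
have Eub v : euler cw b v = co v r by rewrite cwE bE euler_proj // -cwE.
set y := wprod (map tau D); set x := wprod (map tau A).
have yW : y \in W := wprod_tauW D; have xW : x \in W := wprod_tauW A.
have yI : act y I = - act x^-1%g b.
  have -> : b = act (wprod cw) (- I) by rewrite -IE repVK.
  rewrite -(cs_prod sp) (repM _ xW yW) repK // repN opprK //.
(* The vector y I - X + Z' is placed in both spans, which meet in 0: y changes I by an element of
   span D, x^-1 changes b by an element of span A, and y I = - x^-1 b. *)
have memD : act y I - X + Z' \in <<D>>%VS.
  have -> : act y I - X + Z' = (act y I - I) + (Z + Z').
    by rewrite {3}EI opprD !addrA subrK.
  apply: memvD; last exact: memvD.
  apply: rep_refl_prod => d dD.
  by have [/pos_root] := cs_posD sp dD.
have memA : act y I - X + Z' \in <<A>>%VS.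
  have -> : act y I - X + Z' = (b - act x^-1%g b) - (X' + X).
    rewrite yI; move: (act x^-1%g b) => b'; rewrite Eb.
    by apply: co_inj => t; rewrite !(coD, coN); ring.
  apply: memvB; last exact: memvD.
  rewrite -{1}(repVK b xW); apply: rep_refl_prod => d dA.
  by have [/pos_root] := cs_posA sp dA.
have yIE : act y I = X - Z'.
  apply/eqP; rewrite -subr_eq0 -[X in _ == X](cs_span_disjoint sp memA memD).
  by apply/eqP/co_inj => t; rewrite !(coD, coN); ring.
have cX : cone A X.
  apply: (cs_coneA sp) => // v vA; rewrite -EIA // EuI.
  by have [pv _] := cs_posA sp vA; apply: pos_ge0 pv.
have cZ : cone (rev D) Z'.
  apply: (cs_coneD sp) => // v vD; rewrite -EbD // Eub.
  by have [pv _] := cs_posD sp vD; apply: pos_ge0 pv.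
by rewrite yIE repB nnegD ?(cs_coneA_nneg sp) ?(cs_coneD_nneg sp).
Qed.

Implicit Types (ts : seq gT).
Local Notation T := (reflections W S).

(** * Surjectivity of Reading's map *)

Lemma reflP t : reflect (exists w s, [/\ w \in W, s \in S & t = (w * s * w^-1)%g]) (t \in T).
Proof.
apply: (iffP bigcupP) => [[w wW]|[w [s [wW sS ->]]]].
  by rewrite mem_conjg invgK => sS; exists w, (t ^ w)%g; split=> //; rewrite conjgE !mulgA mulgV mul1g mulgK.
by exists w => //; rewrite mem_conjg invgK conjgE !mulgA mulVg mul1g mulgKV.
Qed.

Lemma refl_conj w t : w \in W -> t \in T -> (t ^ w)%g \in T.
Proof.
move=> wW /reflP[x [s [xW sS ->]]]; apply/reflP; exists (w^-1 * x)%g, s.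
by rewrite groupM ?groupV // conjgE invMg invgK !mulgA.
Qed.

Lemma reflS s : s \in S -> s \in T.
Proof. by move=> sS; apply/reflP; exists 1%g, s; rewrite group1 invg1 mul1g mulg1. Qed.

Lemma tau_refl b : isroot b -> tau b \in T.
Proof. by case/isrootP=> w [s [wW sS ->]]; rewrite tau_conj //; apply/reflP; exists w, s. Qed.

Lemma refl_pos t : t \in T -> exists2 b, pos b & tau b = t.
Proof.
case/reflP=> w [s [wW sS ->]]; have rb : isroot (act w (a s)) by rewrite root_rep ?root_alpha.
case/orP: (root_sign rb) => n; first by exists (act w (a s)); rewrite ?root_pos ?tau_conj.
by exists (- act w (a s)); rewrite ?root_pos ?isrootN ?tauN ?tau_conj.
Qed.

Lemma refl_pos_seq ts : {subset ts <= T} ->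
  exists2 L, {in L, forall b, pos b} & map tau L = ts.
Proof.
elim: ts => [|t ts IH] tsT; first by exists [::].
have [|L Lp LE] := IH; first by move=> r rts; apply: tsT; rewrite inE rts orbT.
have [b pb bE] := refl_pos (tsT t (mem_head _ _)).
exists (b :: L); last by rewrite /= bE LE.
by move=> v; rewrite inE => /predU1P[->|/Lp].
Qed.

(** * Vectors moved by a Coxeter element and the length of reflection factorizations *)

Section Coxeter.
Variable cw : seq gT.
Hypotheses (uJ : uniq cw) (cwS : all (mem S) cw).
Let c := wprod cw.

Definition parabolic_space : {vspace 'cV[R]_#|gT|} := <<map (@alpha R gT) cw>>%VS.
Local Notation VJ := parabolic_space.

Lemma mem_parabolic v : supp v cw <-> v \in VJ.
Proof.
split=> [vJ|vVJ t tJ]; last first.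
  apply: (linear_span0 (f := fun v => co v t)) vVJ => [x y|k x|_ /mapP[s sJ ->]].
  - exact: coD.
  - exact: coZ.
  - by rewrite (supp_alpha sJ).
rewrite (co_sum v) memv_suml // => s _; have [sJ|sJ] := boolP (s \in cw).
  by rewrite memvZ // memv_span // map_f.
by rewrite vJ // scale0r mem0v.
Qed.

Lemma dim_parabolic : \dim VJ = size cw.
Proof.
rewrite /parabolic_space -(size_map (@alpha R gT) cw); apply/eqP.
rewrite -[_ == _]/(free (map (@alpha R gT) cw)).
elim: cw uJ => [|s z IH] /=; first by rewrite nil_free.
case/andP=> sz uz; rewrite free_cons IH // andbT; apply/negP => sin.
have : co (a s) s = 0.
  apply: (linear_span0 (f := fun v => co v s)) sin => [x y|k x|_ /mapP[t tz ->]].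
  - exact: coD.
  - exact: coZ.
  - by rewrite co_alpha; case: eqP => // ts; rewrite -ts tz in sz.
by rewrite co_alpha eqxx => /eqP; rewrite oner_eq0.
Qed.

(** From c v = v the tail of the word sends v to s v. The tail preserves the [s]-coordinate and [s]
    preserves all the others, so both fix v. *)
Lemma coxeter_fix_simple v : act c v = v -> {in cw, forall s, act s v = v}.
Proof.
rewrite /c; elim: cw uJ cwS => [|s z IH] //= /andP[sz uz] /andP[sS zS].
have zW := wprodW zS; rewrite wprod_cons (repM _ (S_in_W sS) zW) => E.
have E' : act (wprod z) v = act s v by rewrite -{2}E repSS.
have Es : act s v = v.
  apply: co_inj => t; have [->|ts] := eqVneq t s; last by rewrite (rep_co _ sS) // eq_sym.
  by rewrite -E' rep_word_co.
by move=> t; rewrite inE => /predU1P[->|] //; apply: IH => //; rewrite E'.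
Qed.

(* A vector fixed by the standard parabolic subgroup equals its own average,
   while the average of each simple root vanishes. *)
Lemma coxeter_fix0 v : supp v cw -> act c v = v -> v = 0.
Proof.
move=> vJ /coxeter_fix_simple fixv; pose H := (<<[set:: cw]>>)%G.
have sH s : s \in cw -> s \in H by move=> scw; rewrite mem_gen // inE.
have HW w : w \in H -> w \in W.
  rewrite -(geo_gen G); apply: (subsetP (genS _)); apply/subsetP => s.
  by rewrite inE => /(allP cwS).
have fixH w : w \in H -> act w v = v.
  move=> /gen_wprod[z zJ <-]; have zJ' : {subset z <= cw}.
    by move=> s /(allP zJ); rewrite /= inE.
  have zS : all (mem S) z by apply/allP => s /zJ' /(allP cwS).
  elim: z zJ' zS {zJ} => [|s z IH] zJ /=; first by rewrite wprod_nil rep1.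
  case/andP=> sS zS; rewrite wprod_cons (repM _ (S_in_W sS) (wprodW zS)) IH //.
    by apply/fixv/zJ/mem_head.
  by move=> t tz; apply: zJ; rewrite inE tz orbT.
have avg0 s : s \in cw -> \sum_(w in H) act w (a s) = 0.
  move=> scw; have sS := allP cwS s scw.
  set X := \sum_(w in H) _; have XN : X = - X.
    rewrite {1}/X (reindex_inj (mulIg s)) /= -sumrN; apply: eq_big => [w|w].
      by rewrite groupMr; [|apply: sH].
    rewrite (groupMr _ (sH _ scw)) => wH.
    by rewrite (repM _ (HW _ wH) (S_in_W sS)) rep_alpha // repN.
  apply: co_inj => t; have := congr1 (fun v => co v t) XN; rewrite coN co0; lra.
have : \sum_(w in H) act w v = 0.
  rewrite {1}(co_sum v); under eq_bigr do rewrite mulmx_sumr.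
  rewrite exchange_big big1 // => s _; have [scw|scw] := boolP (s \in cw).
    by under eq_bigr do rewrite repZ; rewrite -scaler_sumr avg0 ?scaler0.
  by rewrite big1 // => w _; rewrite vJ // scale0r mulmx0.
rewrite (eq_bigr (fun=> v)); last by move=> w wH; apply: fixH.
rewrite sumr_const => /eqP; rewrite -scaler_nat scaler_eq0 pnatr_eq0 => /orP[|/eqP //].
by rewrite eqn0Ngt cardG_gt0.
Qed.

(** Carter's space im(w - 1): it lies in the span of the roots of any reflection factorization of w,
    so its dimension bounds the number of factors from below. *)
Definition moved w : {vspace 'cV[R]_#|gT|} :=
  limg (linfun (mulmx (rho w - 1%:M) : 'cV[R]_#|gT| -> 'cV[R]_#|gT|)).

Lemma mem_moved w v : act w v - v \in moved w.
Proof.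
have -> : act w v - v = linfun (mulmx (rho w - 1%:M)) v.
  by rewrite lfunE /= mulmxBl mul1mx.
exact: memv_img (memvf v).
Qed.

Lemma moved_sub L : {in L, forall b, isroot b} -> (moved (wprod (map tau L)) <= <<L>>)%VS.
Proof.
move=> rL; apply/subvP => _ /memv_imgP[v _ ->].
by rewrite lfunE /= mulmxBl mul1mx rep_refl_prod.
Qed.

(** c - 1 is injective on the parabolic space, hence onto it, and c v - v = (x (y v) - y v) + (y v -
    v). *)
Lemma coxeter_moved (x y : gT) : x \in W -> y \in W -> (x * y)%g = c ->
  (VJ <= moved x + moved y)%VS.
Proof.
move=> xW yW xyc; pose f : 'End('cV[R]_#|gT|) := linfun (mulmx (rho c - 1%:M)).
have fE v : f v = act c v - v by rewrite lfunE /= mulmxBl mul1mx.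
have fJ : (f @: VJ <= VJ)%VS.
  apply/subvP => _ /memv_imgP[v vJ ->]; rewrite fE memvB //.
  by apply/mem_parabolic/supp_rep => //; apply/mem_parabolic.
have ker0 : (VJ :&: lker f)%VS = 0%VS.
  apply/eqP; rewrite -subv0; apply/subvP => v; rewrite memv_cap memv_ker memv0 fE subr_eq0.
  by case/andP=> /mem_parabolic vJ /eqP /(coxeter_fix0 vJ) ->.
have <- : (f @: VJ)%VS = VJ.
  apply/eqP; rewrite eqEdim fJ -(limg_ker_dim f VJ) ker0 dimv0 add0n leqnn //.
apply/subvP => _ /memv_imgP[v _ ->]; rewrite fE -xyc repM //.
rewrite -(subrK (act y v) (act x (act y v))) -addrA memv_add ?mem_moved //.
Qed.

(** The rank is at most dim im(x - 1) + dim im(y - 1), each dimension is at most the number of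
    factors, and there are at most rank many factors; equality holds throughout. *)
Lemma refl_factorization L1 L2 : {in L1, forall b, isroot b} -> {in L2, forall b, isroot b} ->
  (wprod (map tau L1) * wprod (map tau L2))%g = c -> (size L1 + size L2 <= size cw)%N ->
  [/\ <<L1>>%VS = moved (wprod (map tau L1)), <<L2>>%VS = moved (wprod (map tau L2)),
      size L1 = \dim (moved (wprod (map tau L1))),
      size L2 = \dim (moved (wprod (map tau L2))) &
      {in L1 ++ L2, forall b, supp b cw}].
Proof.
set x := wprod (map tau L1); set y := wprod (map tau L2) => r1 r2 xyc le.
have xW : x \in W := wprod_tauW L1; have yW : y \in W := wprod_tauW L2.
have sx := moved_sub r1; have sy := moved_sub r2; rewrite -/x -/y in sx sy.
have VM := coxeter_moved xW yW xyc.
have d0 := dimvS VM; rewrite dim_parabolic in d0.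
have d1 := dimvS sx; have d2 := dimvS sy.
have d3 := dim_span L1; have d4 := dim_span L2.
have d5 := (dimv_add_leqif (moved x) (moved y)).1.
have [e1 e2 e3 e4 e5] : [/\ (\dim <<L1>> <= \dim (moved x))%N,
    (\dim <<L2>> <= \dim (moved y))%N, size L1 = \dim (moved x),
    size L2 = \dim (moved y) & (\dim (moved x + moved y) <= size cw)%N].
  move: (\dim <<L1>>) (\dim <<L2>>) (\dim (moved x + moved y)) (\dim (moved x)) (\dim (moved y))
    (size L1) (size L2) (size cw) d0 d1 d2 d3 d4 d5 le.
  by clear; split; lia.
have E1 : <<L1>>%VS = moved x by apply/esym/eqP; rewrite eqEdim sx.
have E2 : <<L2>>%VS = moved y by apply/esym/eqP; rewrite eqEdim sy.
split=> // b; rewrite mem_cat => bL; apply/mem_parabolic.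
have /eqP -> : VJ == (moved x + moved y)%VS by rewrite eqEdim VM dim_parabolic.
case/orP: bL => bL; first by apply: (subvP (addvSl _ _)); rewrite -E1 memv_span.
by apply: (subvP (addvSr _ _)); rewrite -E2 memv_span.
Qed.
End Coxeter.

Implicit Types (xs ys : seq gT).

(* Successive conjugation of [t] by the letters of [cw], cyclically repeated,
   reaches within [k] steps the letter about to be used. *)
Fixpoint hit k cw t : bool :=
  if cw is s :: cw' then
    (t == s) || (if k is k'.+1 then hit k' (rcons cw' s) (t ^ s)%g else false)
  else false.

Lemma hitN_prefix z p j b : all (mem S) z -> uniq (z ++ p) -> pos b -> supp b (z ++ p) ->
  ~~ hit (size z + j) (z ++ p) (tau b) ->
  pos (act (wprod z)^-1%g b) && ~~ hit j (p ++ z) (tau (act (wprod z)^-1%g b)).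
Proof.
elim: z p b => [|s z IH] p b; first by rewrite wprod_nil invg1 rep1 cats0 => _ _ ->.
rewrite [all _ _]/= cat_cons => /andP[sS zS] uJ pb sb.
rewrite /= negb_or rcons_cat => /andP[ts hN].
have zW := wprodW zS; have sW := S_in_W sS.
have ys : b != a s by apply: contraNneq ts => ->; rewrite tau_alpha.
have psb := pos_simple sS pb ys.
have := IH (rcons p s) (act s b) zS _ psb.
have -> : tau (act s b) = (tau b ^ s)%g.
  by rewrite tau_rep ?(pos_root pb) // conjgE (SV sS) mulgA.
rewrite wprod_cons invMg (SV sS) (repM _ (groupVr zW) sW).
rewrite -cat_rcons; apply=> //; first by rewrite -rcons_cat rcons_uniq.
by apply/(supp_sub _ (supp_repS sS (mem_head _ _) sb)) => t; rewrite !inE !mem_cat mem_rcons inE orbCA.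
Qed.

Lemma hitN_pow cw m b : all (mem S) cw -> uniq cw -> pos b -> supp b cw ->
  ~~ hit (m * size cw) cw (tau b) ->
  forall i, (i <= m)%N -> pos (act ((wprod cw)^-1 ^+ i)%g b).
Proof.
move=> cwS uJ; have cW := wprodW cwS; have cVW := groupVr cW.
elim: m b => [|m IH] b pb sb hN [|i] //; rewrite ?rep1 // ltnS => im.
have := @hitN_prefix cw [::] (m * size cw) b cwS; rewrite cats0 -mulSn => /(_ uJ pb sb hN).
case/andP=> pcb hcN; rewrite expgSr repM ?groupX //; apply: IH => //.
rewrite wprod_inv //; apply: supp_rep; rewrite ?all_rev //.
by move=> t; rewrite mem_rev.
Qed.

(** Without a hit every c^-i b stays positive. The sum of these roots over a full period is fixed by
    c, hence zero, so -b is a sum of nonnegative vectors, a contradiction. *)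
Lemma exists_hit cw b : all (mem S) cw -> uniq cw -> pos b -> supp b cw ->
  exists k, hit k cw (tau b).
Proof.
move=> cwS uJ pb sb; have cW := wprodW cwS; have cVW := groupVr cW.
set c := wprod cw in cW cVW *; pose o := #[c^-1]%g.
exists (o * size cw)%N; apply/negPn/negP => hN.
have pc i : (i < o)%N -> pos (act (c^-1 ^+ i)%g b).
  by move=> io; apply: (hitN_pow cwS uJ pb sb hN); apply: ltnW.
have sV v : supp v cw -> supp (act c^-1%g v) cw.
  by move=> sv; rewrite /c wprod_inv //; apply: supp_rep; rewrite ?all_rev // => t; rewrite mem_rev.
have sc i : supp (act (c^-1 ^+ i)%g b) cw.
  elim: i => [|i IH]; first by rewrite rep1.
  by rewrite expgS (repM _ cVW (groupX i cVW)); apply: sV.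
pose v := \sum_(0 <= i < o) act (c^-1 ^+ i)%g b.
have o0 : (0 < o)%N by rewrite order_gt0.
have sv : supp v cw.
  rewrite /v; elim: (o) => [|n IHn]; first by rewrite big_geq // => t; rewrite co0.
  by rewrite big_nat_recr //=; apply: suppD IHn (sc n).
have cVv : act c^-1%g v = v.
  rewrite /v mulmx_sumr (eq_bigr (fun i => act (c^-1 ^+ i.+1)%g b)); last first.
    by move=> i _; rewrite expgS repM ?groupX.
  rewrite -(big_add1 _ _ 0 o.+1 xpredT (fun i => act (c^-1 ^+ i)%g b)).
  rewrite big_nat_recr //= [in RHS]big_ltn // expg_order expg0.
  by rewrite addrC.
have cv : act c v = v by rewrite -{1}cVv repVK.
have v0 := coxeter_fix0 uJ cwS sv cv.
have : b = 0.
  apply: nneg_anti (pos_nneg pb) _.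
  have -> : - b = \sum_(1 <= i < o) act (c^-1 ^+ i)%g b.
    by apply/eqP; rewrite eq_sym -addr_eq0 addrC -[X in X + _](rep1 b) -(expg0 c^-1%g) -big_ltn // -/v v0.
  rewrite big_nat; elim/big_ind: _ => [|x y|i /andP[_ io]]; [exact: nneg0|exact: nnegD|].
  exact/pos_nneg/pc.
by apply/eqP/pos_neq0.
Qed.

Lemma csort_trivial cw : csort cw [::] (map a cw) [::].
Proof. by elim: cw => [|s cw IH]; [apply: CsNil | apply: CsSkip]. Qed.

(** * Moves on reflection factorizations of the Coxeter word *)

Section Realizable.
Variables (s : gT) (cw wd : seq gT) (A D : seq 'cV[R]_#|gT|).
Hypotheses (sS : s \in S) (uJ : uniq (s :: cw)) (cwS : all (mem S) cw).

(** A noncrossing partition and its complement, each given by a reflection word; the bound by the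
    rank forces both words to be as short as possible. *)
Definition realizable cw xs ys :=
  [/\ {subset xs <= T}, {subset ys <= T}, (size xs + size ys <= size cw)%N &
      (wprod xs * wprod ys)%g = wprod cw].

Lemma realizable_conj xs ys : realizable (rcons cw s) xs ys ->
  realizable (s :: cw) (map (fun t => t ^ s)%g xs) (map (fun t => t ^ s)%g ys).
Proof.
case=> xsT ysT sz E; split.
- by move=> _ /mapP[t /xsT tT ->]; rewrite refl_conj ?S_in_W.
- by move=> _ /mapP[t /ysT tT ->]; rewrite refl_conj ?S_in_W.
- by rewrite !size_map; rewrite size_rcons in sz.
- by rewrite !wprod_conj -conjMg E; apply: wprod_conjS.
Qed.

Lemma realizable_conjV xs ys : realizable (s :: cw) xs ys ->
  realizable (rcons cw s) (map (fun t => t ^ s)%g xs) (map (fun t => t ^ s)%g ys).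
Proof.
case=> xsT ysT sz E; split.
- by move=> _ /mapP[t /xsT tT ->]; rewrite refl_conj ?S_in_W.
- by move=> _ /mapP[t /ysT tT ->]; rewrite refl_conj ?S_in_W.
- by rewrite !size_map size_rcons.
- by rewrite !wprod_conj -conjMg E wprod_rcons wprod_cons conjgE mulgA mulKg.
Qed.

Lemma realizable_csort : csort_spec (rcons cw s) wd A D ->
  realizable (rcons cw s) (map tau A) (map tau D).
Proof.
move=> sp; split.
- by move=> _ /mapP[b bA ->]; apply: tau_refl; have [/pos_root] := cs_posA sp bA.
- by move=> _ /mapP[b bD ->]; apply: tau_refl; have [/pos_root] := cs_posD sp bD.
- by rewrite !size_map (cs_size sp).
- exact: (cs_prod sp).
Qed.

(** Hurwitz moves: [s] travels to the front and conjugates the letters it passes. *)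
Lemma wprod_hurwitz z z' :
  wprod (z ++ s :: z') = (s * wprod (map (fun t => t ^ s)%g z ++ z'))%g.
Proof. by rewrite !wprod_cat wprod_cons wprod_conj conjgE SV // !mulgA (geo_inv G) // mul1g. Qed.

Lemma hurwitz_subset z z' : {subset z ++ s :: z' <= T} ->
  {subset map (fun t => t ^ s)%g z ++ z' <= T}.
Proof.
move=> zT t; rewrite mem_cat => /orP[/mapP[r rz ->]|tz].
  by rewrite refl_conj ?S_in_W // zT // mem_cat rz.
by apply: zT; rewrite mem_cat inE tz !orbT.
Qed.

Lemma realizable_skip xs ys : realizable (s :: cw) xs ys -> s \in xs ->
  exists xs', realizable cw xs' ys.
Proof.
move=> [+ ysT + +] sxs; case/path.splitPr: sxs => z z' xsT sz E.
exists (map (fun t => t ^ s)%g z ++ z'); split=> //.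
- exact: hurwitz_subset.
- by move: sz; rewrite !size_cat size_map /= addnS addSn.
- by apply: (mulgI s); rewrite mulgA -wprod_hurwitz E wprod_cons.
Qed.

(** [s] is brought to the head of [ys]; conjugating everything by [s] to rotate the Coxeter word
    then turns it into the last factor of [xs']. *)
Lemma realizable_cover xs ys : realizable (s :: cw) xs ys -> s \in ys ->
  exists xs' ys', [/\ realizable (rcons cw s) xs' ys', s \in xs',
    (size ys' < size ys)%N & (s * wprod ys' ^ s)%g = wprod ys].
Proof.
move=> [xsT + + +] sys; case/path.splitPr: sys => z z' ysT sz E.
pose ys0 := map (fun t => t ^ s)%g z ++ z'.
exists (rcons (map (fun t => t ^ s)%g xs) s), (map (fun t => t ^ s)%g ys0); split.
- have ys0T : {subset ys0 <= T} by apply: hurwitz_subset.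
  split.
  + move=> t; rewrite mem_rcons inE => /predU1P[->|/mapP[r /xsT rT ->]]; first exact: reflS.
    exact: refl_conj (S_in_W sS) rT.
  + by move=> _ /mapP[t /ys0T tT ->]; rewrite refl_conj ?S_in_W.
  + by move: sz; rewrite !size_rcons !size_map !size_cat !size_map /= !addnS addSn.
  + rewrite !wprod_rcons !wprod_conj.
    move: E; rewrite wprod_hurwitz -/ys0 wprod_cons => E.
    have -> : wprod cw = (s * (wprod xs * (s * wprod ys0)))%g by rewrite E SmulK.
    by rewrite !conjgE (SV sS) -!mulgA SmulK.
- by rewrite mem_rcons mem_head.
- by rewrite size_map !size_cat size_map /= addnS.
- by rewrite wprod_hurwitz wprod_conj !conjgE (SV sS) -!mulgA (geo_inv G) // mulg1 SmulK.
Qed.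

End Realizable.

Lemma realizable_roots cw xs ys : uniq cw -> all (mem S) cw -> realizable cw xs ys ->
  exists L1 L2, [/\ {in L1, forall b, pos b}, {in L2, forall b, pos b},
    map tau L1 = xs, map tau L2 = ys &
    [/\ <<L1>>%VS = moved (wprod xs), size ys = \dim (moved (wprod ys)) &
        {in L2, forall b, supp b cw}]].
Proof.
move=> uJ cwS [/refl_pos_seq[L1 p1 E1] /refl_pos_seq[L2 p2 E2] sz E].
exists L1, L2; split=> //.
have r1 : {in L1, forall b, isroot b} by move=> b /p1 /pos_root.
have r2 : {in L2, forall b, isroot b} by move=> b /p2 /pos_root.
have := refl_factorization uJ cwS r1 r2; rewrite E1 E2 => /(_ E).
rewrite -(size_map tau L1) -(size_map tau L2) E1 E2 => /(_ sz)[-> _ _ -> sL]; split=> //.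
by move=> b b2; apply: sL; rewrite mem_cat b2 orbT.
Qed.

Lemma refl_span s b L : s \in S -> isroot b -> tau b = s -> b \in L -> a s \in <<L>>%VS.
Proof.
move=> sS rb bs bL; have := rep_tau (a s) rb; rewrite bs rep_alpha // => E.
have -> : a s = (bf b (a s) / 2) *: b.
  by apply: co_inj => t; have := congr1 (fun v => co v t) E; rewrite coN coB !coZ; lra.
by rewrite memvZ // memv_span.
Qed.

(** E(x, a_s) is the [s]-coordinate of x, so [a s] lies in the cone of A. Were it not a member, the
    sum of the coordinates off [s] would be positive on A and zero on [a s]. *)
Lemma mem_alpha_last s cw wd A D : csort_spec (rcons cw s) wd A D ->
  uniq (s :: cw) -> s \in S -> a s \in <<A>>%VS -> a s \in A.
Proof.
move=> sp uJ sS sA; have sN : s \notin cw by case/andP: uJ.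
have cA : cone A (a s).
  apply: (cs_coneA sp) => // x xA; rewrite euler_alpha_last //.
  by have [px _] := cs_posA sp xA; apply: pos_ge0 px.
apply/negPn/negP => nA; have /eqP[] := alpha_neq0 s.
apply: (cone_pos0 (f := fun v => \sum_(t | t != s) co v t)) cA _ => [x y|c x|x xA|].
- by rewrite -big_split; apply: eq_bigr => t _; rewrite coD.
- by rewrite mulr_sumr; apply: eq_bigr => t _; rewrite coZ.
- have [px _] := cs_posA sp xA; apply: pos_off_simple => //.
  by apply: contra nA => /eqP <-.
- by rewrite big1 // => t ts; rewrite co_alpha eq_sym (negPf ts).
Qed.

(* Lexicographic induction on the rank, the number of factors of [ys], and the
   time at which some factor becomes a simple reflection about to be conjugated
   by. When the recursive call yields a factorization containing [s], that
   factorization replaces the given one. *)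
Lemma csort_onto cw xs ys : uniq cw -> all (mem S) cw -> realizable cw xs ys ->
  exists wd A D, csort cw wd A D /\ wprod (map tau D) = wprod ys.
Proof.
have [n szcw] : exists n, size cw = n by exists (size cw).
elim: n cw szcw xs ys => [|n IHn] cw szcw xs ys.
  move/size0nil: szcw => -> _ _ [_ _]; rewrite leqn0 addn_eq0 => /andP[_ /eqP/size0nil ->] _.
  by exists [::], [::], [::]; split; first exact: CsNil.
have [m szys] : exists m, size ys = m by exists (size ys).
elim/ltn_ind: m cw xs ys szcw szys => m IHm.
have skip s cw xs ys : size (s :: cw) = n.+1 -> uniq (s :: cw) -> all (mem S) (s :: cw) ->
    realizable (s :: cw) xs ys -> s \in xs ->
    exists wd A D, csort (s :: cw) wd A D /\ wprod (map tau D) = wprod ys.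
  case=> szcw uJ cwS rl sxs; have /andP[sS cwS'] := cwS; have /andP[sN uJ'] := uJ.
  have [xs' rl'] := realizable_skip sS rl sxs.
  have [wd [A [D [cs E]]]] := IHn cw szcw xs' ys uJ' cwS' rl'.
  by exists wd, (a s :: A), D; split=> //; apply: CsSkip.
have cover s cw xs ys : size (s :: cw) = n.+1 -> (size ys <= m)%N ->
    uniq (s :: cw) -> all (mem S) (s :: cw) -> realizable (s :: cw) xs ys -> s \in ys ->
    exists wd A D, csort (s :: cw) wd A D /\ wprod (map tau D) = wprod ys.
  move=> szcw szys uJ cwS rl sys; have /andP[sS cwS'] := cwS.
  have [xs' [ys' [rl' sxs' lt E]]] := realizable_cover sS rl sys.
  have uJ' : uniq (rcons cw s) by rewrite rcons_uniq.
  have cwS1 : all (mem S) (rcons cw s) by rewrite all_rcons.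
  have szr : size (rcons cw s) = n.+1 by rewrite size_rcons.
  have [wd [A [D [cs ED]]]] := IHm _ (leq_trans lt szys) _ xs' ys' szr erefl uJ' cwS1 rl'.
  have sp := csortP uJ' cwS1 cs.
  have [L1 [L2 [p1 p2 E1 E2 [spL1 _ _]]]] := realizable_roots uJ' cwS1 rl'.
  have [M1 [M2 [q1 q2 F1 F2 [spM1 _ _]]]] := realizable_roots uJ' cwS1 (realizable_csort sp).
  have xE : wprod (map tau A) = wprod xs'.
    apply: (mulIg (wprod ys')); rewrite -{1}ED (cs_prod sp).
    by case: rl' => _ _ _ ->.
  (* [xs'] contains [s], but A comes from another factorization of the same element; both lists of
     roots span the moved space, which carries [a s] over. *)
  have sA : a s \in A.
    apply: (mem_alpha_last sp) => //.
    have rA : {in A, forall b, isroot b} by move=> b bA; have [/pos_root] := cs_posA sp bA.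
    have : a s \in <<L1>>%VS.
      move: sxs'; rewrite -E1 => /mapP[b b1 bE].
      by apply: (refl_span (b := b)) => //; apply/pos_root/p1.
    rewrite spL1 -xE; apply/subvP/moved_sub => //.
  case/path.splitPr: sA cs => A1 A2 cs.
  exists (s :: wd), (map (fun v => act s v) (A1 ++ A2)), (a s :: map (fun v => act s v) D).
  split; first exact: CsCover.
  rewrite /= wprod_cons tau_alpha // tau_conj_seq //.
    by rewrite wprod_conj ED.
  by move=> b bD; have [/pos_root] := cs_posD sp bD.
(* [k] bounds the number of conjugations before some factor of [ys] meets its letter; an empty [ys]
   is settled at [k = 0] by the identity. *)
have main k : forall cw xs ys, size cw = n.+1 -> (size ys <= m)%N -> uniq cw ->
    all (mem S) cw -> realizable cw xs ys -> ys = [::] \/ (exists2 t, t \in ys & hit k cw t) ->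
    exists wd A D, csort cw wd A D /\ wprod (map tau D) = wprod ys.
  elim: k => [|k IHk] [|s cw] // xs ys szcw szys uJ cwS rl hk; have /andP[sS cwS'] := cwS.
    have [->|[t tys]] := hk; first by exists [::], (map a (s :: cw)), [::]; split=> //; apply: csort_trivial.
    by rewrite /= orbF => /eqP ts; apply: cover rl _ => //; rewrite -ts.
  have [sxs|sxs] := boolP (s \in xs); first exact: skip rl sxs.
  have [sys|sys] := boolP (s \in ys); first exact: cover rl sys.
  have uJ' : uniq (rcons cw s) by rewrite rcons_uniq.
  have cwS1 : all (mem S) (rcons cw s) by rewrite all_rcons.
  have szr : size (rcons cw s) = n.+1 by rewrite size_rcons.
  have rl' := realizable_conjV sS rl.
  have [||wd [A [D [cs E]]]] := IHk _ _ _ szr _ uJ' cwS1 rl'; first by rewrite size_map.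
    case: hk => [->|[t tys /=]]; first by left.
    case/orP=> [/eqP ts|ht]; first by rewrite -ts tys in sys.
    by right; exists (t ^ s)%g => //; apply: map_f.
  have sp := csortP uJ' cwS1 cs; have rl1 := realizable_conj sS (realizable_csort sp).
  have Eys : wprod (map (fun t => t ^ s)%g (map tau D)) = wprod ys.
    by rewrite wprod_conj E wprod_conj -conjgM (geo_inv G) // conjg1.
  have [_ [_ [_ _ _ _ [_ dimys _]]]] := realizable_roots uJ cwS rl.
  have [_ [_ [_ _ _ _ [_ dimD _]]]] := realizable_roots uJ cwS rl1.
  (* The number of factors is the dimension of the moved space of their product, so exchanging
     factorizations does not exceed [m]. *)
  have szD : (size (map (fun t => t ^ s)%g (map tau D)) <= m)%N by rewrite dimD Eys -dimys.
  have tau_s B : a s \in B -> s \in map (fun t => t ^ s)%g (map tau B).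
    by move=> sB; apply/mapP; exists s; rewrite ?conjgE ?mulVg ?mul1g ?mulKg // -{1}(tau_alpha sS) map_f.
  have [sA|sA] := boolP (a s \in A).
    by rewrite -Eys; apply: skip rl1 _ => //; apply: tau_s.
  have [sD|sD] := boolP (a s \in D).
    by rewrite -Eys; apply: cover rl1 _ => //; apply: tau_s.
  exists (s :: wd), (map (fun v => act s v) A), (map (fun v => act s v) D); split; last first.
    by rewrite tau_conj_seq // => b bD; have [/pos_root] := cs_posD sp bD.
  apply: CsMove => //; have [X [Y [cX cY ->]]] := cs_last_decomp sp uJ sS sD.
  by rewrite repB nnegD ?(cs_coneA_nneg sp) ?(cs_coneD_nneg sp).
move=> cw xs ys szcw szys uJ cwS rl.
have [L1 [L2 [p1 p2 E1 E2 [_ _ sL2]]]] := realizable_roots uJ cwS rl.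
case: L2 p2 sL2 E2 => [|b L2] p2 sL2 E2.
  by apply: (main 0%N) rl _; rewrite ?szys //; left.
have [k hk] := exists_hit cwS uJ (p2 b (mem_head _ _)) (sL2 b (mem_head _ _)).
by apply: (main k) rl _; rewrite ?szys //; right; exists (tau b); rewrite // -E2 mem_head.
Qed.

Implicit Types (f : nat -> gT) (i j k n m : nat) (p : seq nat).

(** * Sorting words *)

Lemma ell_mull w s : w \in W -> s \in S ->
  (ell (s * w)%g < ell w)%N = nneg (- act w^-1%g (a s)).
Proof. by move=> wW sS; rewrite -{1}(tau_alpha sS) refl_lt // pos_alphaS. Qed.

Lemma ell_asc w s : w \in W -> s \in S -> nneg (act w^-1%g (a s)) ->
  ell (s * w)%g = (ell w).+1.
Proof.
move=> wW sS p; apply/eqP; rewrite eqn_leq; apply/andP; split.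
  by apply: wlength_mull => //; rewrite (geo_gen G).
have swW := mulSW sS wW; have := ell_mull swW sS; rewrite SmulK // => ->.
rewrite invMg (SV sS) (repM _ (groupVr wW) (S_in_W sS)) rep_alpha // repN opprK //.
Qed.

(* [p] lists the positions, from [n] on, of the letters of [f] kept when its left
   descents are stripped from [w] greedily. *)
Fixpoint greedy f n w p : Prop :=
  if p is j :: p' then
    [/\ (n <= j)%N, (ell (f j * w)%g < ell w)%N,
        forall i, (n <= i < j)%N -> ~~ (ell (f i * w)%g < ell w)%N &
        greedy f j.+1 (f j * w)%g p']
  else w = 1%g.

Lemma greedy_uniq f n w p p' : greedy f n w p -> greedy f n w p' -> p = p'.
Proof.
elim: p n w p' => [|j p IH] n w [|j' p'] //=.
- by move=> -> [_]; rewrite wlength1.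
- by move=> [_ + _ _] w1; rewrite w1 wlength1.
move=> [nj dj mj g] [nj' dj' mj' g'].
have jj' : j = j'.
  case: (ltngtP j j') => // lt.
    by have := mj' j; rewrite nj lt dj => /(_ isT).
  by have := mj j'; rewrite nj' lt dj' => /(_ isT).
by rewrite -jj' in g' *; congr (_ :: _); apply: IH g g'.
Qed.

Lemma greedy_ge f n w p : greedy f n w p -> all (leq n) p.
Proof.
elim: p n w => //= j p IH n w [nj _ _ /IH gp]; rewrite nj.
by apply: sub_all gp => i; apply: leq_trans; apply: leqW.
Qed.

Lemma greedy_prod f n w p : greedy f n w p -> {in p, forall j, f j \in S} ->
  wprod (map f p) = w.
Proof.
elim: p n w => [|j p IH] n w /=; first by rewrite wprod_nil => ->.
case=> _ _ _ /IH E pS; rewrite wprod_cons E ?SmulK ?pS ?mem_head // => i ip.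
by apply: pS; rewrite inE ip orbT.
Qed.

Lemma greedy_succ f n w p : greedy f n.+1 w (map succn p) <-> greedy (f \o succn) n w p.
Proof.
elim: p n w => //= j p IH n w; split=> -[nj dj mj g]; split=> //; try by apply/IH.
  by move=> i ij; apply: mj.
by case=> // i ij; apply: mj.
Qed.

Lemma eq_greedy f f' n w p : f =1 f' -> greedy f n w p -> greedy f' n w p.
Proof.
move=> E; elim: p n w => //= j p IH n w [nj dj mj g]; split=> //; first by rewrite -E.
  by move=> i ij; rewrite -E; apply: mj.
by rewrite -E; apply: IH.
Qed.

Section LexMin.
Variable cw : seq gT.
Hypotheses (cwS : {subset cw <= S}) (Scw : {subset S <= cw}).
Local Notation f := (cinf cw).

Lemma exists_subword_from n w : w \in W -> exists pq,
  [/\ sorted ltn pq, all (leq n) pq & reduced_expr S w (map f pq)].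
Proof.
rewrite -(geo_gen G) => /wlength_word[z [zS zw zl]].
suff [pq [sq nq E]] : exists pq, [/\ sorted ltn pq, all (leq n) pq & map f pq = z].
  by exists pq; split=> //; rewrite E /reduced_expr zS -[(\prod_(s <- z) s)%g]/(wprod z) zw zl !eqxx.
elim: z zS n {zw zl} => [|s z IH] /=; first by move=> _ n; exists [::].
case/andP=> sS zS n; have sc := Scw sS.
have isz : (index s cw < size cw)%N by rewrite index_mem.
(* The letter is taken from the copy numbered [n], which starts at or after position [n]. *)
pose j := (n * size cw + index s cw)%N.
have nj : (n <= j)%N.
  by apply: leq_trans (leq_addr _ _); rewrite leq_pmulr //; apply: leq_ltn_trans isz.
have [pq [sq jq E]] := IH zS j.+1; exists (j :: pq); split=> /=.
- by rewrite path_min_sorted.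
- by rewrite nj; apply: sub_all jq => i ji; apply: leq_trans (ltnW ji).
- by rewrite E /cinf modnMDl modn_small ?nth_index.
Qed.

(** If a position passed over carried a left descent, keeping it and completing by a reduced word
    from later positions would give a lexicographically smaller reduced subword. *)
Lemma lexmin_greedy n w p : w \in W -> sorted ltn p -> all (leq n) p ->
  reduced_expr S w (map f p) ->
  (forall pq, sorted ltn pq -> all (leq n) pq -> reduced_expr S w (map f pq) ->
     ((p : seqlexi nat) <= (pq : seqlexi nat))%O) ->
  greedy f n w p.
Proof.
elim: p n w => [|j p IH] n w wW.
  by move=> _ _ /and3P[_ /eqP <- _] _; rewrite big_nil.
move=> sp /andP[nj np] /and3P[/andP[jS pS] /eqP E /eqP sz] mn.
have fjw : (f j * w)%g = wprod (map f p).
  by move: E; rewrite /= big_cons -[(\prod_(s <- map f p) s)%g]/(wprod (map f p)) => <-; rewrite SmulK.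
have dj : (ell (f j * w)%g < ell w)%N.
  by rewrite fjw -sz /= ltnS; apply: wlength_wprod.
have red_cons i pq : f i \in S -> (ell (f i * w)%g < ell w)%N ->
    reduced_expr S (f i * w)%g (map f pq) -> reduced_expr S w (map f (i :: pq)).
  move=> iS di /and3P[qS /eqP Eq /eqP szq]; apply/and3P; split; first by rewrite /= iS.
    by rewrite /= big_cons Eq SmulK.
  rewrite /= szq eqn_leq di /=; have := @wlength_mull _ S (f i) (f i * w)%g iS.
  by rewrite (geo_gen G) mulSW // SmulK // => /(_ isT).
have sorted_cons i pq : sorted ltn pq -> all (leq i.+1) pq -> sorted ltn (i :: pq).
  by move=> sq iq; rewrite /= path_min_sorted.
split=> //.
- move=> i /andP[ni ij]; apply/negP => di.
  have iS : f i \in S.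
    apply/cwS/mem_nth; rewrite ltn_mod.
    by have := jS; rewrite /= /cinf; case: (cw) (Scw jS).
  have [pq [sq iq rq]] := exists_subword_from i.+1 (mulSW iS wW).
  have := mn (i :: pq) (sorted_cons _ _ sq iq) _ (red_cons _ _ iS di rq).
  rewrite /= ni (sub_all _ iq) => [/(_ isT)|k ik]; last exact: leq_trans ni (ltnW ik).
  by rewrite lexi_cons leEnat => /andP[]; rewrite leqNgt ij.
- have jp : all (leq j.+1) p.
    by move: sp; rewrite /= (path_sortedE ltn_trans) => /andP[].
  have red_p : reduced_expr S (f j * w)%g (map f p).
    apply/and3P; split=> //; first by rewrite fjw.
    rewrite eqn_leq {2}fjw wlength_wprod // andbT.
    have := @wlength_mull _ S (f j) (f j * w)%g jS.
    by rewrite (geo_gen G) mulSW // SmulK // -sz; apply.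
  apply: IH => //; [exact: mulSW|exact: path_sorted sp|].
  move=> pq sq jq rq; have := mn (j :: pq) (sorted_cons _ _ sq jq) _ (red_cons _ _ jS dj rq).
  rewrite /= nj (sub_all _ jq) => [/(_ isT)|k jk]; last exact: leq_trans nj (ltnW jk).
  by rewrite lexi_cons => /andP[_]; rewrite lexx.
Qed.

End LexMin.

Lemma cinf_rot s cw i : cinf (s :: cw) i.+1 = cinf (rcons cw s) i.
Proof.
rewrite /cinf size_rcons [size (s :: cw)]/=; set n := (size cw).+1.
have lt : (i %% n < n)%N by rewrite ltn_mod.
have -> : (i.+1 %% n = (i %% n).+1 %% n)%N by rewrite {1}(divn_eq i n) -addnS modnMDl.
rewrite nth_rcons; case: (ltngtP (i %% n) (size cw)) => [lt'|gt|->].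
- by rewrite modn_small.
- by rewrite ltnNge -ltnS -/n lt in gt.
- by rewrite modnn.
Qed.

(* The position in the periodic word of [s :: cw] of the [i]-th letter of the
   periodic word of [cw]. *)
Definition skip_pos cw i := (i + i %/ size cw).+1.

Lemma skip_pos_lt cw : {homo skip_pos cw : i j / (i < j)%N}.
Proof. by move=> i j ij; rewrite /skip_pos ltnS -addSn leq_add // leq_div2r // ltnW. Qed.

Lemma skip_pos_le cw : {mono skip_pos cw : i j / (i <= j)%N}.
Proof. exact: leq_mono (@skip_pos_lt cw). Qed.

Lemma skip_posE cw i : skip_pos cw i =
  (i %/ size cw * (size cw).+1 + (i %% size cw).+1)%N.
Proof.
rewrite /skip_pos {1}(divn_eq i (size cw)) mulnS addnS; congr _.+1.
by rewrite addnC addnA.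
Qed.

Lemma cinf_skip s cw i : (0 < size cw)%N -> cinf (s :: cw) (skip_pos cw i) = cinf cw i.
Proof.
move=> cw0; rewrite /cinf [size (s :: cw)]/= skip_posE modnMDl modn_small //.
by rewrite ltnS ltn_mod.
Qed.

Lemma skip_pos_surj s cw k : ~~ (size (s :: cw) %| k)%N ->
  exists i, k = skip_pos cw i.
Proof.
rewrite [size _]/=; set n := size cw => kn.
have m0 : (0 < k %% n.+1)%N by rewrite lt0n.
have mn : ((k %% n.+1).-1 < n)%N by rewrite -ltnS prednK // ltn_mod.
exists (k %/ n.+1 * n + (k %% n.+1).-1)%N.
rewrite skip_posE -/n modnMDl (modn_small mn) prednK // divnMDl ?(leq_ltn_trans _ mn) //.
by rewrite (divn_small mn) addn0 -divn_eq.
Qed.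

Lemma skip_pos_sub cw i : (0 < size cw)%N -> (size cw <= i)%N ->
  (skip_pos cw i - (size cw).+1)%N = skip_pos cw (i - size cw).
Proof.
move=> n0 ni; rewrite !skip_posE.
have -> : (i %/ size cw = (i - size cw) %/ size cw + 1)%N.
  by rewrite -{1}(subnK ni) divnDr // divnn n0.
have -> : (i %% size cw = (i - size cw) %% size cw)%N.
  by rewrite -{1}(subnK ni) modnDr.
by rewrite mulnDl mul1n addnAC addnK.
Qed.

Lemma skip_pos_ge cw i : (0 < size cw)%N ->
  ((size cw).+1 <= skip_pos cw i)%N = (size cw <= i)%N.
Proof.
move=> n0; rewrite /skip_pos ltnS; case: (leqP (size cw) i) => [ni|ni].
  by apply: leq_trans ni (leq_addr _ _).
by rewrite divn_small // addn0 leqNgt ni.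
Qed.

(** The inclusion of each block in the preceding one, in terms of positions: as the letters of the
    Coxeter word are distinct, the same letter one copy earlier sits exactly n positions earlier. *)
Definition nested n p := forall j, j \in p -> (n <= j)%N -> (j - n)%N \in p.

(** Used contrapositively: a first letter absent from the first copy is absent from all copies,
    which is the skip case of the recursion. *)
Lemma nested_dvd n p j : (0 < n)%N -> nested n p -> j \in p -> (n %| j)%N -> 0%N \in p.
Proof.
move=> n0 np; elim/ltn_ind: j => j IH jp nj; case: (posnP j) => [<- //|j0].
have nlj := dvdn_leq j0 nj; apply: (IH (j - n)%N); last by rewrite dvdn_subr.
  by rewrite ltn_subrL n0.
exact: np.
Qed.

Lemma not_descent_notin s z : s \in S -> all (mem S) z -> s \notin z ->
  ~~ (ell (s * wprod z)%g < ell (wprod z))%N.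
Proof.
move=> sS zS sz; rewrite ell_mull ?wprodW // root_nneg; last first.
  by rewrite root_rep ?root_alpha // groupV wprodW.
rewrite negbK; have /orP[//|/nnegP/(_ s)] :
    nneg (act (wprod z)^-1%g (a s)) || nneg (- act (wprod z)^-1%g (a s)).
  by apply: root_sign; rewrite root_rep ?root_alpha // groupV wprodW.
by rewrite coN rep_wordV_co // co_alpha eqxx oppr_ge0 ler10.
Qed.

(** The elements met on the way lie in the parabolic subgroup without [s], so [s] is never a descent
    and is passed over. The condition on [n0] and [n] says that both searches start at corresponding
    places. *)
Lemma greedy_skip s cw n n0 z p : s \in S -> all (mem S) cw -> s \notin cw -> (0 < size cw)%N ->
  all (mem S) z -> s \notin z -> (forall i, (n0 <= skip_pos cw i)%N = (n <= i)%N) ->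
  greedy (cinf cw) n (wprod z) p ->
  greedy (cinf (s :: cw)) n0 (wprod z) (map (skip_pos cw) p).
Proof.
move=> sS cwS sN cw0; elim: p n n0 z => //= j p IH n n0 z zS sz nE [nj dj mj g].
have jcw : cinf cw j \in cw by rewrite mem_nth // ltn_mod.
split; rewrite ?nE ?cinf_skip //.
- move=> i /andP[n0i ij]; have [/dvdnP[d ->]|/skip_pos_surj[i' iE]] := boolP (size (s :: cw) %| i)%N.
    by rewrite /cinf modnMl not_descent_notin.
  rewrite iE cinf_skip //; apply: mj; rewrite -nE -iE n0i /=.
  by rewrite ltnNge -(skip_pos_le cw) -ltnNge -iE.
- rewrite -wprod_cons; apply: (IH j.+1) => /=.
  + by rewrite zS andbT; apply: (allP cwS).
  + by rewrite inE negb_or sz andbT; apply: contraNneq sN => ->.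
  + by move=> i; apply: (leqW_mono (skip_pos_le cw)).
  + by rewrite wprod_cons.
Qed.

Lemma greedy_unskip s cw n n0 w p : (0 < size cw)%N ->
  (forall i, (n0 <= skip_pos cw i)%N = (n <= i)%N) ->
  greedy (cinf (s :: cw)) n0 w (map (skip_pos cw) p) -> greedy (cinf cw) n w p.
Proof.
move=> cw0; elim: p n n0 w => //= j p IH n n0 w nE; rewrite nE cinf_skip // => -[nj dj mj g].
split=> // [i /andP[ni ij]|]; last by apply: IH g => i; apply: (leqW_mono (skip_pos_le cw)).
by rewrite -(cinf_skip s) //; apply: mj; rewrite nE ni skip_pos_lt.
Qed.

(** Skipping a letter re-indexes positions by [skip_pos]; using it puts position 0 in front and
    shifts the positions of the rotated word by one. *)
Lemma csort_greedy cw wd A D : uniq cw -> all (mem S) cw -> csort cw wd A D ->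
  exists p, [/\ greedy (cinf cw) 0 (wprod wd) p, map (cinf cw) p = wd & nested (size cw) p].
Proof.
move=> uJ cwS cs.
have move_step s cw' wd' p' : s \in S -> all (mem S) wd' -> nneg (act (wprod wd')^-1%g (a s)) ->
    [/\ greedy (cinf (rcons cw' s)) 0 (wprod wd') p', map (cinf (rcons cw' s)) p' = wd'
      & nested (size (rcons cw' s)) p'] ->
    exists p, [/\ greedy (cinf (s :: cw')) 0 (wprod (s :: wd')) p,
      map (cinf (s :: cw')) p = s :: wd' & nested (size (s :: cw')) p].
  move=> sS wdS asc [g E ne]; exists (0%N :: map succn p'); split=> /=.
  - have f0 : cinf (s :: cw') 0 = s by rewrite /cinf mod0n.
    split=> //; rewrite ?f0 wprod_cons SmulK //.
      by rewrite ell_asc // wprodW.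
    by apply/greedy_succ; apply: eq_greedy g => i; rewrite /= cinf_rot.
  - rewrite {1}/cinf mod0n /= -map_comp -[in RHS]E; congr (_ :: _).
    by apply: eq_map => i; rewrite /= cinf_rot.
  - move=> j; rewrite inE => /predU1P[-> //|/mapP[i ip ->]]; rewrite ltnS => ni.
    (* Position [size cw'] of the rotated word is the next copy of [s]; one copy earlier lies the
       new position 0. *)
    rewrite inE; move: ni; rewrite leq_eqVlt => /predU1P[->|ni]; first by rewrite subnn eqxx.
    rewrite subSS; have := ne i ip; rewrite size_rcons ni => /(_ isT) ip'.
    apply/orP; right; apply/mapP; exists (i - (size cw').+1)%N => //.
    by rewrite subnS prednK // subn_gt0.
elim: cs uJ cwS => {cw wd A D}.
- by exists [::]; split=> //; apply: wprod_nil.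
- move=> s cw wd A D cs IH /= /andP[sN uJ] /andP[sS cwS].
  have sp := csortP uJ cwS cs; have [wdS wdcw] := cs_word sp.
  have [p [g E ne]] := IH uJ cwS; have [cw0|cw0] := posnP (size cw).
    move: wdcw; rewrite (size0nil cw0) => wd0.
    have -> : wd = [::] by case: (wd) wd0 => // t z /(_ t (mem_head _ _)).
    by exists [::]; split=> //; apply: wprod_nil.
  exists (map (skip_pos cw) p); split.
  + apply: (greedy_skip sS cwS sN cw0 wdS _ _ g) => //.
    by apply: contra sN => /wdcw.
  + by rewrite -map_comp -[RHS]E; apply: eq_map => i; rewrite /= cinf_skip.
  + move=> _ /mapP[i ip ->]; rewrite skip_pos_ge // => ni.
    by rewrite skip_pos_sub // map_f // ne.
- move=> s cw wd A D cs IH asc _ uJ cwS; have /andP[sS cwS'] := cwS.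
  have uJ' : uniq (rcons cw s) by rewrite rcons_uniq.
  have cwS1 : all (mem S) (rcons cw s) by rewrite all_rcons.
  have [p hp] := IH uJ' cwS1; have [wdS _] := cs_word (csortP uJ' cwS1 cs).
  exact: move_step hp.
- move=> s cw wd A1 A2 D cs IH uJ cwS; have /andP[sS cwS'] := cwS.
  have uJ' : uniq (rcons cw s) by rewrite rcons_uniq.
  have cwS1 : all (mem S) (rcons cw s) by rewrite all_rcons.
  have [p hp] := IH uJ' cwS1; have sp := csortP uJ' cwS1 cs; have [wdS _] := cs_word sp.
  apply: move_step hp => //; apply: (cs_A sp).
  by rewrite mem_cat mem_head orbT.
Qed.

(** Position 0 decides whether the first letter is skipped or used, and in the latter case
    membership of [a s] in A decides between [CsCover] and [CsMove]. The rank decreases in the first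
    case, the number of positions in the second. *)
Lemma greedy_csort n cw p w : size cw = n -> uniq cw -> all (mem S) cw -> w \in W ->
  greedy (cinf cw) 0 w p -> nested n p -> exists A D, csort cw (map (cinf cw) p) A D.
Proof.
elim: n cw p w => [|n IHn] cw p w.
  move/size0nil=> -> _ _ _; case: p => [|j p] /=; first by exists [::], [::]; apply: CsNil.
  by case=> _; rewrite /cinf nth_nil mul1g ltnn.
have [m] := ubnP (size p); elim: m cw p w => // m IHm [|s cw] // p w.
rewrite ltnS => szp [szcw] uJ cwS wW g ne; have /andP[sS cwS'] := cwS.
have [p0|p0] := boolP (0%N \in p).
  case: p p0 szp g ne => // j p p0 szp g ne.
  have j0 : j = 0%N.
    move: p0 g; rewrite inE => /predU1P[<- //|p0 [_ _ _ /greedy_ge/allP/(_ _ p0)]].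
    by rewrite ltn0.
  rewrite j0 in szp g ne *; case: g => _.
  have f0 : cinf (s :: cw) 0 = s by rewrite /cinf mod0n.
  rewrite f0 => dj _ g.
  have pE : p = map succn (map predn p).
    rewrite -map_comp -[LHS]map_id; apply/eq_in_map => i /(allP (greedy_ge g)) i0 /=.
    by rewrite prednK.
  pose p' := map predn p; rewrite -/p' in pE.
  have g' : greedy (cinf (rcons cw s)) 0 (s * w)%g p'.
    apply: (eq_greedy (f := cinf (s :: cw) \o succn)) => [i|]; first by rewrite /= cinf_rot.
    by apply/greedy_succ; rewrite -pE.
  have uJ' : uniq (rcons cw s) by rewrite rcons_uniq.
  have cwS1 : all (mem S) (rcons cw s) by rewrite all_rcons.
  have szr : size (rcons cw s) = n.+1 by rewrite size_rcons szcw.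
  have ne' : nested n.+1 p'.
    move=> i ip ni; have := ne i.+1; rewrite inE pE mem_map ?ip; last exact: succn_inj.
    rewrite leqW // => /(_ isT isT); rewrite subSn // inE /= mem_map //; exact: succn_inj.
  have szp' : (size p' < m)%N by rewrite size_map; apply: szp.
  have [A [D cs]] := IHm _ _ _ szp' szr uJ' cwS1 (mulSW sS wW) g' ne'.
  have sp := csortP uJ' cwS1 cs.
  have cinfS j' : cinf (rcons cw s) j' \in S.
    by apply: (allP cwS1); rewrite mem_nth // ltn_mod size_rcons.
  have wE : wprod (map (cinf (rcons cw s)) p') = (s * w)%g by apply: greedy_prod g' _.
  have asc : nneg (act (s * w)^-1%g (a s)).
    have swW := mulSW sS wW.
    have := ell_mull swW sS; rewrite SmulK // ltnNge (ltnW dj) root_nneg.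
      by case: (nneg _).
    by rewrite root_rep ?root_alpha ?groupV.
  have mE : map (cinf (s :: cw)) p = map (cinf (rcons cw s)) p'.
    by rewrite pE -map_comp; apply: eq_map => i; rewrite /= cinf_rot.
  rewrite map_cons f0 mE; have [sA|sA] := boolP (a s \in A).
    case/path.splitPr: sA cs => A1 A2 cs.
    exists (map (fun v => act s v) (A1 ++ A2)), (a s :: map (fun v => act s v) D).
    exact: CsCover.
  exists (map (fun v => act s v) A), (map (fun v => act s v) D).
  by apply: CsMove => //; rewrite wE.
have pN j : j \in p -> ~~ (size (s :: cw) %| j)%N.
  move=> jp; apply: contra p0 => d; apply: nested_dvd jp d => //.
  by rewrite /= szcw.
have [p' pE] : exists p', p = map (skip_pos cw) p'.
  elim: (p) pN => [|j p1 IHp] pN; first by exists [::].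
  have [|p' ->] := IHp; first by move=> i ip; apply: pN; rewrite inE ip orbT.
  by have [i ->] := skip_pos_surj (pN j (mem_head _ _)); exists (i :: p').
have /andP[sN uJ'] := uJ.
have [cw0|cw0] := posnP (size cw).
  have p0' : p = [::].
    by case: (p) pN => // j p1 /(_ j (mem_head _ _)); rewrite /= cw0 dvd1n.
  have [||A [D cs]] := IHn cw [::] 1%g szcw uJ' cwS' (group1 W); rewrite // p0' /=.
  by exists (a s :: A), D; apply: CsSkip.
have g' : greedy (cinf cw) 0 w p' by apply: (greedy_unskip (n0 := 0) cw0) => //; rewrite -pE; apply: g.
have ne' : nested n p'.
  move=> i ip; rewrite -szcw => ni.
  have := ne (skip_pos cw i); rewrite pE map_f // -szcw skip_pos_ge // ni => /(_ isT isT).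
  rewrite skip_pos_sub // mem_map //; exact: incn_inj (skip_pos_le cw).
have [A [D cs]] := IHn cw p' w szcw uJ' cwS' wW g' ne'.
exists (a s :: A), D; have -> : map (cinf (s :: cw)) p = map (cinf cw) p'.
  by rewrite pE -map_comp; apply: eq_map => i; rewrite /= cinf_skip.
exact: CsSkip.
Qed.

Lemma csort_reduced cw wd A D : uniq cw -> all (mem S) cw -> csort cw wd A D ->
  ell (wprod wd) = size wd.
Proof.
move=> uJ cwS cs; elim: cs uJ cwS => {cw wd A D}.
- by rewrite wprod_nil wlength1.
- by move=> s cw wd A D _ IH /= /andP[_ uJ] /andP[_ cwS]; apply: IH.
- move=> s cw wd A D cs IH asc _ /= uJ /andP[sS cwS].
  have uJ' : uniq (rcons cw s) by rewrite rcons_uniq.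
  have cwS1 : all (mem S) (rcons cw s) by rewrite all_rcons /= sS.
  by rewrite wprod_cons ell_asc ?IH ?(cs_wordW (csortP uJ' cwS1 cs)).
- move=> s cw wd A1 A2 D cs IH /= uJ /andP[sS cwS].
  have uJ' : uniq (rcons cw s) by rewrite rcons_uniq.
  have cwS1 : all (mem S) (rcons cw s) by rewrite all_rcons /= sS.
  have sp := csortP uJ' cwS1 cs.
  rewrite wprod_cons ell_asc ?IH ?(cs_wordW sp) //; apply: (cs_A sp).
  by rewrite mem_cat mem_head orbT.
Qed.

Lemma inversion_seq_cons s wd : s \in S ->
  inversion_seq (s :: wd) = s :: map (fun t => t ^ s)%g (inversion_seq wd).
Proof.
move=> sS; rewrite /inversion_seq /= big_seq1; congr (_ :: _).
rewrite -[1%N]addn0 iotaDl -!map_comp; apply: eq_map => i /=.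
rewrite big_cons rev_cons -rcons_cons -rcons_cat.
rewrite -[(\prod_(r <- rcons _ _) r)%g]/(wprod (rcons _ _)) wprod_rcons.
by rewrite conjgE SV // mulgA.
Qed.

Lemma inversion_seqW wd t : all (mem S) wd -> t \in inversion_seq wd -> t \in W.
Proof.
elim: wd t => [|s wd IH] t //= /andP[sS wdS]; rewrite inversion_seq_cons // inE.
by case/predU1P=> [->|/mapP[r /(IH _ wdS) rW ->]]; [apply: S_in_W | apply: groupJ rW (S_in_W sS)].
Qed.

Lemma pos_tau_alpha s b : s \in S -> pos b -> tau b = s -> b = a s.
Proof.
move=> sS pb bs; have rb := pos_root pb; apply: pos_alpha (pos_nneg pb) => // t ts.
have := refl_span sS rb bs (mem_head _ [::]); rewrite span_seq1 => /vlineP[c cE].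
have c0 : c != 0.
  by apply: contraNneq (alpha_neq0 s) => c0; rewrite cE c0 scale0r.
have := congr1 (fun v => co v t) cE; rewrite co_alpha eq_sym (negPf ts) coZ => /esym/eqP.
by rewrite mulf_eq0 (negPf c0) => /eqP.
Qed.

Lemma inversion_seq_lt wd t : all (mem S) wd -> t \in inversion_seq wd ->
  (ell (t * wprod wd)%g < size wd)%N.
Proof.
elim: wd t => [|s wd IH] t //= /andP[sS wdS]; rewrite inversion_seq_cons // wprod_cons inE.
case/predU1P=> [->|/mapP[r rI ->]]; first by rewrite SmulK // ltnS wlength_wprod.
have -> : (r ^ s * (s * wprod wd) = s * (r * wprod wd))%g.
  by rewrite conjgE SV // -!mulgA SmulK.
have gen (g : gT) : g \in W -> g \in (<<S>>)%g by rewrite (geo_gen G).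
apply: leq_ltn_trans (wlength_mull sS (gen _ _)) _; last exact: IH.
by rewrite groupM ?wprodW // (inversion_seqW wdS).
Qed.

(** D and the inversion sequence follow the same recursion: conjugate by [s], and put [s] in front.
    In the cover case [s] cannot occur a second time, since it would have to be an inversion of an
    element for which it is an ascent. *)
Lemma csort_inversions cw wd A D : uniq cw -> all (mem S) cw -> csort cw wd A D ->
  map tau D = [seq t <- inversion_seq wd | t \in map tau D].
Proof.
move=> uJ cwS cs; elim: cs uJ cwS => {cw wd A D} //.
- by move=> s cw wd A D _ IH /= /andP[_ uJ] /andP[_ cwS]; apply: IH.
- move=> s cw wd A D cs IH asc sA uJ cwS0; have /andP[sS cwS] := cwS0.
  have uJ' : uniq (rcons cw s) by rewrite rcons_uniq.
  have cwS1 : all (mem S) (rcons cw s) by rewrite all_rcons.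
  have sp := csortP uJ' cwS1 cs.
  have rD : {in D, forall b, isroot b} by move=> b bD; have [/pos_root] := cs_posD sp bD.
  rewrite tau_conj_seq // inversion_seq_cons // [filter _ _]/=.
  case: ifP => [/mapP[_ /mapP[d dD ->] sE]|_].
    have ds : tau d = s.
      by apply: (conjg_inj s); rewrite -sE conjgE mulKg.
    have [pd _] := cs_posD sp dD.
    by have := step_notin sp asc; rewrite -(pos_tau_alpha sS pd ds) dD.
  rewrite filter_map {1}(IH uJ' cwS1); congr map; apply: eq_filter => t.
  exact/esym/(mem_map (f := fun t => (t ^ s)%g) (@conjg_inj _ s)).
- move=> s cw wd A1 A2 D cs IH uJ cwS0; have /andP[sS cwS] := cwS0.
  have uJ' : uniq (rcons cw s) by rewrite rcons_uniq.
  have cwS1 : all (mem S) (rcons cw s) by rewrite all_rcons.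
  have sp := csortP uJ' cwS1 cs; have [wdS _] := cs_word sp; have wW := wprodW wdS.
  have asc : nneg (act (wprod wd)^-1%g (a s)).
    by apply: (cs_A sp); rewrite mem_cat mem_head orbT.
  have rD : {in D, forall b, isroot b} by move=> b bD; have [/pos_root] := cs_posD sp bD.
  rewrite map_cons tau_alpha // tau_conj_seq // inversion_seq_cons // [filter _ _]/= mem_head.
  congr (_ :: _).
  rewrite filter_map {1}(IH uJ' cwS1); congr map; apply: eq_in_filter => t tI /=.
  rewrite inE (mem_map (f := fun t => (t ^ s)%g) (@conjg_inj _ s)).
  case: eqP => //= ts; have {ts} ts : t = s.
    by apply: (conjg_inj s); rewrite ts conjgE mulKg.
  have := inversion_seq_lt wdS tI; rewrite ts -(csort_reduced uJ' cwS1 cs) ell_asc //.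
  by rewrite ltnNge leqnSn.
Qed.

Lemma mem_covers cw wd A D t : csort_spec cw wd A D ->
  (t \in covers S (wprod wd)) = (t \in map tau D).
Proof.
move=> sp; have wW := cs_wordW sp.
apply/imsetP/mapP => [[r]|[d dD ->]].
  rewrite inE => /andP[rS]; rewrite descentP // => n ->.
  exists (- act (wprod wd) (a r)); first exact: (cs_cov sp).
  by rewrite tauN ?tau_conj // root_rep ?root_alpha.
have [r rS dE] := cs_D sp dD; exists r; last first.
  by rewrite dE tauN ?tau_conj // root_rep ?root_alpha.
have [pd _] := cs_posD sp dD.
by rewrite inE rS descentP // -dE; apply: pos_nneg pd.
Qed.

(** * Reading's map through the recursion, and comparison of the two inversion sets *)

Section Main.
Variable cw : seq gT.
Hypotheses (uJ : uniq cw) (cwS : all (mem S) cw) (Scw : {subset S <= cw}).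

Lemma sorting_positions_greedy w : w \in W -> greedy (cinf cw) 0 w (sorting_positions S cw w).
Proof.
move=> wW; have wS : w \in (<<S>>)%g by rewrite (geo_gen G).
have [/andP[sp rp] mp] := sorting_positionsP Scw wS.
apply: lexmin_greedy => //; first exact/allP.
  exact/allP.
by move=> p' sp' _ rp'; apply: mp; apply/andP.
Qed.

Lemma sorting_positions_lt w j : j \in sorting_positions S cw w ->
  (j < size cw * ell w)%N.
Proof.
rewrite /sorting_positions; case: pickP => [p _ /mapP[i _ ->]|_ //].
exact: ltn_ord.
Qed.

(** Blocks compare letters whereas [nested] compares positions: distinctness of the letters makes
    equal letters have equal residues, and the bound on positions keeps the block index in the range
    of [sortable]. *)
Lemma sortableE w : (w \in sortable W S cw) <->
  w \in W /\ nested (size cw) (sorting_positions S cw w).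
Proof.
have blockP i t : reflect (exists j, [/\ j \in sorting_positions S cw w, (j %/ size cw = i)%N
    & t = cinf cw j]) (t \in sorting_block S cw w i).
  rewrite inE; apply: (iffP mapP) => [[j]|[j [jp ji ->]]].
    by rewrite mem_filter => /andP[/eqP ji jp] ->; exists j.
  by exists j => //; rewrite mem_filter ji eqxx.
rewrite inE; split=> [/andP[wW /forallP ne]|[wW ne]]; last first.
  rewrite wW; apply/forallP => i; apply/subsetP => t /blockP[j [jp ji ->]].
  have n0 : (0 < size cw)%N by move: ji; case: (size cw).
  have nj : (size cw <= j)%N by rewrite -[size cw]mul1n -leq_divRL // ji.
  apply/blockP; exists (j - size cw)%N; split; first exact: ne.
    by move: ji; rewrite -{1}(subnK nj) divnDr // divnn n0 addn1 => -[].
  by rewrite /cinf -[in LHS](subnK nj) modnDr.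
split=> // j jp nj; have jl := sorting_positions_lt jp.
have n0 : (0 < size cw)%N by case: (size cw) jl.
have j1 : (0 < j %/ size cw)%N by rewrite divn_gt0.
have jl' : ((j %/ size cw).-1 < ell w)%N.
  by apply: leq_ltn_trans (leq_pred _) _; rewrite ltn_divLR // mulnC.
have /subsetP/(_ (cinf cw j)) := ne (Ordinal jl'); rewrite /= prednK // => sub.
have /blockP[j' [jp' ji' E]] : cinf cw j \in sorting_block S cw w (j %/ size cw).-1.
  by apply: sub; apply/blockP; exists j.
suff <- : j' = (j - size cw)%N by [].
have mE : (j' %% size cw = j %% size cw)%N.
  apply/eqP; rewrite -(nth_uniq 1%g _ _ uJ) ?ltn_mod //.
  by rewrite -[nth _ _ _]/(cinf cw j') -E.
rewrite (divn_eq j' (size cw)) mE ji' {3}(divn_eq j (size cw)).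
by rewrite -{2}(prednK j1) mulSn -addnA addKn.
Qed.

Lemma Read_csort w wd A D : csort cw wd A D -> sorting_word S cw w = wd -> wprod wd = w ->
  Read S cw w = wprod (map tau D).
Proof.
move=> cs wdE wE; have sp := csortP uJ cwS cs.
rewrite /Read wdE (csort_inversions uJ cwS cs) /wprod big_filter.
by apply: eq_bigl => t; rewrite -wE (mem_covers _ sp).
Qed.

Lemma sortable_csort w : w \in sortable W S cw ->
  exists A D, csort cw (sorting_word S cw w) A D /\ wprod (sorting_word S cw w) = w.
Proof.
case/sortableE=> wW ne; have g := sorting_positions_greedy wW.
have [A [D cs]] := greedy_csort erefl uJ cwS wW g ne.
exists A, D; split=> //; apply: greedy_prod g _ => j jp.
apply: (allP cwS); rewrite mem_nth // ltn_mod.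
by case: (size cw) (sorting_positions_lt jp).
Qed.

Lemma csort_sortable wd A D : csort cw wd A D ->
  wprod wd \in sortable W S cw /\ sorting_word S cw (wprod wd) = wd.
Proof.
move=> cs; have [p [g E ne]] := csort_greedy uJ cwS cs.
have wW := cs_wordW (csortP uJ cwS cs).
have pE : sorting_positions S cw (wprod wd) = p.
  exact: greedy_uniq (sorting_positions_greedy wW) g.
split; last by rewrite /sorting_word pE.
by apply/sortableE; rewrite pE.
Qed.

(** Surjectivity rules out the default value of [Read_inv]; whichever sortable element is picked,
    its sorting word carries its own A and D, with the required product. *)
Lemma Read_inv_csort (y : gT) : (exists xs ys, realizable cw xs ys /\ wprod ys = y) ->
  exists wd A D, [/\ csort cw wd A D, wprod (map tau D) = y & Read_inv W S cw y = wprod wd].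
Proof.
case=> xs [ys [rl yE]]; have [wd [A [D [cs E]]]] := csort_onto uJ cwS rl.
have [so wE] := csort_sortable cs; rewrite /Read_inv.
case: pickP => [w /andP[wso /eqP wy]|/(_ (wprod wd))]; last first.
  by rewrite /= so (Read_csort cs wE) // E yE eqxx.
have [A' [D' [cs' wE']]] := sortable_csort wso.
exists (sorting_word S cw w), A', D'; split=> //.
by rewrite -wy (Read_csort cs').
Qed.

(** Shortest reflection words for x and x^-1 c have total length that of c, which is at most the
    rank because simple reflections are reflections. *)
Lemma NC_realizable (x : gT) : x \in NC W S (wprod cw) ->
  exists xs ys, realizable cw xs ys /\ wprod ys = (x^-1 * wprod cw)%g.
Proof.
rewrite inE => /andP[xW /eqP ab]; have cW := wprodW cwS.
have WT (g : gT) : g \in W -> g \in (<<T>>)%g.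
  rewrite -(geo_gen G); apply: (subsetP (genS _)); apply/subsetP => s; exact: reflS.
have [xs [xsT xE xl]] := wlength_word (WT x xW).
have [ys [ysT yE yl]] := wlength_word (WT (x^-1 * wprod cw)%g (groupM (groupVr xW) cW)).
exists xs, ys; split=> //; split.
- exact/allP.
- exact/allP.
- rewrite xl yl ab; apply: wlength_wprod; apply/allP => s /(allP cwS); exact: reflS.
- by rewrite xE yE mulKVg.
Qed.

(** For b = x^-1 a_s both y^-1 b and w^-1 b are negative. If b is positive both memberships hold;
    otherwise the positive root of the reflection is -b and both fail. *)
Lemma NC_inversion s (x : gT) : s \in S -> (ell (s * wprod cw) < ell (wprod cw))%N ->
  x \in NC W S (wprod cw) -> forall y : gT, y = (x^-1 * wprod cw)%g ->
  (x^-1 * s * x)%g \in inversions W S y <->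
  (x^-1 * s * x)%g \in inversions W S (Read_inv W S cw y).
Proof.
move=> sS hs xNC y yE; have xW : x \in W by move: xNC; rewrite inE => /andP[].
have cW := wprodW cwS; have cVW := groupVr cW; have xVW := groupVr xW.
have [wd [A [D [cs Dy ->]]]] : exists wd A D,
    [/\ csort cw wd A D, wprod (map tau D) = y & Read_inv W S cw y = wprod wd].
  by apply: Read_inv_csort; rewrite yE; apply: NC_realizable.
have sp := csortP uJ cwS cs; have wW := cs_wordW sp.
have yW : y \in W by rewrite yE groupM.
rewrite ell_mull // in hs.
pose b := act x^-1%g (a s); have rb : isroot b by rewrite root_rep ?root_alpha.
have tE : tau b = (x^-1 * s * x)%g by rewrite tau_conj // invgK.
have bE : b = act y (act (wprod cw)^-1%g (a s)).
  by rewrite -repM // yE mulgK.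
have ny : nneg (- act y^-1%g b) by rewrite bE repK.
have nw : nneg (- act (wprod wd)^-1%g b).
  by rewrite bE -Dy; apply: (initial_root_sign uJ cwS sp) => //; apply: pos_alphaS.
have tT : tau b \in T := tau_refl rb.
rewrite -tE !inE tT /=; case/orP: (root_sign rb) => p.
  have pb : pos b by rewrite root_pos.
  by rewrite !refl_lt // ny nw.
have pb : pos (- b) by rewrite root_pos ?isrootN.
have neg g : g \in W -> nneg (- act g^-1%g b) -> nneg (act g^-1%g b) = false.
  by move=> gW; rewrite (root_nneg (root_rep (groupVr gW) rb)) => /negbTE.
by rewrite -(tauN rb) !refl_lt // !repN !opprK !neg.
Qed.

End Main.

Lemma wlength_uniq z : uniq z -> all (mem S) z -> ell (wprod z) = size z.
Proof.
elim: z => [|s z IH] /=; first by rewrite wprod_nil wlength1.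
case/andP=> sz uz /andP[sS zS]; have zW := wprodW zS.
rewrite wprod_cons ell_asc ?IH //; have := not_descent_notin sS zS sz.
by rewrite ell_mull // root_nneg ?negbK // root_rep ?root_alpha ?groupV.
Qed.

(** [cw] is only given as a reduced expression of c. It contains every generator r, since a word
    avoiding r preserves all r-coordinates and c does not; its length is the number of generators,
    so no letter repeats. *)
Lemma coxeter_word (c : gT) cw : standard_coxeter_element S c -> reduced_expr S c cw ->
  [/\ uniq cw, all (mem S) cw, {subset S <= cw} & wprod cw = c].
Proof.
case=> z zS cz /and3P[cwS /eqP cwc /eqP szcw].
have zmem s : (s \in z) = (s \in S) by rewrite (perm_mem zS) mem_enum.
have uz : uniq z by rewrite (perm_uniq zS) enum_uniq.
have zSS : all (mem S) z by apply/allP => s; rewrite zmem.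
have Scw : {subset S <= cw}.
  move=> r rS; apply/negPn/negP => rcw.
  have rz : r \in z by rewrite zmem.
  have E : wprod cw = wprod z by rewrite /wprod cwc cz.
  case/path.splitPr: rz E zSS uz => z1 z2 E.
  rewrite all_cat /= => /and3P[z1S _ z2S]; rewrite cat_uniq /= negb_or.
  case/and4P=> _ /andP[rz1 _] rz2 _.
  (* Test vector with [r]-coordinate 1: [z2] carries it to [a r], then [r] negates it, and [z1]
     keeps the resulting coordinate -1. *)
  have := rep_word_co (act (wprod z2)^-1%g (a r)) cwS rcw; rewrite E wprod_cat wprod_cons.
  rewrite (repM _ (wprodW z1S) (mulSW rS (wprodW z2S))) (repM _ (S_in_W rS) (wprodW z2S)).
  rewrite repVK ?wprodW // rep_alpha // repN coN rep_word_co // rep_wordV_co // co_alpha eqxx.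
  by rewrite !mulr1n => /eqP; rewrite eqNr oner_eq0.
split=> //; apply: (leq_size_uniq uz) => [s|]; first by rewrite zmem; apply: Scw.
by rewrite szcw cz -[(\prod_(s <- z) s)%g]/(wprod z) wlength_uniq.
Qed.

End CoxeterTheory.

Local Close Scope ring_scope.
Local Open Scope group_scope.

Theorem lemma4p6 (gT : finGroupType) (W : {group gT}) (S : {set gT})
    (hWS : coxeter_system W S)
    (c : gT) (hc : standard_coxeter_element S c)
    (cw : seq gT) (hcw : reduced_expr S c cw)
    (s : gT) (hs : s \in S) (hsc : wlength S (s * c) < wlength S c)
    (x : gT) (hx : x \in NC W S c)
    (y : gT) (hy : y = x^-1 * c) :
  (x^-1 * s * x \in inversions W S y) <->
  (x^-1 * s * x \in inversions W S (Read_inv W S cw y)).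
Proof.
have [q [u [u0 u1 uS num]]] := dihedral_numbers.
have um m : 1 < m -> u m m = 0%R by case/num.
have umS m : 1 < m -> u m m.+1 = (-1)%R by case/num.
have q4 m : 1 < m -> (q m * q m != 4)%R by case/num.
have [rho [rho1 rhoM rhoS]] := geometric_representation u0 u1 uS um umS q4 hWS.
have [genS S2 _] := hWS.
have G : geometric q u W S rho.
  split=> // [m k m1 km|s' s'S]; first by case: (num m m1) => _ _ _; apply.
  by rewrite -(expg_order s') (S2 _ s'S) expgS expg1.
have [uJ cwS Scw cwE] := coxeter_word G hc hcw.
rewrite -cwE in hsc hx hy.
exact: (NC_inversion G uJ cwS Scw hs hsc hx hy).
Qed.
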